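(* Let $\lambda,\gamma>0$ and let $f_0:\mathbb{R}\to[0,\infty)$, $g_0:\mathbb{R}^2\to[0,\infty)$ be measurable with $$\int_{\mathbb{R}}(1+\varphi^2)f_0\,\mathrm{d}\varphi<\infty,\qquad \int_{\mathbb{R}^2}(1+\varphi^2)g_0\,\mathrm{d}\varphi\,\mathrm{d}\varphi_*<\infty,\qquad g_0(\varphi,\varphi_* )=g_0(\varphi_*,\varphi),$$ $f_0\log f_0\in L^1(\mathbb{R})$ and $g_0\log g_0\in L^1(\mathbb{R}^2)$. For $\varepsilon>0$ let $(f_\varepsilon,g_\varepsilon)$ be the (mild) solution of $$\partial_tf_\varepsilon=2\Big(\gamma\int_{\mathbb{R}}g_\varepsilon\,\mathrm{d}\varphi_*-\lambda M_{f_\varepsilon}f_\varepsilon\Big),\qquad \varepsilon\,\partial_tg_\varepsilon+\nabla\cdot(v_1g_\varepsilon)=\lambda f_\varepsilon(\varphi,t)f_\varepsilon(\varphi_*,t)-\gamma g_\varepsilon,$$ with initial data $f_\varepsilon(\cdot,0)=f_0$, $g_\varepsilon(\cdot,\cdot,0)=g_0$. Then $$\lim_{\varepsilon\to0}f_\varepsilon(\cdot,t)=f(\cdot,t)\quad\text{weakly in }L^1(\mathbb{R}),\text{ locally uniformly in }t\in[0,\infty),$$ $$\lim_{\varepsilon\to0}g_\varepsilon(\cdot,\cdot,t)=g(\cdot,\cdot,t)\quad\text{tightly, locally uniformly in }t\in(0,\infty),$$ where $f$ is the solution of $$\partial_tf=Q_1(f,f):=\int_{\mathbb{R}}\int_0^\infty\sigma(s)\Big(e^sf\big(\Phi^{-s}(\varphi,\varphi_*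 ),t\big)f\big(\Phi^{-s}_*(\varphi,\varphi_* ),t\big)-f(\varphi,t)f(\varphi_*,t)\Big)\,\mathrm{d}s\,\mathrm{d}\varphi_*,\qquad f(t=0)=f_0,$$ with $\sigma(s)=2\lambda\gamma e^{-\gamma s}$, and $$g(\varphi,\varphi_*,t)=\lambda\int_0^\infty e^{(1-\gamma)s}f\big(\Phi^{-s}(\varphi,\varphi_* ),t\big)f\big(\Phi^{-s}_*(\varphi,\varphi_* ),t\big)\,\mathrm{d}s.$$
   Context: Here $\varphi,\varphi_*\in\mathbb{R}$, $\nabla=(\partial_\varphi,\partial_{\varphi_*})$, $v_1(\varphi,\varphi_* )=\frac{\varphi-\varphi_*}{2}(-1,1)$, $M_{f_\varepsilon}(t)=\int_{\mathbb{R}}f_\varepsilon(\varphi,t)\,\mathrm{d}\varphi$, and for $s\in\mathbb{R}$ $$\Phi^s(\varphi,\varphi_* )=\frac{\varphi+\varphi_*}{2}+e^{-s}\frac{\varphi-\varphi_*}{2},\qquad \Phi^s_*(\varphi,\varphi_* )=\frac{\varphi+\varphi_*}{2}+e^{-s}\frac{\varphi_*-\varphi}{2}.$$ The mild solution $(f_\varepsilon,g_\varepsilon)$ is the unique element of $C([0,\infty);L^1_+(\mathbb{R})\times L^1_+(\mathbb{R}^2))$ ($L^1_+$: nonnegative functions in $L^1$) satisfying $$f_\varepsilon(\varphi,t)=F_\varepsilon(0,t)f_0(\varphi)+2\gamma\int_0^tF_\varepsilon(s,t)\int_{\mathbb{R}}g_\varepsilon(\varphi,\varphi_*,s)\,\mathrm{d}\varphi_*\,\mathrm{d}s,$$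 $$g_\varepsilon(\cdot,\cdot,t)=S(t/\varepsilon)g_0+\frac\lambda\varepsilon\int_0^tS(s/\varepsilon)\big[f_\varepsilon(\cdot,t-s)f_{\varepsilon,*}(\cdot,t-s)\big]\,\mathrm{d}s,$$ where $F_\varepsilon(s,t)=\exp(-2\lambda\int_s^tM_{f_\varepsilon}(r)\,\mathrm{d}r)$, where $f_\varepsilon(\cdot,s)f_{\varepsilon,*}(\cdot,s)$ is the function $(\varphi,\varphi_* )\mapsto f_\varepsilon(\varphi,s)f_\varepsilon(\varphi_*,s)$, and $(S(t)g)(\varphi,\varphi_* )=e^{(1-\gamma)t}g(\Phi^{-t}(\varphi,\varphi_* ),\Phi^{-t}_*(\varphi,\varphi_* ))$. The mass $M_{f_\varepsilon}$ is determined by $\dot M_{f_\varepsilon}=2\gamma M_{g_\varepsilon}-2\lambda M_{f_\varepsilon}^2$, $\varepsilon\dot M_{g_\varepsilon}=\lambda M_{f_\varepsilon}^2-\gamma M_{g_\varepsilon}$ with $M_{f_\varepsilon}(0)=\int_{\mathbb{R}} f_0\,\mathrm{d}\varphi$, $M_{g_\varepsilon}(0)=\int_{\mathbb{R}^2} g_0\,\mathrm{d}\varphi\,\mathrm{d}\varphi_*$. ''The solution'' $f$ of the limit equation means its unique solution in $C([0,\infty);L^1(\mathbb{R}))$. Weak convergence in $L^1(\mathbb{R})$ is convergence tested against every $h\in L^\infty(\mathbb{R})$; tight convergence is convergence of measures tested against every bounded continuous $h\in C_b(\mathbb{R}^2)$. Locally uniformly in $t$ means that for every fixed test function the convergence of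 the corresponding integrals is uniform for $t$ in compact subsets of the indicated interval. *)

(* Defs.v *)
From HB Require Import structures.
From mathcomp Require Import all_boot all_order all_algebra.
From mathcomp Require Import all_classical all_reals all_analysis.

Set Implicit Arguments.
Unset Strict Implicit.
Unset Printing Implicit Defensive.

Import Order.TTheory GRing.Theory Num.Theory.
Import numFieldNormedType.Exports.

Local Open Scope classical_set_scope.
Local Open Scope ring_scope.

Notation leb R := (@lebesgue_measure R) (only parsing).
Notation leb2 R := (@lebesgue_measure R \x @lebesgue_measure R)%E (only parsing).

Section L1_curves.
Context d (T : measurableType d) (R : realType).
Variable mu : {measure set T -> \bar R}.

(* Elements of C([0, +oo[; L^1(mu)). A curve of classes is given by a jointly
   measurable representative [u t x]; every continuous L^1-valued curve has one,
   and joint measurability makes pointwise time integrals meaningful almost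
   everywhere. Values at negative times are irrelevant. *)
Definition C_L1 (u : R -> T -> R) : Prop :=
  [/\ measurable_fun ((`[0, +oo[%classic : set R) `*` [set: T])
        (fun p => u p.1 p.2),
      forall t, 0 <= t -> mu.-integrable [set: T] (EFin \o u t) &
      forall t0, 0 <= t0 ->
        (\int[mu]_x (`|u t x - u t0 x|)%:E)%E
          @[t --> within `[0, +oo[%classic (nbhs t0)] --> 0%E].

Definition C_L1_plus (u : R -> T -> R) : Prop :=
  C_L1 u /\ forall t, 0 <= t -> {ae mu, forall x, 0 <= u t x}.

(* The derivative is a norm limit in L^1; it is one-sided at t = 0. *)
Definition is_L1_derive (u : R -> T -> R) (t : R) (v : T -> R) : Prop :=
  (\int[mu]_x (`|h^-1 * (u (t + h) x - u t x) - v x|)%:E)%E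
    @[h --> within [set h | 0 <= t + h] 0^'] --> 0%E.

End L1_curves.

Section model.
Variable R : realType.
Implicit Types (lambda gamma eps s t x y : R) (z : R * R).

Definition Phi s z : R := (z.1 + z.2) / 2 + expR (- s) * ((z.1 - z.2) / 2).

Definition Phi_star s z : R := (z.1 + z.2) / 2 + expR (- s) * ((z.2 - z.1) / 2).

Definition semigroup gamma t (g : R * R -> R) : R * R -> R :=
  fun z => expR ((1 - gamma) * t) * g (Phi (- t) z, Phi_star (- t) z).

Definition tensor (u : R -> R) : R * R -> R := fun z => u z.1 * u z.2.

Definition mass (f : R -> R -> R) t : R := \int[leb R]_x f t x.

Definition damping lambda (f : R -> R -> R) s t : R :=
  expR (- (2 * lambda * \int[leb R]_(r in `[s, t]) mass f r)).

(* Both Duhamel formulas are identities in L^1, hence hold almost everywhere at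
   each time; at t = 0 they give the initial conditions. *)
Definition mild_solution lambda gamma eps (f0 : R -> R) (g0 : R * R -> R)
    (f : R -> R -> R) (g : R -> R * R -> R) : Prop :=
  [/\ C_L1_plus (leb R) f,
      C_L1_plus (leb2 R) g,
      forall t, 0 <= t -> {ae leb R, forall x,
        f t x = damping lambda f 0 t * f0 x +
          2 * gamma * \int[leb R]_(s in `[0, t])
            (damping lambda f s t * \int[leb R]_y g s (x, y))} &
      forall t, 0 <= t -> {ae leb2 R, forall z,
        g t z = semigroup gamma (t / eps) g0 z +
          lambda / eps * \int[leb R]_(s in `[0, t])
            semigroup gamma (s / eps) (tensor (f (t - s))) z}].

Definition sigma lambda gamma s : R := 2 * lambda * gamma * expR (- (gamma * s)).

Definition Q1 lambda gamma (u : R -> R) x : R :=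
  \int[leb R]_y \int[leb R]_(s in `[0, +oo[)
    (sigma lambda gamma s *
      (expR s * (u (Phi (- s) (x, y)) * u (Phi_star (- s) (x, y))) - u x * u y)).

Definition limit_solution lambda gamma (f0 : R -> R) (f : R -> R -> R) : Prop :=
  [/\ C_L1 (leb R) f,
      {ae leb R, forall x, f 0 x = f0 x} &
      forall t, 0 <= t -> is_L1_derive (leb R) f t (Q1 lambda gamma (f t))].

Definition limit_pair_density lambda gamma (f : R -> R -> R) t z : R :=
  lambda * \int[leb R]_(s in `[0, +oo[)
    (expR ((1 - gamma) * s) * (f t (Phi (- s) z) * f t (Phi_star (- s) z))).

Definition weak_L1_cvg_loc_unif (J : set R)
    (u : R -> R -> R -> R) (u0 : R -> R -> R) : Prop :=
  (forall t, J t -> (leb R).-integrable [set: R] (EFin \o u0 t)) /\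
  forall h : R -> R, h \in Lfun (leb R) +oo%E ->
  forall K : set R, compact K -> K `<=` J ->
  {uniform K, (fun eps t => \int[leb R]_x (u eps t x * h x)) @ 0^'+
     --> (fun t => \int[leb R]_x (u0 t x * h x))}.

(* Densities are identified with the finite measures they define, whence the
   integrability of the limit. *)
Definition tight_cvg_loc_unif (J : set R)
    (v : R -> R -> R * R -> R) (v0 : R -> R * R -> R) : Prop :=
  (forall t, J t -> (leb2 R).-integrable [set: R * R] (EFin \o v0 t)) /\
  forall h : R * R -> R, continuous h -> [bounded h z | z in [set: R * R]] ->
  forall K : set R, compact K -> K `<=` J ->
  {uniform K, (fun eps t => \int[leb2 R]_z (v eps t z * h z)) @ 0^'+
     --> (fun t => \int[leb2 R]_z (v0 t z * h z))}.

End model.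

(* Main.v *)
Require Import Defs.
From HB Require Import structures.
From mathcomp Require Import all_boot all_order all_algebra.
From mathcomp Require Import all_classical all_reals all_analysis.
From mathcomp Require Import measurable_realfun ess_sup_inf ring lra.

Set Implicit Arguments.
Unset Strict Implicit.
Unset Printing Implicit Defensive.

Import Order.TTheory GRing.Theory Num.Theory.
Import numFieldNormedType.Exports.

Local Open Scope classical_set_scope.
Local Open Scope ring_scope.

(** The pair density forgets its past on the time scale eps: the rescaled
    transport semigroup contracts the L^1 norm by exactly e^(- gamma t / eps),
    and during a time eps the single density f_eps barely moves. So after an
    initial layer of width eps, g_eps(t) is the response
    K(f_eps(t)) = lambda int_0^oo S(s) [f_eps(t) f_eps(t)'] ds to the present
    single density. Putting g = K(f) into the equation for f gives
    f' = c(f) := 2 gamma (marginal of K(f)) - 2 lambda M_f f, and c = Q1 almost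
    everywhere. All of this is quantitative in the norm of L^1, and the proof
    establishes convergence in that norm, which is stronger than the weak and
    tight convergences asked for.

    Uniform estimates. The total mass M_f + 2 eps M_g is conserved
    ([mass_conservation]), so the masses are bounded uniformly for eps <= 1 and
    f_eps is Lipschitz in L^1 ([f_lipschitz]). Comparing the Duhamel formula for
    g_eps with the one where f_eps is frozen at its present value gives
    ||g_eps(t) - K(f_eps(t))|| <= C (e^(- gamma t / eps) + eps) ([relaxation]).
    Restarting the Duhamel formula for f_eps at time a and inserting this bound
    shows that one explicit Euler step of f' = c(f), of length h, reproduces
    f_eps(a + h) up to C (h^2 + eps (1 + h)) ([euler_estimate]): the exponential
    in the relaxation bound has time integral eps / gamma, so the initial layer
    costs no more than O(eps).

    Limit. The operator c is Lipschitz on bounded sets of L^1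
    ([n1_collisionB_le]), so a discrete Gronwall argument over N equal steps
    bounds the distance of two such curves, with parameters eps1 and eps2, by
    a multiple of t^2 / N + (eps1 + eps2) (N + t) ([euler_dist_le]). Taking N
    large first and then eps small, the family is Cauchy, locally uniformly in
    time. Its limit obeys the Euler estimate with eps = 0
    ([limit_curve_euler]), which says that it is differentiable in L^1 with
    derivative c(f) = Q1(f, f) ([euler_derive]). The local Lipschitz bound on c
    also makes the solution unique ([limit_solution_unique]).

    Convergence of g_eps for t >= r > 0 follows from the relaxation bound,
    where the exponential is now O(eps), and from the local Lipschitz continuity
    of K ([strong_cvg_g]). *)

(** * The L^1 norm *)

Definition L1norm d (T : measurableType d) (R : realType)
    (mu : {measure set T -> \bar R}) (u : T -> R) : \bar R :=
  (\int[mu]_x (`|u x|)%:E)%E.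
Arguments L1norm : simpl never.
Notation n1 mu u := (L1norm mu u%R) (only parsing).

Section L1_norm.
Context d (T : measurableType d) (R : realType).
Variable mu : {measure set T -> \bar R}.
Implicit Types u v w : T -> R.

Lemma n1_ge0 u : (0 <= n1 mu u)%E.
Proof. by apply: integral_ge0 => x _; rewrite lee_fin. Qed.

Lemma measurable_normE u : measurable_fun setT u ->
  measurable_fun setT (fun x => (`|u x|)%:E : \bar R).
Proof. by move=> mu_; apply/measurable_EFinP/measurableT_comp. Qed.

Lemma n1_le u v : measurable_fun setT u -> measurable_fun setT v ->
  {ae mu, forall x, `|u x| <= `|v x|} -> (n1 mu u <= n1 mu v)%E.
Proof.
move=> mU mV uv; apply: ae_ge0_le_integral => //.
- exact: measurable_normE.
- exact: measurable_normE.
by apply: filterS uv => x h _; rewrite lee_fin.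
Qed.

Lemma n1_ae u v : measurable_fun setT u -> measurable_fun setT v ->
  {ae mu, forall x, u x = v x} -> n1 mu u = n1 mu v.
Proof.
move=> mU mV uv; apply/eqP; rewrite eq_le; apply/andP; split; apply: n1_le => //;
  by apply: filterS uv => x ->.
Qed.

Lemma eq_n1 u v : u =1 v -> n1 mu u = n1 mu v.
Proof. by move=> uv; apply: eq_integral => x _; rewrite uv. Qed.

Lemma n1D u v : measurable_fun setT u -> measurable_fun setT v ->
  (n1 mu (fun x => u x + v x) <= n1 mu u + n1 mu v)%E.
Proof.
move=> mU mV; rewrite /L1norm -ge0_integralD//; do ?exact: measurable_normE.
apply: ge0_le_integral => //.
- by apply: measurable_normE; exact: measurable_funD.
- by apply: emeasurable_funD; exact: measurable_normE.
- by move=> x _; rewrite -EFinD lee_fin ler_normD.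
Qed.

Lemma n1N u : n1 mu (fun x => - u x) = n1 mu u.
Proof. by apply: eq_integral => x _; rewrite normrN. Qed.

Lemma n1B u v : measurable_fun setT u -> measurable_fun setT v ->
  (n1 mu (fun x => u x - v x) <= n1 mu u + n1 mu v)%E.
Proof.
move=> mU mV; rewrite -(n1N v); apply: n1D => //.
exact: measurableT_comp.
Qed.

Lemma n1_distC u v : n1 mu (fun x => u x - v x) = n1 mu (fun x => v x - u x).
Proof. by apply: eq_integral => x _; rewrite distrC. Qed.

Lemma n1_trans w u v : measurable_fun setT u -> measurable_fun setT v ->
  measurable_fun setT w ->
  (n1 mu (fun x => u x - v x) <= n1 mu (fun x => u x - w x) + n1 mu (fun x => w x - v x))%E.
Proof.
move=> mU mV mW; rewrite [leLHS](_ : _ = n1 mu (fun x => (u x - w x) + (w x - v x))).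
  by apply: n1D; exact: measurable_funB.
by apply: eq_n1 => x; rewrite addrA subrK.
Qed.

Lemma n1Z (c : R) u : measurable_fun setT u ->
  n1 mu (fun x => c * u x) = (`|c|%:E * n1 mu u)%E.
Proof.
move=> mU; rewrite -ge0_integralZl_EFin//; last exact: measurable_normE.
by apply: eq_integral => x _; rewrite normrM EFinM.
Qed.

Lemma n1Z_lty (c : R) u : measurable_fun setT u -> (n1 mu u < +oo)%E ->
  (n1 mu (fun x => c * u x) < +oo)%E.
Proof.
by move=> mU uoo; rewrite n1Z// lte_mul_pinfty// lee_fin.
Qed.

Lemma n1D_lty u v : measurable_fun setT u -> measurable_fun setT v ->
  (n1 mu u < +oo)%E -> (n1 mu v < +oo)%E -> (n1 mu (fun x => u x + v x) < +oo)%E.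
Proof.
by move=> mU mV uoo voo; apply: le_lt_trans (n1D mU mV) _; exact: lte_add_pinfty.
Qed.

Lemma n1B_lty u v : measurable_fun setT u -> measurable_fun setT v ->
  (n1 mu u < +oo)%E -> (n1 mu v < +oo)%E -> (n1 mu (fun x => u x - v x) < +oo)%E.
Proof.
by move=> mU mV uoo voo; apply: le_lt_trans (n1B mU mV) _; exact: lte_add_pinfty.
Qed.

Lemma n1Z_le (k b c : R) u : measurable_fun setT u ->
  (n1 mu u <= b%:E)%E -> `|k| * b <= c -> (n1 mu (fun x => k * u x) <= c%:E)%E.
Proof.
move=> mU ub kc; rewrite n1Z//; apply: le_trans _ (_ : ((`|k| * b)%:E <= _)%E) => //.
by rewrite EFinM; apply: lee_wpmul2l.
Qed.

Lemma n1D_le (a b c : R) u v : measurable_fun setT u -> measurable_fun setT v ->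
  (n1 mu u <= a%:E)%E -> (n1 mu v <= b%:E)%E -> a + b <= c ->
  (n1 mu (fun x => u x + v x) <= c%:E)%E.
Proof.
move=> mU mV ua vb abc; apply: le_trans (n1D mU mV) _.
by apply: le_trans (leeD ua vb) _; rewrite -EFinD lee_fin.
Qed.

Lemma n1_trans_le (a b c : R) w u v : measurable_fun setT u -> measurable_fun setT v ->
  measurable_fun setT w ->
  (n1 mu (fun x => u x - w x) <= a%:E)%E -> (n1 mu (fun x => w x - v x) <= b%:E)%E ->
  a + b <= c -> (n1 mu (fun x => u x - v x) <= c%:E)%E.
Proof.
move=> mU mV mW ua vb abc; apply: le_trans (n1_trans mU mV mW) _.
by apply: le_trans (leeD ua vb) _; rewrite -EFinD lee_fin.
Qed.

Lemma integrable_n1P u : mu.-integrable setT (EFin \o u) <->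
  measurable_fun setT u /\ (n1 mu u < +oo)%E.
Proof.
by split => [/integrableP[/measurable_EFinP]|[mU uoo]] //; apply/integrableP; split => //;
  exact/measurable_EFinP.
Qed.

Lemma Rintegral_le_n1 u : measurable_fun setT u ->
  (`|\int[mu]_x u x|%:E <= n1 mu u)%E.
Proof.
move=> mU; have mE : measurable_fun setT (EFin \o u) by exact/measurable_EFinP.
apply: le_trans (le_abse_integral mu measurableT mE).
rewrite /Rintegral; case: (integral _ _ _) => //=.
all: by rewrite normr0 leey.
Qed.

Lemma integral_le_cst (D : set T) (h : T -> \bar R) (c : R) : measurable D ->
  measurable_fun D h -> (forall s, D s -> (0 <= h s)%E) ->
  (forall s, D s -> (h s <= c%:E)%E) ->
  (\int[mu]_(s in D) h s <= c%:E * mu D)%E.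
Proof. by move=> mD mh h0 hc; rewrite -integral_cst//; exact: ge0_le_integral. Qed.

Lemma ae_mono (P Q : T -> Prop) : (forall x, P x -> Q x) ->
  {ae mu, forall x, P x} -> {ae mu, forall x, Q x}.
Proof.
move=> PQ [N [mN N0 sub]]; exists N; split => // x /= nq.
by apply: sub => /= p; exact/nq/PQ.
Qed.

Lemma ae_mono2 (P Q S : T -> Prop) : (forall x, P x -> Q x -> S x) ->
  {ae mu, forall x, P x} -> {ae mu, forall x, Q x} -> {ae mu, forall x, S x}.
Proof. by move=> h p q; apply: filterS2 p q. Qed.

Lemma eq_Rintegral_ae u v : measurable_fun setT u -> measurable_fun setT v ->
  {ae mu, forall x, u x = v x} -> \int[mu]_x u x = \int[mu]_x v x.
Proof.
move=> mU mV uv; rewrite /Rintegral; congr fine; apply: ae_eq_integral => //.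
- exact/measurable_EFinP.
- exact/measurable_EFinP.
- by apply: ae_mono uv => x ->.
Qed.

Lemma n1_eq0_ae u v : measurable_fun setT u -> measurable_fun setT v ->
  n1 mu (fun x => u x - v x) = 0%E -> {ae mu, forall x, u x = v x}.
Proof.
move=> mU mV n0.
have mE : measurable_fun setT (fun x => (u x - v x)%:E).
  by apply/measurable_EFinP; exact: measurable_funB.
have [+ _] := ae_eq_integral_abs mu measurableT mE.
move=> /(_ n0); apply: filterS => x /(_ I) /eqP.
by rewrite eqe subr_eq0 => /eqP.
Qed.

Lemma n1_dist0 u v : measurable_fun setT u -> measurable_fun setT v ->
  {ae mu, forall x, u x = v x} -> n1 mu (fun x => u x - v x) = 0%E.
Proof.
move=> mU mV uv; rewrite (@n1_ae _ (fun=> 0)).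
- by apply: integral0_eq => x _; rewrite normr0.
- exact: measurable_funB.
- exact: measurable_cst.
- by apply: filterS uv => x ->; rewrite subrr.
Qed.

End L1_norm.
Arguments n1_le {d T R} mu {u v}.
Arguments eq_Rintegral_ae {d T R} mu {u v}.
Arguments n1_ae {d T R} mu {u v}.
Arguments n1Z_le {d T R} mu {k b c u}.
Arguments n1D_le {d T R} mu {a b c u v}.
Arguments n1_trans_le {d T R} mu {a b c w u v}.
Arguments n1_dist0 {d T R} mu {u v}.
Arguments n1_eq0_ae {d T R} mu {u v}.
Arguments n1Z_lty {d T R} mu c {u}.
Arguments n1D_lty {d T R} mu {u v}.
Arguments n1B_lty {d T R} mu {u v}.

(** * Integrals depending on a parameter *)

Section parameter_integrals.
Context dS dT (S : measurableType dS) (T : measurableType dT) (R : realType).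
Variable nu : {sigma_finite_measure set S -> \bar R}.
Variable mu : {sigma_finite_measure set T -> \bar R}.
Implicit Types (H : S -> T -> R) (D : set S).

Definition joint_meas H := measurable_fun setT (fun p : S * T => H p.1 p.2).

Lemma joint_meas_sec H s : joint_meas H -> measurable_fun setT (H s).
Proof. by move=> mH; exact: (measurableT_comp mH (measurable_pair1 _)). Qed.

Lemma joint_meas_sec2 H x : joint_meas H -> measurable_fun setT (H ^~ x).
Proof. by move=> mH; exact: (measurableT_comp mH (measurable_pair2 _)). Qed.

Lemma integral_indicM D (f : S -> R) : measurable D ->
  (\int[nu]_(s in D) (f s)%:E = \int[nu]_s (\1_D s * f s)%:E)%E.
Proof.
move=> mD; rewrite integral_mkcond; apply: eq_integral => s _.
rewrite patchE indicE; case: ifPn => sD; first by rewrite mul1r.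
by rewrite mul0r.
Qed.

Lemma joint_meas_indicM D H : measurable D -> joint_meas H ->
  joint_meas (fun s x => \1_D s * H s x).
Proof.
move=> mD mH; apply: measurable_funM => //.
exact: (measurableT_comp (@measurable_indic _ S R setT D mD)
  (@measurable_fst _ _ S T)).
Qed.

Lemma measurable_integral_param D H : measurable D -> joint_meas H ->
  measurable_fun setT (fun x => \int[nu]_(s in D) (H s x)%:E)%E.
Proof.
move=> mD mH.
under eq_fun do rewrite integral_indicM//.
have mDH := joint_meas_indicM mD mH.
pose f := fun p : S * T => (\1_D p.1 * H p.1 p.2)%:E.
have mf : measurable_fun setT f by exact/measurable_EFinP.
rewrite (_ : (fun _ => _) =
   (fun x => (\int[nu]_s f^\+ (s, x) - \int[nu]_s f^\- (s, x))%E)).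
  apply: emeasurable_funB.
    apply: (measurable_fun_fubini_tonelli_G (f^\+)%E) => //.
    exact: measurable_funepos.
  apply: (measurable_fun_fubini_tonelli_G (f^\-)%E) => //.
  exact: measurable_funeneg.
apply/funext => x; rewrite integralE.
by congr (_ - _)%E; apply: eq_integral => s _; rewrite ?funeposE ?funenegE.
Qed.

Lemma measurable_Rintegral_param D H : measurable D -> joint_meas H ->
  measurable_fun setT (fun x => \int[nu]_(s in D) H s x).
Proof.
move=> mD mH; apply: (measurableT_comp (@fine_measurable R setT measurableT)).
exact: measurable_integral_param.
Qed.

Lemma tonelli_n1 D H : measurable D -> joint_meas H ->
  (\int[mu]_x \int[nu]_(s in D) (`|H s x|)%:E =
   \int[nu]_(s in D) n1 mu (H s))%E.
Proof.
move=> mD mH.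
under eq_integral do rewrite integral_indicM//.
rewrite [RHS]integral_mkcond.
transitivity (\int[nu]_s \int[mu]_x (\1_D s * `|H s x|)%:E)%E.
  have mf : measurable_fun setT (fun p : S * T => (\1_D p.1 * `|H p.1 p.2|)%:E : \bar R).
    apply/measurable_EFinP; apply: (@joint_meas_indicM D (fun s x => `|H s x|)) => //.
    exact: measurableT_comp.
  rewrite -(fubini_tonelli (m1 := nu) (m2 := mu) (fun p => (\1_D p.1 * `|H p.1 p.2|)%:E)) => [//|//|].
  by move=> x; rewrite lee_fin mulr_ge0// indicE ler0n.
apply: eq_integral => s _; rewrite patchE indicE; case: ifPn => sD.
  by apply: eq_integral => x _; rewrite mul1r.
by apply: integral0_eq => x _; rewrite mul0r.
Qed.

Lemma measurable_n1_param H : joint_meas H -> measurable_fun setT (fun s => n1 mu (H s)).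
Proof.
move=> mH; apply: (measurable_fun_fubini_tonelli_F (m2 := mu) (fun p => (`|H p.1 p.2|)%:E)) => //.
by apply/measurable_EFinP; exact: measurableT_comp.
Qed.

(** Minkowski's inequality for integrals: Tonelli applied to the absolute value.
    It is the basic tool for estimating Duhamel integrals in L^1. *)
Lemma minkowski_integral D H : measurable D -> joint_meas H ->
  (n1 mu (fun x => (\int[nu]_(s in D) H s x)%R) <= \int[nu]_(s in D) n1 mu (H s))%E.
Proof.
move=> mD mH; rewrite -tonelli_n1//.
have mDH : measurable_fun setT (fun x => \int[nu]_(s in D) (`|H s x|)%:E)%E.
  by apply: measurable_integral_param => //; exact: measurableT_comp.
apply: ge0_le_integral => //.
- by apply: measurable_normE; exact: measurable_Rintegral_param.
- move=> x _.
  have mE : measurable_fun D (EFin \o (H ^~ x)).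
    by apply/measurable_EFinP/measurable_funTS; exact: joint_meas_sec2.
  apply: le_trans (le_abse_integral nu mD mE).
  rewrite /Rintegral; case: (integral _ _ _) => //=.
  all: by rewrite normr0 leey.
Qed.

Lemma ae_integrable_param D H : measurable D -> joint_meas H ->
  (\int[nu]_(s in D) n1 mu (H s) < +oo)%E ->
  {ae mu, forall x, nu.-integrable D (EFin \o (H ^~ x))}.
Proof.
move=> mD mH; rewrite -tonelli_n1// => fin.
have mDH : measurable_fun setT (fun x => \int[nu]_(s in D) (`|H s x|)%:E)%E.
  by apply: measurable_integral_param => //; exact: measurableT_comp.
have : mu.-integrable setT (fun x => \int[nu]_(s in D) (`|H s x|)%:E)%E.
  apply/integrableP; split => //.
  under eq_integral do rewrite gee0_abs ?integral_ge0//.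
  by [].
move/integrable_ae => /(_ measurableT); apply: filterS => x /(_ I) h.
apply/integrableP; split.
  by apply/measurable_EFinP/measurable_funTS; exact: joint_meas_sec2.
by rewrite -ge0_fin_numE// integral_ge0.
Qed.

(** Fubini for real-valued integrals. The inner integrals may diverge on null sets,
    where [Rintegral] takes junk values, so the two sides are compared almost
    everywhere. *)
Lemma Rintegral_swap D H : measurable D -> joint_meas H ->
  (\int[nu]_(s in D) n1 mu (H s) < +oo)%E ->
  \int[mu]_x (\int[nu]_(s in D) H s x) = \int[nu]_(s in D) (\int[mu]_x H s x).
Proof.
move=> mD mH fin; have aeint := ae_integrable_param mD mH fin.
have mDH := joint_meas_indicM mD mH.
have iDH : (nu \x mu)%E.-integrable setT (fun p : S * T => (\1_D p.1 * H p.1 p.2)%:E : \bar R).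
  apply/integrable12ltyP; first exact/measurable_EFinP.
  move: fin; rewrite integral_mkcond; congr (_ < _)%E.
  apply: eq_integral => s _; rewrite patchE /L1norm; case: ifPn => sD.
    by apply: eq_integral => x _ /=; rewrite indicE sD mul1r.
  by apply/esym/integral0_eq => x _ /=; rewrite indicE (negbTE sD) mul0r normr0.
have aes := ae_integrable1 iDH.
rewrite /Rintegral.
transitivity (fine (\int[mu]_x \int[nu]_s (\1_D s * H s x)%:E)%E).
  congr fine; apply: ae_eq_integral => //.
  - by apply/measurable_EFinP; exact: measurable_Rintegral_param.
  - exact: measurable_integral_param measurableT mDH.
  apply: filterS aeint => x ix _.
  by rewrite -integral_indicM// fineK//; exact: integrable_fin_num.
rewrite -(Fubini iDH); congr fine.
rewrite [RHS]integral_mkcond; apply: ae_eq_integral => //.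
- exact: (measurable_fubini_F iDH).
- rewrite -(_ : (fun s => (\int[mu]_x (\1_D s * H s x))%:E) = (fun s => (fine (\int[mu]_x (H s x)%:E))%:E) \_ D).
    apply/measurable_EFinP; apply: measurableT_comp => //.
    exact: (measurable_fubini_F iDH).
  apply/funext => s; rewrite patchE indicE; case: ifPn => sD.
    by under eq_Rintegral do rewrite mul1r.
  under eq_Rintegral do rewrite mul0r.
  by rewrite Rintegral_cst// mul0r.
- apply: filterS aes => s is_ _; rewrite patchE /=.
  case: ifPn => sD.
    rewrite fineK; first by apply: eq_integral => x _; rewrite indicE sD mul1r.
    move: is_ => /(integrable_fin_num measurableT).
    by under eq_integral do rewrite indicE sD mul1r.
  by apply: integral0_eq => x _; rewrite indicE (negbTE sD) mul0r.
Qed.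

End parameter_integrals.

(** * Change of variables along the flow *)

Section affine_change_of_variables.
Context (R : realType).
Implicit Types (a b : R).

(** The pushforward of Lebesgue measure under an affine map, scaled by a, agrees
    with Lebesgue measure on half-open intervals, hence everywhere. *)
Lemma ge0_integral_affine a b (f : R -> \bar R) : 0 < a ->
  measurable_fun setT f -> (forall x, (0 <= f x)%E) ->
  (\int[leb R]_x f (a * x + b)%R = (a^-1)%:E * \int[leb R]_x f x)%E.
Proof.
move=> a0 mf f0.
pose phi : measurableTypeR R -> measurableTypeR R := fun x => a * x + b.
have mphi : measurable_fun setT phi.
  by apply: measurable_funD => //; exact: measurable_funM.
pose M : {measure set (measurableTypeR R) -> \bar R} :=
  mscale (NngNum (ltW a0))
   (measure_function_pushforward__canonical__measure_function_Measure
     (@lebesgue_measure R) mphi).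
have E A : measurable A -> lebesgue_measure A = M A.
  apply: lebesgue_measure_unique => _ [[u v]] _ <-.
  have E' : phi @^-1` `]u, v] = `](u - b) / a, (v - b) / a]%classic.
    apply/seteqP; split => x; rewrite /phi /= !in_itv/= ltr_pdivrMr// ler_pdivlMr//;
    by rewrite ltrBlDr lerBrDr [x * a]mulrC.
  rewrite [RHS](_ : _ = (a%:E *
    lebesgue_measure [set` `](u - b) / a, (v - b) / a]%R])%E); last first.
    by rewrite -E'.
  rewrite !lebesgue_measure_itv/= !lte_fin ltr_pM2r ?invr_gt0// ltrD2r.
  case: ifPn => _; last by rewrite mule0.
  by rewrite -!EFinB -EFinM; congr EFin; field; rewrite gt_eqF.
rewrite [in RHS](eq_measure_integral M); last by move=> A mA _; exact: E.
rewrite /M ge0_integral_mscale//= ge0_integral_pushforward//.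
by rewrite muleA -EFinM mulVf ?gt_eqF// mul1e.
Qed.

Lemma ge0_integral_shear (c e : R) (G : R * R -> \bar R) : 0 < c ->
  measurable_fun setT G -> (forall z, (0 <= G z)%E) ->
  (\int[leb R]_y \int[leb R]_x G (x, c * y + e * x)%R =
   (c^-1)%:E * \int[leb2 R]_z G z)%E.
Proof.
move=> c0 mG G0.
have mS : measurable_fun setT (fun z : R * R => G (z.1, c * z.2 + e * z.1)).
  apply: (measurableT_comp mG); apply: measurable_fun_pair => //.
  by apply: measurable_funD => //; exact: measurable_funM.
rewrite -[LHS](@fubini_tonelli _ _ _ _ R (@lebesgue_measure R)
  (@lebesgue_measure R) _ mS (fun=> G0 _))/=.
have step x : (\int[leb R]_y G (x, c * y + e * x)%R =
   (c^-1)%:E * \int[leb R]_y G (x, y))%E.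
  by rewrite (@ge0_integral_affine _ _ (fun y => G (x, y)))//; exact: measurable_fun_pair2.
under eq_integral do rewrite step.
rewrite ge0_integralZl_EFin//; last 3 first.
- by move=> y _; exact: integral_ge0.
- exact: measurable_fun_fubini_tonelli_F.
- by rewrite invr_ge0 ltW.
by rewrite [in RHS]fubini_tonelli1.
Qed.

(** A product of two triangular maps handles a symmetric 2 x 2 matrix, so that the
    Jacobian formula reduces to affine substitutions on the line. *)
Lemma ge0_integral_sym_linear a b (G : R * R -> \bar R) :
  0 < a -> 0 < a ^+ 2 - b ^+ 2 ->
  measurable_fun setT G -> (forall z, (0 <= G z)%E) ->
  (\int[leb2 R]_z G ((a * z.1 + b * z.2)%R, (b * z.1 + a * z.2)%R) =
   ((a ^+ 2 - b ^+ 2)^-1)%:E * \int[leb2 R]_z G z)%E.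
Proof.
move=> a0 d0 mG G0.
have m1 : measurable_fun setT (fun z : R * R => a * z.1 + b * z.2).
  by apply: measurable_funD; apply: measurable_funM.
have m2 : measurable_fun setT (fun z : R * R => b * z.1 + a * z.2).
  by apply: measurable_funD; apply: measurable_funM.
have mGL : measurable_fun setT
    (fun z : R * R => G (a * z.1 + b * z.2, b * z.1 + a * z.2)).
  by apply: (measurableT_comp mG); exact: measurable_fun_pair.
rewrite fubini_tonelli2//.
(* In the variable x' = a x + b y the second coordinate b x + a y equals c y + e x'. *)
have [c [e [c0 cE eE]]] : exists c e, [/\ 0 < c, a * c = a ^+ 2 - b ^+ 2 &
    a * e = b].
  exists ((a ^+ 2 - b ^+ 2) / a), (b / a).
  by split; [rewrite divr_gt0|field; rewrite gt_eqF..].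
have mS : measurable_fun setT (fun z : R * R => G (z.1, c * z.2 + e * z.1)).
  apply: (measurableT_comp mG); apply: measurable_fun_pair => //.
  by apply: measurable_funD => //; exact: measurable_funM.
have step y : (\int[leb R]_x G ((a * x + b * y)%R, (b * x + a * y)%R) =
   (a^-1)%:E * \int[leb R]_x G (x, (c * y + e * x)%R))%E.
  rewrite -(@ge0_integral_affine a (b * y) (fun x => G (x, _ + e * x)%R))//.
    apply: eq_integral => x _; congr (G (_, _)).
    apply: (mulfI (x := a)); first by rewrite gt_eqF.
    rewrite [RHS](_ : _ = a * c * y + a * e * (a * x + b * y)); last by ring.
    rewrite cE eE; ring.
  exact: (measurable_fun_pair1 y mS).
rewrite /fubini_G; under eq_integral do rewrite step.
have mI := @measurable_fun_fubini_tonelli_G _ _ _ _ R (@lebesgue_measure R) _ mS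
  (fun=> G0 _).
rewrite ge0_integralZl_EFin//; last 2 first.
- by move=> y _; exact: integral_ge0.
- by rewrite invr_ge0 ltW.
by rewrite ge0_integral_shear// muleA -EFinM -cE invfM.
Qed.

End affine_change_of_variables.

Section flow.
Context (R : realType).
Implicit Types (s t gamma : R).

Lemma Phi_linear s (z : R * R) : Phi s z =
  (1 + expR (- s)) / 2 * z.1 + (1 - expR (- s)) / 2 * z.2.
Proof. by rewrite /Phi; field. Qed.

Lemma Phi_star_linear s (z : R * R) : Phi_star s z =
  (1 - expR (- s)) / 2 * z.1 + (1 + expR (- s)) / 2 * z.2.
Proof. by rewrite /Phi_star; field. Qed.

Lemma measurable_Phi : measurable_fun setT (fun p : R * (R * R) => Phi p.1 p.2).
Proof.
apply: measurable_funD; apply: measurable_funM => //.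
- by apply: measurable_funD; apply: measurableT_comp.
- by apply: (measurableT_comp (@measurable_expR R)); exact: measurableT_comp.
- by apply: measurable_funM => //; apply: measurable_funB; apply: measurableT_comp.
Qed.

Lemma measurable_Phi_star :
  measurable_fun setT (fun p : R * (R * R) => Phi_star p.1 p.2).
Proof.
apply: measurable_funD; apply: measurable_funM => //.
- by apply: measurable_funD; apply: measurableT_comp.
- by apply: (measurableT_comp (@measurable_expR R)); exact: measurableT_comp.
- by apply: measurable_funM => //; apply: measurable_funB; apply: measurableT_comp.
Qed.

(** The map (Phi, Phi_star) is linear and symmetric, with eigenvalues 1 on the
    diagonal and e^s across it; hence its Jacobian is e^s. *)
Lemma ge0_integral_flow s (G : R * R -> \bar R) :
  measurable_fun setT G -> (forall z, (0 <= G z)%E) ->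
  (\int[leb2 R]_z G (Phi (- s) z, Phi_star (- s) z) =
   (expR (- s))%:E * \int[leb2 R]_z G z)%E.
Proof.
move=> mG G0.
have es : 0 < expR s by exact: expR_gt0.
have d : ((1 + expR s) / 2) ^+ 2 - ((1 - expR s) / 2) ^+ 2 = expR s by field.
rewrite expRN -{1}d -ge0_integral_sym_linear// ?d//.
by apply: eq_integral => z _; rewrite Phi_linear Phi_star_linear !opprK.
Qed.

End flow.

Section L1_complements.
Context dS dT (S : measurableType dS) (T : measurableType dT) (R : realType).
Variable nu : {sigma_finite_measure set S -> \bar R}.
Variable mu : {sigma_finite_measure set T -> \bar R}.
Implicit Types (H : S -> T -> R) (D : set S).

(** The difference of two integrals is the integral of the difference only where
    both converge, that is almost everywhere. *)
Lemma minkowski_integralB D H1 H2 : measurable D -> joint_meas H1 -> joint_meas H2 ->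
  (\int[nu]_(s in D) n1 mu (H1 s) < +oo)%E ->
  (\int[nu]_(s in D) n1 mu (H2 s) < +oo)%E ->
  (n1 mu (fun x => (\int[nu]_(s in D) H1 s x)%R - (\int[nu]_(s in D) H2 s x)%R)
   <= \int[nu]_(s in D) n1 mu (fun x => H1 s x - H2 s x)%R)%E.
Proof.
move=> mD m1 m2 f1 f2.
have m12 : joint_meas (fun s x => H1 s x - H2 s x) by exact: measurable_funB.
apply: le_trans (minkowski_integral nu mu mD m12).
apply: n1_le.
- by apply: measurable_funB; exact: measurable_Rintegral_param.
- exact: measurable_Rintegral_param.
have a1 := ae_integrable_param mD m1 f1; have a2 := ae_integrable_param mD m2 f2.
apply: filterS2 a1 a2 => x i1 i2.
by rewrite RintegralB.
Qed.

End L1_complements.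

(** * Exponential integrals and substitutions on the half line *)

Section real_line_integrals.
Context (R : realType).
Implicit Types (a b c t eps : R).

Lemma integral_exp_tail c t : 0 < c ->
  (\int[leb R]_(s in `[t, +oo[) (expR (- (c * s)))%:E = (expR (- (c * t)) / c)%:E)%E.
Proof.
move=> c0.
have df x : is_derive x (1:R) (fun s => - (expR (- (c * s)) / c)) (expR (- (c * x))).
  apply: is_derive_eq; rewrite /GRing.scale /=.
  by field; rewrite gt_eqF.
have cf : continuous (fun s => expR (- (c * s))).
  move=> x; apply: continuous_comp; last exact: continuous_expR.
  by apply: cvgN; apply: cvgM => //; exact: cvg_cst.
rewrite (@ge0_continuous_FTC2y _ _ (fun s => - (expR (- (c * s)) / c)) _ 0)//.
- by rewrite EFinN oppeK add0e.
- exact: continuous_subspaceT.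
- rewrite -oppr0 -[in X in _ --> X](mul0r c^-1); apply: cvgN; apply: cvgM; last exact: cvg_cst.
  rewrite (_ : (fun x => expR (- (c * x))) =
               (fun z => expR (- z)) \o (fun z => c * z))//.
  apply: (@cvg_comp _ _ _ _ _ _ (pinfty_nbhs R)); last exact: cvgr_expR.
  exact: gt0_cvgMry.
- by apply: cvgN; apply: cvgM; [apply/cvg_at_right_filter; exact: cf|exact: cvg_cst].
- by move=> x _; rewrite derive1E; exact: derive_val.
Qed.

Lemma measurable_exp_lin c (D : set R) : measurable_fun D (fun s : R => (expR (- (c * s)))%:E).
Proof.
apply/measurable_EFinP; apply: measurableT_comp => //; apply: measurableT_comp => //.
Qed.

Lemma integral_exp_halfline c : 0 < c ->
  (\int[leb R]_(s in `[0%R, +oo[) (expR (- (c * s)))%:E = (c^-1)%:E)%E.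
Proof. by move=> c0; rewrite integral_exp_tail// mulr0 oppr0 expR0 div1r. Qed.

Lemma integrable_exp_halfline c : 0 < c ->
  (leb R).-integrable `[0, +oo[ (EFin \o (fun s => expR (- (c * s)))).
Proof.
move=> c0; apply/integrableP; split; first exact: measurable_exp_lin.
under eq_integral do rewrite /= ger0_norm ?expR_ge0//.
by rewrite integral_exp_halfline// ltry.
Qed.

Lemma integral_exp_itv c a b : 0 < c -> 0 <= a ->
  (\int[leb R]_(s in `[a, b]) (expR (- (c * s)))%:E <= (c^-1)%:E)%E.
Proof.
move=> c0 a0; apply: (@le_trans _ _ (\int[leb R]_(s in `[0%R, +oo[) (expR (- (c * s)))%:E)%E).
  apply: ge0_subset_integral => //.
  - exact: measurable_exp_lin.
  - by move=> s /=; rewrite !in_itv/= andbT => /andP[+ _]; exact: le_trans.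
by rewrite integral_exp_halfline.
Qed.

(** Half of the exponential absorbs the linear factor:
    s e^(- c s) <= (2 / c) e^(- c s / 2). *)
Lemma integral_id_exp_itv c b : 0 < c ->
  (\int[leb R]_(s in `[0%R, b]) (s * expR (- (c * s)))%:E <= (4 / c ^+ 2)%:E)%E.
Proof.
move=> c0.
apply: (@le_trans _ _ (\int[leb R]_(s in `[0%R, b])
    ((2 / c)%:E * (expR (- (c / 2 * s)))%:E))%E).
  apply: ge0_le_integral => //.
  - move=> s /=; rewrite in_itv/= => /andP[s0 _].
    by rewrite lee_fin mulr_ge0// expR_ge0.
  - apply/measurable_EFinP; apply: measurable_funM => //.
    by apply/measurable_EFinP; exact: measurable_exp_lin.
  - by apply: emeasurable_funM => //; exact: measurable_exp_lin.
  move=> s /=; rewrite in_itv/= => /andP[s0 _]; rewrite -EFinM lee_fin.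
  have -> : expR (- (c * s)) = expR (- (c / 2 * s)) * expR (- (c / 2 * s)).
    by rewrite -expRD; congr expR; field.
  rewrite mulrA ler_wpM2r ?expR_ge0//.
  rewrite expRN ler_pdivrMr ?expR_gt0//.
  have h : c / 2 * s <= expR (c / 2 * s).
    by apply: le_trans (expR_ge1Dx _); rewrite lerDr.
  rewrite -[leLHS](_ : 2 / c * (c / 2 * s) = s); last by field; rewrite gt_eqF.
  by rewrite ler_wpM2l// divr_ge0// ltW.
rewrite ge0_integralZl_EFin//; last 2 first.
- exact: measurable_exp_lin.
- by rewrite divr_ge0// ltW.
have c2 : 0 < c / 2 by rewrite divr_gt0.
apply: (@le_trans _ _ ((2 / c)%:E * ((c / 2)^-1)%:E)%E).
  by apply: lee_wpmul2l; [rewrite lee_fin divr_ge0// ltW|exact: integral_exp_itv].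
rewrite -EFinM lee_fin le_eqVlt; apply/orP; left; apply/eqP.
by field; rewrite gt_eqF.
Qed.

Lemma ge0_integral_reflect t (f : R -> \bar R) :
  measurable_fun setT f -> (forall x, (0 <= f x)%E) ->
  (\int[leb R]_x f (t - x)%R = \int[leb R]_x f x)%E.
Proof.
move=> mf f0.
pose phi : measurableTypeR R -> measurableTypeR R := fun x => t - x.
have mphi : measurable_fun setT phi by exact: measurable_funB.
pose M : {measure set (measurableTypeR R) -> \bar R} :=
   measure_function_pushforward__canonical__measure_function_Measure
     (@lebesgue_measure R) mphi.
have E A : measurable A -> lebesgue_measure A = M A.
  apply: lebesgue_measure_unique => _ [[u v]] _ <-.
  have E' : phi @^-1` `]u, v] = `[t - v, t - u[%classic.
    apply/seteqP; split => x; rewrite /phi /= !in_itv/=;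
    by rewrite andbC lerBlDr ltrBrDr -lerBlDl -ltrBrDl ?[x + _]addrC.
  rewrite [RHS](_ : _ = (lebesgue_measure [set` `[(t - v), (t - u)[%R])%E); last first.
    by rewrite -E'.
  rewrite !lebesgue_measure_itv/= !lte_fin ltrD2l ltrN2.
  by case: ifPn => _ //; rewrite -!EFinB; congr EFin; ring.
rewrite [in RHS](eq_measure_integral M); last by move=> A mA _; exact: E.
by rewrite /M ge0_integral_pushforward.
Qed.

Lemma ge0_integral_itv_reflect t (h : R -> R) : measurable_fun setT h ->
  (forall s, 0 <= h s) ->
  (\int[leb R]_(s in `[0%R, t]) (h (t - s)%R)%:E = \int[leb R]_(s in `[0%R, t]) (h s)%:E)%E.
Proof.
move=> mh h0.
rewrite integral_mkcond [RHS]integral_mkcond.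
rewrite -[RHS](@ge0_integral_reflect t); first last.
- by move=> x; rewrite patchE; case: ifPn => //; rewrite lee_fin.
- apply/(measurable_restrictT _ _).1 => //.
  by apply/measurable_EFinP; exact: measurable_funTS.
apply: eq_integral => s _; rewrite !patchE; congr (if _ then _ else _).
by rewrite !mem_setE !in_itv/= subr_ge0 lerBlDr lerDl andbC.
Qed.

Lemma ge0_integral_scale eps (g : R -> \bar R) : 0 < eps ->
  measurable_fun setT g -> (forall s, (0 <= g s)%E) ->
  (\int[leb R]_(s in `[0%R, +oo[) g (s / eps)%R =
   eps%:E * \int[leb R]_(s in `[0%R, +oo[) g s)%E.
Proof.
move=> e0 mg g0; rewrite integral_mkcond [X in (_ * X)%E]integral_mkcond.
have e1 : 0 < eps^-1 by rewrite invr_gt0.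
rewrite -{2}(invrK eps) -(@ge0_integral_affine _ _ 0 _ e1).
- apply: eq_integral => s _; rewrite addr0 !patchE [eps^-1 * s]mulrC.
  congr (if _ then _ else _).
  by rewrite !mem_setE !in_itv/= !andbT pmulr_lge0.
- by apply/(measurable_restrictT _ _).1 => //; exact: measurable_funTS.
- by move=> x; rewrite patchE; case: ifPn.
Qed.

Lemma Rintegral_scale eps (f : R -> R) : 0 < eps -> measurable_fun setT f ->
  (leb R).-integrable `[0, +oo[ (EFin \o f) ->
  \int[leb R]_(s in `[0, +oo[) f s =
  eps^-1 * \int[leb R]_(s in `[0, +oo[) f (s / eps).
Proof.
move=> e0 mf fi.
pose h := EFin \o f; have mh : measurable_fun setT h by exact/measurable_EFinP.
have mD : measurable ([set` `[0%R, +oo[%R] : set (measurableTypeR R)) by [].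
have p := integrable_pos_fin_num mD fi; have n := integrable_neg_fin_num mD fi.
rewrite /Rintegral [in RHS]integralE.
have -> : (\int[leb R]_(s in `[0%R, +oo[) (fun s => (f (s / eps))%:E)^\+ s =
    eps%:E * \int[leb R]_(s in `[0%R, +oo[) h^\+ s)%E.
  rewrite -ge0_integral_scale//; last exact: measurable_funepos.
  by apply: eq_integral => s _; rewrite !funeposE.
have -> : (\int[leb R]_(s in `[0%R, +oo[) (fun s => (f (s / eps))%:E)^\- s =
    eps%:E * \int[leb R]_(s in `[0%R, +oo[) h^\- s)%E.
  rewrite -ge0_integral_scale//; last exact: measurable_funeneg.
  by apply: eq_integral => s _; rewrite !funenegE.
rewrite integralE -(fineK p) -(fineK n) -!EFinM -!EFinB /=.
by rewrite -mulrBr mulrA mulVf ?gt_eqF// mul1r.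
Qed.

End real_line_integrals.

(** * The transport semigroup and tensor products in L^1 *)

Section semigroup_norm.
Context (R : realType).
Implicit Types (t gamma : R) (u v : R -> R) (g : R * R -> R).

Lemma joint_meas_semigroup dS (S : measurableType dS) gamma (tau : S -> R)
    (G : S -> R * R -> R) : measurable_fun setT tau -> joint_meas G ->
  joint_meas (fun s => semigroup gamma (tau s) (G s)).
Proof.
move=> mtau mG; have mt : measurable_fun setT (fun p : S * (R * R) => tau p.1).
  exact: (measurableT_comp mtau (@measurable_fst _ _ S (R * R)%type)).
apply: measurable_funM.
  by apply: measurableT_comp => //; exact: measurable_funM.
have mp : measurable_fun setT (fun p : S * (R * R) => (- tau p.1, p.2)).
  by apply: measurable_fun_pair => //; exact: measurableT_comp.
have m1 := measurableT_comp (@measurable_Phi R) mp.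
have m2 := measurableT_comp (@measurable_Phi_star R) mp.
have m3 := measurable_fun_pair m1 m2.
have m4 : measurable_fun setT (fun p : S * (R * R) => (p.1,
    (Phi (- tau p.1) p.2, Phi_star (- tau p.1) p.2))).
  exact: (measurable_fun_pair (@measurable_fst _ _ S (R * R)%type) m3).
exact: (measurableT_comp mG m4).
Qed.

Lemma measurable_semigroup gamma t g : measurable_fun setT g ->
  measurable_fun setT (semigroup gamma t g).
Proof.
move=> mg.
have := @joint_meas_semigroup _ R gamma (fun=> t) (fun=> g) (measurable_cst _)
  (measurableT_comp mg (@measurable_snd _ _ R (R * R)%type)).
by move/joint_meas_sec => /(_ 0).
Qed.

Lemma joint_meas_tensor dS (S : measurableType dS) (U : S -> R -> R) :
  joint_meas U -> joint_meas (fun s => tensor (U s)).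
Proof.
move=> mU; apply: measurable_funM.
  apply: (measurableT_comp mU (g := fun p : S * (R * R) => (p.1, p.2.1))).
  by apply: measurable_fun_pair => //; exact: measurableT_comp.
apply: (measurableT_comp mU (g := fun p : S * (R * R) => (p.1, p.2.2))).
by apply: measurable_fun_pair => //; exact: measurableT_comp.
Qed.

Lemma measurable_tensor2 u v : measurable_fun setT u -> measurable_fun setT v ->
  measurable_fun setT (fun z : R * R => u z.1 * v z.2).
Proof.
by move=> mu mv; apply: measurable_funM; apply: measurableT_comp.
Qed.

(** The factor e^((1 - gamma) t) of the semigroup meets the Jacobian e^(- t) of the
    flow; only the absorption rate gamma is left. *)
Lemma n1_semigroup gamma t g : measurable_fun setT g ->
  n1 (leb2 R) (semigroup gamma t g) = ((expR (- (gamma * t)))%:E * n1 (leb2 R) g)%E.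
Proof.
move=> mg; rewrite /L1norm.
have mn := measurable_normE mg.
transitivity (\int[leb2 R]_z ((expR ((1 - gamma) * t))%:E *
    (`|g (Phi (- t) z, Phi_star (- t) z)|)%:E))%E.
  by apply: eq_integral => z _; rewrite /semigroup normrM (ger0_norm (expR_ge0 _)) EFinM.
have mgf : measurable_fun setT (fun z : R * R => (`|g (Phi (- t) z, Phi_star (- t) z)|)%:E).
  have := measurable_semigroup gamma t mg.
  move=> /(measurable_funM (measurable_cst (expR (- ((1 - gamma) * t))))) h.
  apply: measurable_normE; apply: eq_measurable_fun h => z _.
  by rewrite /semigroup /= mulrA -expRD addNr expR0 mul1r.
rewrite ge0_integralZl_EFin ?expR_ge0//.
rewrite (@ge0_integral_flow _ t (fun z => (`|g z|)%:E))// muleA -EFinM -expRD.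
by congr (_%:E * _)%E; congr expR; ring.
Qed.

Lemma integral_semigroup gamma t g : (leb2 R).-integrable setT (EFin \o g) ->
  \int[leb2 R]_z semigroup gamma t g z = expR (- (gamma * t)) * \int[leb2 R]_z g z.
Proof.
move=> ig; have [mg gfin] := (integrable_n1P _ _).1 ig.
have msg := measurable_semigroup 0 t mg.
pose h := EFin \o g; have mh : measurable_fun setT h by exact/measurable_EFinP.
have p := integrable_pos_fin_num measurableT ig.
have n := integrable_neg_fin_num measurableT ig.
have fE : (\int[leb2 R]_z (g (Phi (- t) z, Phi_star (- t) z))%:E =
    (expR (- t))%:E * \int[leb2 R]_z h z)%E.
  rewrite integralE.
  have -> : (\int[leb2 R]_z (fun z => (g (Phi (- t) z, Phi_star (- t) z))%:E)^\+ z =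
      (expR (- t))%:E * \int[leb2 R]_z h^\+ z)%E.
    rewrite -(@ge0_integral_flow _ t); [|exact: measurable_funepos|by []].
    by apply: eq_integral => z _; rewrite !funeposE.
  have -> : (\int[leb2 R]_z (fun z => (g (Phi (- t) z, Phi_star (- t) z))%:E)^\- z =
      (expR (- t))%:E * \int[leb2 R]_z h^\- z)%E.
    rewrite -(@ge0_integral_flow _ t); [|exact: measurable_funeneg|by []].
    by apply: eq_integral => z _; rewrite !funenegE.
  have [a aE] : exists a, (\int[leb2 R]_z h^\+ z = a%:E)%E.
    by eexists; exact/esym/(fineK p).
  have [b bE] : exists b, (\int[leb2 R]_z h^\- z = b%:E)%E.
    by eexists; exact/esym/(fineK n).
  have hE : (\int[leb2 R]_z h z = (a - b)%:E)%E.
    by rewrite integralE EFinB; congr (_ - _)%E.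
  by rewrite aE bE hE -!EFinM -EFinB mulrBr.
have E : forall z, semigroup gamma t g z =
    expR (- gamma * t) * semigroup 1 t g z * expR t.
  move=> z; rewrite /semigroup subrr mul0r expR0 mul1r mulrAC -expRD.
  by congr (expR _ * _); ring.
have is1 : (leb2 R).-integrable setT (EFin \o semigroup 1 t g).
  apply/integrable_n1P; split; first exact: measurable_semigroup.
  by rewrite n1_semigroup// lte_mul_pinfty// ?lee_fin ?expR_ge0//.
under eq_Rintegral do rewrite E.
rewrite RintegralZr//; last first.
  by have := integrableZl measurableT (expR (- gamma * t)) is1.
rewrite RintegralZl//.
have -> : \int[leb2 R]_z semigroup 1 t g z = expR (- t) * \int[leb2 R]_z g z.
  rewrite /Rintegral; under eq_integral do rewrite /semigroup subrr mul0r expR0 mul1r.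
  by rewrite fE fineM//; exact: integrable_fin_num.
rewrite mulrA mulrAC mulNr; congr (_ * _).
by rewrite -!expRD; congr expR; ring.
Qed.

Lemma n1_tensor2 u v : measurable_fun setT u -> measurable_fun setT v ->
  n1 (leb2 R) (fun z => u z.1 * v z.2) = (n1 (leb R) u * n1 (leb R) v)%E.
Proof.
move=> mu mv; rewrite /L1norm fubini_tonelli1//; last first.
  by apply: measurable_normE; exact: measurable_tensor2.
rewrite /fubini_F /=.
transitivity (\int[leb R]_x ((`|u x|)%:E * \int[leb R]_y (`|v y|)%:E))%E.
  apply: eq_integral => x _; rewrite -ge0_integralZl_EFin//; last exact: measurable_normE.
  by apply: eq_integral => y _; rewrite normrM EFinM.
rewrite ge0_integralZr//; first exact: measurable_normE.
exact: integral_ge0.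
Qed.

Lemma integral_tensor u : (leb R).-integrable setT (EFin \o u) ->
  \int[leb2 R]_z tensor u z = (\int[leb R]_x u x) ^+ 2.
Proof.
move=> iu; have [mu ufin] := (integrable_n1P _ _).1 iu.
have it : (leb2 R).-integrable setT (EFin \o tensor u).
  apply/integrable_n1P; split; first exact: measurable_tensor2.
  by rewrite n1_tensor2// lte_mul_pinfty ?n1_ge0// ge0_fin_numE ?n1_ge0.
rewrite /Rintegral -(integral12_prod_meas1 it) /fubini_F /=.
transitivity (fine (\int[leb R]_x ((\int[leb R]_y u y)%:E * (u x)%:E))).
  congr fine; apply: eq_integral => x _.
  rewrite -[in RHS]EFinM mulrC -RintegralZl// fineK//.
  exact: (integrable_fin_num _ (integrableZl measurableT (u x) iu)).
by rewrite integralZl// fineM//; exact: integrable_fin_num.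
Qed.

(** From u u' - v v' = u (u' - v') + (u - v) v'. *)
Lemma n1_tensorB u v : measurable_fun setT u -> measurable_fun setT v ->
  (n1 (leb2 R) (fun z => tensor u z - tensor v z) <=
   (n1 (leb R) u + n1 (leb R) v) * n1 (leb R) (fun x => u x - v x))%E.
Proof.
move=> mu mv.
have muv : measurable_fun setT (fun x => u x - v x) by exact: measurable_funB.
set D := n1 (leb R) (fun x => u x - v x).
rewrite [leLHS](_ : _ = n1 (leb2 R) (fun z =>
    u z.1 * (u z.2 - v z.2) + (u z.1 - v z.1) * v z.2)); last first.
  by apply: eq_n1 => z; rewrite /tensor; ring.
apply: le_trans (n1D _ _ _) _.
- exact: (measurable_tensor2 mu muv).
- exact: (measurable_tensor2 muv mv).
rewrite (n1_tensor2 mu muv) (n1_tensor2 muv mv) -/D.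
have factor (x y e : \bar R) : (0 <= x)%E -> (0 <= y)%E ->
    (x * e + e * y <= (x + y) * e)%E.
  by move=> x0 y0; rewrite ge0_muleDl// (muleC y).
by apply: factor; exact: n1_ge0.
Qed.

End semigroup_norm.

(** * Marginals *)

Section marginals.
Context (R : realType).
Implicit Types (g h : R * R -> R).

Definition marginal g x : R := \int[leb R]_y g (x, y).

Lemma joint_meas_marginal dS (S : measurableType dS) (G : S -> R * R -> R) :
  joint_meas G -> joint_meas (fun s => marginal (G s)).
Proof.
move=> mG.
have := @measurable_Rintegral_param _ _ _ _ R (@lebesgue_measure R) setT
  (fun (y : R) (p : S * R) => G p.1 (p.2, y)) measurableT.
apply.
apply: (measurableT_comp mG (g := fun q : R * (S * R) => (q.2.1, (q.2.2, q.1)))).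
apply: measurable_fun_pair; first exact: measurableT_comp.
by apply: measurable_fun_pair => //; exact: measurableT_comp.
Qed.

Lemma measurable_marginal g : measurable_fun setT g -> measurable_fun setT (marginal g).
Proof.
move=> mg.
have := @measurable_Rintegral_param _ _ _ _ R (@lebesgue_measure R) setT
  (fun (y : R) (x : R) => g (x, y)) measurableT.
apply.
by apply: (measurableT_comp mg (g := fun q : R * R => (q.2, q.1))); exact: measurable_fun_pair.
Qed.

Lemma n1_sections g : measurable_fun setT g ->
  (\int[leb R]_y n1 (leb R) (fun x => g (x, y)) = n1 (leb2 R) g)%E.
Proof.
move=> mg; rewrite [RHS](_ : _ = \int[leb2 R]_z (`|g z|)%:E)%E//.
by rewrite fubini_tonelli2//; exact: measurable_normE.
Qed.

Lemma joint_meas_swap g : measurable_fun setT g -> joint_meas (fun y x => g (x, y)).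
Proof.
by move=> mg; apply: (measurableT_comp mg (g := fun q : R * R => (q.2, q.1))); exact: measurable_fun_pair.
Qed.

Lemma n1_marginal g : measurable_fun setT g ->
  (n1 (leb R) (marginal g) <= n1 (leb2 R) g)%E.
Proof.
move=> mg; rewrite -n1_sections//.
exact: (minkowski_integral (@lebesgue_measure R) (@lebesgue_measure R) measurableT (joint_meas_swap mg)).
Qed.

Lemma n1_marginalB g h : measurable_fun setT g -> measurable_fun setT h ->
  (n1 (leb2 R) g < +oo)%E -> (n1 (leb2 R) h < +oo)%E ->
  (n1 (leb R) (fun x => marginal g x - marginal h x) <=
   n1 (leb2 R) (fun z => g z - h z))%E.
Proof.
move=> mg mh gf hf; rewrite -n1_sections; last exact: measurable_funB.
have := @minkowski_integralB _ _ _ _ R (@lebesgue_measure R) (@lebesgue_measure R) _ _ _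
  measurableT (joint_meas_swap mg) (joint_meas_swap mh).
by apply; rewrite n1_sections.
Qed.

Lemma integral_marginal g : (leb2 R).-integrable setT (EFin \o g) ->
  \int[leb R]_x marginal g x = \int[leb2 R]_z g z.
Proof.
move=> ig; have [mg gf] := (integrable_n1P _ _).1 ig.
rewrite /marginal (@Rintegral_swap _ _ _ _ _ (@lebesgue_measure R) (@lebesgue_measure R) setT
  (fun y x => g (x, y)))//; last 2 first.
- exact: joint_meas_swap.
- by rewrite n1_sections.
rewrite [in RHS]/Rintegral -(integral21_prod_meas1 ig) /fubini_G /=.
apply/esym; congr fine.
apply: ae_eq_integral => //.
- exact: (measurable_fubini_G ig).
- apply/measurable_EFinP; apply: (measurableT_comp (@fine_measurable R setT measurableT)).
  exact: (measurable_fubini_G ig).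
- apply: filterS (ae_integrable2 ig) => y iy _.
  by rewrite fineK//; exact: integrable_fin_num.
Qed.

End marginals.

(** * Parameter integrals over the plane *)

Section planar_measure.
Context (R : realType).

Lemma sigma_finite_leb2 : sigma_finite [set: R * R] (leb2 R).
Proof.
have /sigma_finiteP[F [TF ndF Foo]] := sigma_finiteT (@lebesgue_measure R).
exists (fun n => F n `*` F n).
  rewrite -setXTT TF predeqE => -[x y]; split.
    move=> [/= [n _ Fnx] [k _ Gky]]; exists (maxn n k) => //; split.
    - by move: x Fnx; exact/subsetPset/ndF/leq_maxl.
    - by move: y Gky; exact/subsetPset/ndF/leq_maxr.
  by move=> [n _ []/= ? ?]; split; exists n.
move=> k; have [mF Fk] := Foo k.
split; first exact: measurableX.
by rewrite product_measure1E// lte_mul_pinfty// ge0_fin_numE.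
Qed.

(** The product measure packaged as a sigma-finite measure, so that the parameter
    integral lemmas apply to it. *)
Definition planar_lebesgue :
    {sigma_finite_measure set (measurableTypeR R * measurableTypeR R)%type -> \bar R} :=
  HB.pack (leb2 R) (@Measure_isSigmaFinite.Build _ _ _ (leb2 R) sigma_finite_leb2).

Implicit Types (D : set R) (H : R -> R * R -> R).

Lemma measurable_n1_planar H : joint_meas H ->
  measurable_fun setT (fun s => n1 (leb2 R) (H s)).
Proof.
by move=> mH; have := @measurable_n1_param _ _ _ _ R planar_lebesgue H mH; apply.
Qed.

Lemma minkowski_planar D H : measurable D -> joint_meas H ->
  (n1 (leb2 R) (fun z => (\int[leb R]_(s in D) H s z)%R) <=
   \int[leb R]_(s in D) n1 (leb2 R) (H s))%E.
Proof. exact: (minkowski_integral (@lebesgue_measure R) planar_lebesgue). Qed.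

Lemma minkowskiB_planar D H1 H2 : measurable D -> joint_meas H1 -> joint_meas H2 ->
  (\int[leb R]_(s in D) n1 (leb2 R) (H1 s) < +oo)%E ->
  (\int[leb R]_(s in D) n1 (leb2 R) (H2 s) < +oo)%E ->
  (n1 (leb2 R) (fun z => (\int[leb R]_(s in D) H1 s z)%R -
                         (\int[leb R]_(s in D) H2 s z)%R)
   <= \int[leb R]_(s in D) n1 (leb2 R) (fun z => H1 s z - H2 s z)%R)%E.
Proof. exact: (@minkowski_integralB _ _ _ _ R (@lebesgue_measure R) planar_lebesgue). Qed.

Lemma ae_integrable_planar D H : measurable D -> joint_meas H ->
  (\int[leb R]_(s in D) n1 (leb2 R) (H s) < +oo)%E ->
  {ae leb2 R, forall z, (leb R).-integrable D (EFin \o (H ^~ z))}.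
Proof. exact: (@ae_integrable_param _ _ _ _ R (@lebesgue_measure R) planar_lebesgue). Qed.

Lemma Rintegral_swap_planar D H : measurable D -> joint_meas H ->
  (\int[leb R]_(s in D) n1 (leb2 R) (H s) < +oo)%E ->
  \int[leb2 R]_z (\int[leb R]_(s in D) H s z) =
  \int[leb R]_(s in D) (\int[leb2 R]_z H s z).
Proof. exact: (@Rintegral_swap _ _ _ _ R (@lebesgue_measure R) planar_lebesgue). Qed.

End planar_measure.

(** * The pair density in quasi-equilibrium *)

Section pair_density.
Context (R : realType).
Variables (lambda gamma : R).
Hypotheses (lambda_gt0 : 0 < lambda) (gamma_gt0 : 0 < gamma).
Implicit Types (t eps a d c : R) (u v : R -> R).

Lemma n1_semigroup_family_le eps (D : set R) (H : R -> R * R -> R) (h : R -> R) :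
  measurable D -> joint_meas H -> measurable_fun setT h -> (forall s, D s -> 0 <= h s) ->
  (forall s, D s -> (n1 (leb2 R) (H s) <= (h s)%:E)%E) ->
  (\int[leb R]_(s in D) n1 (leb2 R) (semigroup gamma (s / eps) (H s)) <=
   \int[leb R]_(s in D) (h s * expR (- (gamma / eps * s)))%:E)%E.
Proof.
move=> mD mH mh h0 Hh; apply: ge0_le_integral => //.
- by move=> s _; exact: n1_ge0.
- have mS : joint_meas (fun s : R => semigroup gamma (s / eps) (H s)).
    apply: (@joint_meas_semigroup R _ R gamma (fun s => s / eps) H) => //.
    exact: measurable_funM.
  exact: measurable_funTS (measurable_n1_planar mS).
- apply/measurable_EFinP; apply: measurable_funM; first exact: measurable_funTS.
  by apply/measurable_EFinP; exact: measurable_exp_lin.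
move=> s Ds; rewrite n1_semigroup; last exact: joint_meas_sec.
rewrite EFinM muleC; have -> : gamma * (s / eps) = gamma / eps * s by ring.
by apply: lee_wpmul2r; [rewrite lee_fin expR_ge0|exact: Hh].
Qed.

(** The operator K: the stationary state of the fast equation for the pair density
    when the source is the tensor square of u. The limit pair density at time t is,
    by definition, the image of f(t). *)
Definition pair_density u z : R :=
  lambda * \int[leb R]_(s in `[0, +oo[) semigroup gamma s (tensor u) z.

Lemma joint_meas_const_tensor u : measurable_fun setT u -> joint_meas (fun _ : R => tensor u).
Proof.
move=> mu; apply: (@joint_meas_tensor R _ R (fun=> u)).
exact: (measurableT_comp mu (@measurable_snd _ _ R R)).
Qed.

Lemma joint_meas_semigroup_tensor eps u : measurable_fun setT u ->
  joint_meas (fun s : R => semigroup gamma (s / eps) (tensor u)).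
Proof.
move=> mu; apply: (@joint_meas_semigroup R _ R gamma (fun s => s / eps) (fun=> tensor u)).
  exact: measurable_funM.
exact: joint_meas_const_tensor.
Qed.

(** Puts K in the rescaled form s / eps, with eps = 1, in which the integrals over
    the semigroup are estimated. *)
Lemma pair_densityE u z : pair_density u z =
  lambda * \int[leb R]_(s in `[0, +oo[) semigroup gamma (s / 1) (tensor u) z.
Proof.
by rewrite /pair_density; congr (lambda * _); apply: eq_Rintegral => s _; rewrite (divr1 s).
Qed.

Lemma measurable_pair_density u : measurable_fun setT u ->
  measurable_fun setT (pair_density u).
Proof.
move=> mu; apply: measurable_funM => //.
have h : joint_meas (fun s : R => semigroup gamma s (tensor u)).
  apply: (@joint_meas_semigroup R _ R gamma id (fun=> tensor u)) => //.
  exact: joint_meas_const_tensor.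
have := @measurable_Rintegral_param _ _ _ _ R (@lebesgue_measure R) _ _ _ h.
by apply.
Qed.

Lemma n1_tensor_le u a : measurable_fun setT u -> (n1 (leb R) u <= a%:E)%E ->
  (n1 (leb2 R) (tensor u) <= (a ^+ 2)%:E)%E.
Proof.
move=> mu ua; rewrite (n1_tensor2 mu mu) expr2 EFinM.
by apply: lee_pmul => //; exact: n1_ge0.
Qed.

Lemma bound_ge0 u a : (n1 (leb R) u <= a%:E)%E -> 0 <= a.
Proof. by move=> ua; rewrite -lee_fin; apply: le_trans ua; exact: n1_ge0. Qed.

Lemma n1_tensorB_le u v a d : measurable_fun setT u -> measurable_fun setT v ->
  (n1 (leb R) u <= a%:E)%E -> (n1 (leb R) v <= a%:E)%E ->
  (n1 (leb R) (fun x => u x - v x) <= d%:E)%E ->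
  (n1 (leb2 R) (fun z => tensor u z - tensor v z) <= (2 * a * d)%:E)%E.
Proof.
move=> mu mv ua va uvd; apply: le_trans (n1_tensorB mu mv) _.
rewrite EFinM; apply: lee_pmul => //; first by apply: adde_ge0; exact: n1_ge0.
  exact: n1_ge0.
by rewrite mulrDl mul1r EFinD; exact: leeD.
Qed.

Lemma integral_n1_semigroup_tensor eps (D : set R) u a : 0 < eps -> measurable D ->
  D `<=` `[0, +oo[%classic -> measurable_fun setT u -> (n1 (leb R) u <= a%:E)%E ->
  (\int[leb R]_(s in D) n1 (leb2 R) (semigroup gamma (s / eps) (tensor u)) <=
   (a ^+ 2)%:E * \int[leb R]_(s in D) (expR (- (gamma / eps * s)))%:E)%E.
Proof.
move=> e0 mD D0 mu ua.
apply: le_trans (@n1_semigroup_family_le eps D (fun=> tensor u) (fun=> a ^+ 2) _ _ _ _ _) _ => //.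
- exact: joint_meas_const_tensor.
- by move=> s _; exact: sqr_ge0.
- by move=> s _; exact: n1_tensor_le.
under eq_integral do rewrite EFinM.
rewrite ge0_integralZl_EFin//; first exact: measurable_exp_lin.
exact: sqr_ge0.
Qed.

Lemma integral_n1_semigroup_tensor_fin eps u : 0 < eps ->
  measurable_fun setT u -> (n1 (leb R) u < +oo)%E ->
  (\int[leb R]_(s in `[0%R, +oo[) n1 (leb2 R) (semigroup gamma (s / eps) (tensor u)) < +oo)%E.
Proof.
move=> e0 mu uoo.
have ua : (n1 (leb R) u <= (fine (n1 (leb R) u))%:E)%E.
  by rewrite fineK// ge0_fin_numE ?n1_ge0.
have := @integral_n1_semigroup_tensor eps `[0, +oo[%classic _ _ e0 _ _ mu ua.
rewrite integral_exp_halfline ?divr_gt0// -EFinM => h.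
by apply: le_lt_trans (h _ _) _ => //; exact: ltry.
Qed.

Lemma n1_pair_density_le u a : measurable_fun setT u -> (n1 (leb R) u <= a%:E)%E ->
  (n1 (leb2 R) (pair_density u) <= (lambda / gamma * a ^+ 2)%:E)%E.
Proof.
move=> mu ua.
have mI := @measurable_Rintegral_param _ _ _ _ R (@lebesgue_measure R) _ _
   (measurable_itv `[0%R, +oo[) (joint_meas_semigroup_tensor 1 mu).
have -> : n1 (leb2 R) (pair_density u) = n1 (leb2 R) (fun z =>
    lambda * \int[leb R]_(s in `[0, +oo[) semigroup gamma (s / 1) (tensor u) z).
  by apply: eq_n1 => z; exact: pair_densityE.
rewrite n1Z// gtr0_norm// [lambda / _ * _](_ : _ = lambda * (a ^+ 2 * gamma^-1)); last by ring.
rewrite EFinM; apply: lee_wpmul2l; first by rewrite lee_fin ltW.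
apply: le_trans (minkowski_planar _ (joint_meas_semigroup_tensor 1 mu)) _ => //.
apply: le_trans (integral_n1_semigroup_tensor _ _ _ mu ua) _ => //.
by rewrite divr1 integral_exp_halfline.
Qed.

Lemma n1_pair_densityB_le u v a d : measurable_fun setT u -> measurable_fun setT v ->
  (n1 (leb R) u <= a%:E)%E -> (n1 (leb R) v <= a%:E)%E ->
  (n1 (leb R) (fun x => u x - v x) <= d%:E)%E ->
  (n1 (leb2 R) (fun z => pair_density u z - pair_density v z)
   <= (lambda / gamma * (2 * a * d))%:E)%E.
Proof.
move=> mu mv ua va uvd.
have mI w (mw : measurable_fun setT w) :=
   @measurable_Rintegral_param _ _ _ _ R (@lebesgue_measure R) _ _
   (measurable_itv `[0%R, +oo[) (joint_meas_semigroup_tensor 1 mw).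
have d0 := bound_ge0 uvd; have a0 := bound_ge0 ua.
have -> : n1 (leb2 R) (fun z => pair_density u z - pair_density v z) =
    n1 (leb2 R) (fun z => lambda *
   (\int[leb R]_(s in `[0, +oo[) semigroup gamma (s / 1) (tensor u) z -
    \int[leb R]_(s in `[0, +oo[) semigroup gamma (s / 1) (tensor v) z)).
  by apply: eq_n1 => z; rewrite !pair_densityE mulrBr.
rewrite n1Z; last by apply: measurable_funB; exact: mI.
rewrite gtr0_norm// [lambda / _ * _](_ : _ = lambda * (2 * a * d * gamma^-1)); last by ring.
rewrite EFinM; apply: lee_wpmul2l; first by rewrite lee_fin ltW.
have fin w b (mw : measurable_fun setT w) (wb : (n1 (leb R) w <= b%:E)%E) :
    (\int[leb R]_(s in `[0%R, +oo[) n1 (leb2 R) (semigroup gamma (s / 1) (tensor w)) < +oo)%E.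
  by apply: integral_n1_semigroup_tensor_fin => //; apply: le_lt_trans wb _; exact: ltry.
have mM := minkowskiB_planar
  (measurable_itv `[0%R, +oo[) (joint_meas_semigroup_tensor 1 mu) (joint_meas_semigroup_tensor 1 mv)
  (fin _ _ mu ua) (fin _ _ mv va).
apply: le_trans mM _.
have mT : joint_meas (fun _ : R => fun z => tensor u z - tensor v z).
  by apply: measurable_funB; exact: joint_meas_const_tensor.
have fam := @n1_semigroup_family_le 1 `[0, +oo[%classic
  (fun _ z => tensor u z - tensor v z) (fun=> 2 * a * d) _ mT.
apply: (@le_trans _ _ (\int[leb R]_(s in `[0%R, +oo[)
    n1 (leb2 R) (semigroup gamma (s / 1) (fun z => tensor u z - tensor v z)))%E).
  rewrite le_eqVlt; apply/orP; left; apply/eqP; apply: eq_integral => s _.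
  by apply: eq_n1 => z; rewrite /semigroup mulrBr.
apply: le_trans (fam _ _ _ _) _ => //.
- by move=> s _; rewrite !mulr_ge0.
- by move=> s _; exact: n1_tensorB_le.
under eq_integral do rewrite EFinM.
rewrite ge0_integralZl_EFin//; last 2 first.
- exact: measurable_exp_lin.
- by rewrite !mulr_ge0.
by rewrite divr1 integral_exp_halfline.
Qed.

(** The substitution s := s / eps identifies K with the integral in the Duhamel
    formula. It needs the integrand to be integrable, which holds at almost every
    point. *)
Lemma pair_density_rescaled eps u : 0 < eps -> measurable_fun setT u ->
  (n1 (leb R) u < +oo)%E ->
  n1 (leb2 R) (fun z => pair_density u z -
    lambda / eps * \int[leb R]_(s in `[0, +oo[) semigroup gamma (s / eps) (tensor u) z) = 0%E.
Proof.
move=> e0 mu uoo.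
have mI e := @measurable_Rintegral_param _ _ _ _ R (@lebesgue_measure R) _ _
   (measurable_itv `[0%R, +oo[) (joint_meas_semigroup_tensor e mu).
apply: n1_dist0; first exact: measurable_pair_density.
  by apply: measurable_funM => //; exact: mI.
have := ae_integrable_planar
  (measurable_itv `[0%R, +oo[) (joint_meas_semigroup_tensor 1 mu)
  (integral_n1_semigroup_tensor_fin ltr01 mu uoo).
apply: ae_mono => z iz; rewrite /pair_density -mulrA; congr (_ * _).
rewrite -(@Rintegral_scale _ _ (fun s => semigroup gamma s (tensor u) z))//.
- have := joint_meas_sec2 z (joint_meas_semigroup_tensor 1 mu).
  by apply: eq_measurable_fun => s _; rewrite divr1.
- by apply: eq_integrable iz => // s _; rewrite /= divr1.
Qed.

End pair_density.

(** * The collision operator *)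

Section collision.
Context (R : realType).
Variables (lambda gamma : R).
Hypotheses (lambda_gt0 : 0 < lambda) (gamma_gt0 : 0 < gamma).
Implicit Types (a d : R) (u v : R -> R).

Let K := pair_density lambda gamma.

(** The right-hand side of the equation for f once the pair density is replaced by
    its quasi-equilibrium K u. For integrable u it coincides with [Q1] almost
    everywhere. *)
Definition collision u x : R :=
  2 * gamma * marginal (K u) x - 2 * lambda * (\int[leb R]_y u y) * u x.

Lemma measurable_collision u : measurable_fun setT u -> measurable_fun setT (collision u).
Proof.
move=> mu; have mK := measurable_pair_density lambda gamma mu.
apply: measurable_funB; apply: measurable_funM => //.
exact: measurable_marginal.
Qed.

Lemma Rintegral_bound u a : measurable_fun setT u -> (n1 (leb R) u <= a%:E)%E ->
  `|\int[leb R]_x u x| <= a.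
Proof.
by move=> mu ua; rewrite -lee_fin; apply: le_trans ua; exact: Rintegral_le_n1.
Qed.

(** Both terms are quadratic, so the difference splits into products of one
    difference with one bounded factor: the gain contributes 4, the loss 2 + 2. *)
Lemma n1_collisionB_le u v a d : measurable_fun setT u -> measurable_fun setT v ->
  (n1 (leb R) u <= a%:E)%E -> (n1 (leb R) v <= a%:E)%E ->
  (n1 (leb R) (fun x => u x - v x) <= d%:E)%E ->
  (n1 (leb R) (fun x => collision u x - collision v x) <= (8 * lambda * a * d)%:E)%E.
Proof.
move=> mu mv ua va uvd.
have d0 := bound_ge0 uvd; have a0 := bound_ge0 ua.
have mKu := measurable_pair_density lambda gamma mu.
have mKv := measurable_pair_density lambda gamma mv.
have mPu := measurable_marginal mKu; have mPv := measurable_marginal mKv.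
have muv : measurable_fun setT (fun x => u x - v x) by exact: measurable_funB.
have mP : measurable_fun setT (fun x => marginal (K u) x - marginal (K v) x).
  exact: (measurable_funB mPu mPv).
have iu : (leb R).-integrable setT (EFin \o u).
  by apply/integrable_n1P; split => //; apply: le_lt_trans ua _; exact: ltry.
have iv : (leb R).-integrable setT (EFin \o v).
  by apply/integrable_n1P; split => //; apply: le_lt_trans va _; exact: ltry.
pose Mu := \int[leb R]_y u y; pose Mv := \int[leb R]_y v y.
have Mua : `|Mu| <= a by exact: Rintegral_bound.
have Muvd : `|Mu - Mv| <= d.
  by rewrite /Mu /Mv -RintegralB//; exact: Rintegral_bound.
pose t1 := fun x => 2 * gamma * (marginal (K u) x - marginal (K v) x).
(* The loss term varies first in u with the mass fixed, then in the mass. *)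
pose t2 := fun x => - (2 * lambda * Mu) * (u x - v x).
pose t3 := fun x => - (2 * lambda * (Mu - Mv)) * v x.
have m1 : measurable_fun setT t1.
  exact: (measurable_funM (measurable_cst (2 * gamma)) mP).
have m2 : measurable_fun setT t2.
  exact: (measurable_funM (measurable_cst (- (2 * lambda * Mu))) muv).
have m3 : measurable_fun setT t3.
  exact: (measurable_funM (measurable_cst (- (2 * lambda * (Mu - Mv)))) mv).
have E : n1 (leb R) (fun x => collision u x - collision v x) =
    n1 (leb R) (fun x => (t1 x + t2 x) + t3 x).
  apply: eq_n1 => x; rewrite /collision /t1 /t2 /t3 -/Mu -/Mv.
  by move: (marginal _ x) (marginal _ x) => p q; clearbody Mu Mv; ring.
rewrite E.
have P : (n1 (leb R) (fun x => marginal (K u) x - marginal (K v) x) <=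
    (lambda / gamma * (2 * a * d))%:E)%E.
  apply: le_trans (n1_marginalB mKu mKv _ _) _.
  - by apply: le_lt_trans (n1_pair_density_le _ _ mu ua) _ => //; exact: ltry.
  - by apply: le_lt_trans (n1_pair_density_le _ _ mv va) _ => //; exact: ltry.
  - exact: n1_pair_densityB_le.
have m12 : measurable_fun setT (fun x => t1 x + t2 x).
  exact: (measurable_funD m1 m2).
have P1 : (n1 (leb R) t1 <= (4 * lambda * a * d)%:E)%E.
  rewrite /t1; apply: (n1Z_le (leb R) mP P); rewrite gtr0_norm ?mulr_gt0// le_eqVlt; apply/orP; left.
  by apply/eqP; field; rewrite gt_eqF.
have P2 : (n1 (leb R) t2 <= (2 * lambda * a * d)%:E)%E.
  rewrite /t2; apply: (n1Z_le (leb R) muv uvd).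
  by rewrite normrN !normrM (gtr0_norm lambda_gt0) ger0_norm// !ler_wpM2r// ler_wpM2l// mulr_ge0// ltW.
have P3 : (n1 (leb R) t3 <= (2 * lambda * d * a)%:E)%E.
  rewrite /t3; apply: (n1Z_le (leb R) mv va).
  by rewrite normrN !normrM (gtr0_norm lambda_gt0) ger0_norm// !ler_wpM2r// ler_wpM2l// mulr_ge0// ltW.
have P12 : (n1 (leb R) (fun x => t1 x + t2 x) <= (6 * lambda * a * d)%:E)%E.
  by apply: (n1D_le (leb R) m1 m2 P1 P2); rewrite le_eqVlt; apply/orP; left; apply/eqP; ring.
by apply: (n1D_le (leb R) m12 m3 P12 P3); rewrite le_eqVlt; apply/orP; left; apply/eqP; ring.
Qed.

Let gainloss u s z : R := sigma lambda gamma s *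
  (expR s * (u (Phi (- s) z) * u (Phi_star (- s) z)) - u z.1 * u z.2).

Let inner u z : R := \int[leb R]_(s in `[0, +oo[) gainloss u s z.

Let gainlossE u s z : gainloss u s z = 2 * gamma * lambda *
  semigroup gamma (s / 1) (tensor u) z - sigma lambda gamma s * tensor u z.
Proof.
rewrite /gainloss /semigroup /tensor /sigma /= mulrBr divr1; congr (_ - _).
have -> : expR ((1 - gamma) * s) = expR (- (gamma * s)) * expR s.
  by rewrite -expRD; congr expR; ring.
ring.
Qed.

Let joint_meas_gainloss u : measurable_fun setT u -> joint_meas (gainloss u).
Proof.
move=> mu; rewrite (_ : gainloss u = fun s z => 2 * gamma * lambda *
  semigroup gamma (s / 1) (tensor u) z - sigma lambda gamma s * tensor u z); last first.
  by apply/funext => s; apply/funext => z; exact: gainlossE.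
apply: measurable_funB.
  by apply: measurable_funM => //; exact: joint_meas_semigroup_tensor.
apply: measurable_funM; last exact: joint_meas_const_tensor.
apply: measurable_funM => //; apply: measurableT_comp => //.
by apply: measurableT_comp => //; apply: measurable_funM => //.
Qed.

Let measurable_inner u : measurable_fun setT u -> measurable_fun setT (inner u).
Proof.
move=> mu; have := @measurable_Rintegral_param _ _ _ _ R (@lebesgue_measure R) _ _
  (measurable_itv `[0%R, +oo[) (joint_meas_gainloss mu).
by apply.
Qed.

Lemma measurable_Q1 u : measurable_fun setT u -> measurable_fun setT (Q1 lambda gamma u).
Proof. by move=> mu; exact: measurable_marginal (measurable_inner mu). Qed.

(** In [Q1] the gain and the loss sit under one integral over s. At almost every
    point each converges separately; the gain gives the marginal of K u, and the
    weight sigma has total mass 2 lambda, which gives the loss. *)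
Lemma n1_Q1_collision u : measurable_fun setT u -> (n1 (leb R) u < +oo)%E ->
  n1 (leb R) (fun x => Q1 lambda gamma u x - collision u x) = 0%E.
Proof.
move=> mu uoo.
have ua : (n1 (leb R) u <= (fine (n1 (leb R) u))%:E)%E.
  by rewrite fineK// ge0_fin_numE ?n1_ge0.
have iu : (leb R).-integrable setT (EFin \o u) by exact/integrable_n1P.
have mK := measurable_pair_density lambda gamma mu.
have mT := measurable_tensor2 mu mu.
have Koo : (n1 (leb2 R) (K u) < +oo)%E.
  by apply: le_lt_trans (n1_pair_density_le _ _ mu ua) _ => //; exact: ltry.
have Too : (n1 (leb2 R) (tensor u) < +oo)%E.
  by apply: le_lt_trans (n1_tensor_le mu ua) _; exact: ltry.
pose B z := 2 * gamma * K u z - 2 * lambda * tensor u z.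
have mB : measurable_fun setT B.
  by apply: measurable_funB; exact: measurable_funM.
have Boo : (n1 (leb2 R) B < +oo)%E.
  apply: n1B_lty; [exact: measurable_funM..|exact: n1Z_lty|exact: n1Z_lty].
have mI := measurable_inner mu.
have innerB : n1 (leb2 R) (fun z => inner u z - B z) = 0%E.
  apply: n1_dist0 => //.
  have ie := integrable_exp_halfline gamma_gt0.
  have mD : measurable ([set` `[0%R, +oo[%R] : set (measurableTypeR R)) by [].
  have sigma_int : (leb R).-integrable `[0, +oo[ (EFin \o sigma lambda gamma).
    by have := integrableZl mD (2 * lambda * gamma) ie.
  have sigmaE : \int[leb R]_(s in `[0, +oo[) sigma lambda gamma s = 2 * lambda.
    rewrite RintegralZl//.
    by rewrite /Rintegral integral_exp_halfline//= mulfK// gt_eqF.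
  have := ae_integrable_planar (measurable_itv `[0%R, +oo[)
    (joint_meas_semigroup_tensor gamma 1 mu)
    (integral_n1_semigroup_tensor_fin gamma_gt0 ltr01 mu uoo).
  apply: ae_mono => z iz; rewrite /inner.
  under eq_Rintegral do rewrite gainlossE.
  rewrite RintegralB//; last 2 first.
  - by have := integrableZl mD (2 * gamma * lambda) iz.
  - by have := integrableZr mD (tensor u z) sigma_int.
  rewrite RintegralZl// RintegralZr// sigmaE /B /K pair_densityE.
  by rewrite mulrA.
have inner_oo : (n1 (leb2 R) (inner u) < +oo)%E.
  have -> : n1 (leb2 R) (inner u) = n1 (leb2 R) (fun z => (inner u z - B z) + B z).
    by apply: eq_n1 => z; rewrite subrK.
  apply: n1D_lty => //; first exact: measurable_funB.
  by rewrite innerB.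
apply/eqP; rewrite eq_le n1_ge0 andbT.
have mQ := measurable_Q1 mu; have mC := measurable_collision mu.
have mMB := measurable_marginal mB.
apply: le_trans (n1_trans (leb R) mQ mC mMB) _.
rewrite -[leRHS]adde0; apply: leeD.
  by rewrite -innerB; exact: (n1_marginalB mI mB inner_oo Boo).
rewrite n1_dist0//.
have iK : (leb2 R).-integrable setT (EFin \o K u) by exact/integrable_n1P.
apply: ae_mono (ae_integrable1 iK) => x ix.
rewrite /marginal /B /collision RintegralB//; last 2 first.
- by have := integrableZl measurableT (2 * gamma) ix.
- by have := integrableZl measurableT (2 * lambda * u x) iu;
     apply: eq_integrable => // y _; rewrite /tensor /= EFinM; congr EFin; ring.
rewrite RintegralZl//; congr (_ - _).
rewrite -mulrA [_ * u x]mulrC mulrA -RintegralZl//.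
by apply: eq_Rintegral => y _; rewrite /tensor /=; ring.
Qed.

End collision.

(** * Primitives of continuous functions *)

Section primitives.
Context (R : realType).
Implicit Types (h : R -> R) (a b s t : R).

Lemma continuous_integrable_itv h a b : continuous h ->
  (leb R).-integrable `[a, b] (EFin \o h).
Proof.
move=> ch; apply: continuous_compact_integrable; first exact: segment_compact.
exact: continuous_subspaceT.
Qed.

(** The base point -1 lies to the left of all times considered, so that the
    primitive is differentiable at time 0 as well. *)
Definition prim h t : R := \int[leb R]_(s in `[- 1, t]) h s.

Lemma is_derive_prim h t : continuous h -> - 1 < t -> is_derive t (1:R) (prim h) (h t).
Proof.
move=> ch t1.
have tt1 : t < t + 1 by rewrite ltrDl.
have i := @continuous_integrable_itv h (- 1) (t + 1) ch.
have [dF <-] := @continuous_FTC1_closed R h (- 1) t (t + 1) tt1 i t1 (ch t).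
by rewrite derive1E; exact: derivableP.
Qed.

Lemma Rintegral_itv_split h c a b : (leb R).-integrable `[c, b] (EFin \o h) ->
  c <= a -> a <= b ->
  \int[leb R]_(s in `[c, b]) h s =
  \int[leb R]_(s in `[c, a]) h s + \int[leb R]_(s in `[a, b]) h s.
Proof.
move=> i ca ab; apply/eqP; rewrite addrC -subr_eq; apply/eqP.
rewrite (@Rintegral_itvB _ h (BLeft c) (BRight b) a i)//.
apply: Rintegral_itv_obnd_cbnd.
apply: integrableS i => //; move=> x /=; rewrite !in_itv/= => /andP[ax ->].
by rewrite andbT (le_trans ca)// ltW.
Qed.

Lemma integral_prim h a b : continuous h -> - 1 <= a -> a <= b ->
  \int[leb R]_(s in `[a, b]) h s = prim h b - prim h a.
Proof.
move=> ch a1 ab; rewrite /prim (@Rintegral_itv_split h (- 1) a b)//.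
  by rewrite addrAC subrr add0r.
exact: continuous_integrable_itv.
Qed.

Lemma max0_ge0 t : 0 <= Num.max 0 t.
Proof. by rewrite le_max lexx. Qed.

Lemma continuous_maxr0 : continuous (fun t : R => Num.max 0 t).
Proof. by move=> t; apply: continuous_max; [exact: cvg_cst|exact: cvg_id]. Qed.

Lemma continuous_prim_max h : continuous h ->
  continuous (fun t => prim h (Num.max 0 t)).
Proof.
move=> ch t.
have d := is_derive_prim ch (lt_le_trans (ltrN10 R) (max0_ge0 t)).
apply: (continuous_comp (g := prim h)); first exact: continuous_maxr0.
by apply/differentiable_continuous/derivable1_diffP; case: d.
Qed.

Lemma integral_itv_le_cst (h : R -> \bar R) (c a b : R) : 0 <= c -> a <= b ->
  measurable_fun `[a, b] h -> (forall s, s \in `[a, b] -> (0 <= h s <= c%:E)%E) ->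
  (\int[leb R]_(s in `[a, b]) h s <= (c * (b - a))%:E)%E.
Proof.
move=> c0 ab mh hc.
have := @integral_le_cst _ _ R (leb R) `[a, b]%classic h c (measurable_itv _) mh.
move=> H; apply: le_trans (H _ _) _.
- by move=> s sab; have /andP[] := hc s sab.
- by move=> s sab; have /andP[] := hc s sab.
rewrite /= lebesgue_measure_itv/= lte_fin; case: ifPn => [_|]; first by rewrite -EFinB -EFinM.
by rewrite mule0 lee_fin mulr_ge0// subr_ge0.
Qed.

End primitives.

(** * Continuous curves in L^1 *)

Section L1_curves.
Context d (T : measurableType d) (R : realType).
Variable mu : {measure set T -> \bar R}.
Implicit Types (u : R -> T -> R).

(** Curves defined for all real times: a curve on the half line is extended by its
    value at 0, which frees the estimates from one-sided limits. *)
Definition L1_curve u := [/\ joint_meas u, (forall t, n1 mu (u t) < +oo)%E &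
  forall t0 : R, n1 mu (fun x => u t x - u t0 x) @[t --> t0] --> 0%E].

Lemma cvg_mass u : L1_curve u -> continuous (fun t => \int[mu]_x u t x).
Proof.
move=> [ju uoo uc] t0; apply/cvgrPdist_le => e e0.
have := uc t0 => /fine_cvgP[fnum /cvgrPdist_le/(_ e e0)].
apply: filterS2 fnum => t tfin; rewrite sub0r normrN => te.
have mt s : measurable_fun setT (u s) by exact: joint_meas_sec.
have it s : mu.-integrable setT (EFin \o u s) by exact/integrable_n1P.
have mB : measurable_fun setT (fun x => u t x - u t0 x) by exact: measurable_funB.
rewrite distrC -RintegralB// -lee_fin; apply: le_trans (Rintegral_le_n1 mu mB) _.
rewrite -(fineK tfin) lee_fin; apply: le_trans te; exact: ler_norm.
Qed.

Lemma C_L1_extend u : C_L1 mu u -> L1_curve (fun t => u (Num.max 0 t)).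
Proof.
move=> [mu_ ui uc]; split.
- have m : measurable_fun setT (fun p : R * T => (Num.max 0 p.1, p.2)).
    apply: measurable_fun_pair => //.
    apply: (measurableT_comp (f := fun t : R => Num.max 0 t)) => //.
    exact: continuous_measurable_fun (@continuous_maxr0 R).
  have mD : measurable ((`[0, +oo[%classic : set R) `*` [set: T]).
    by apply: measurableX.
  apply: (measurable_comp mD _ mu_ m).
  by move=> _ [p _ <-]; split => //=; rewrite in_itv/= andbT max0_ge0.
- by move=> t; have := ui _ (max0_ge0 t) => /integrable_n1P[].
move=> t0.
have := uc _ (max0_ge0 t0); apply: cvg_comp => /=.
move=> A [e /= e0 Ae].
have := @continuous_maxr0 R t0.
move=> /cvgrPdist_lt/(_ e e0); apply: filterS => t te.
by apply: Ae => //=; rewrite in_itv/= andbT max0_ge0.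
Qed.

End L1_curves.

Lemma n1_ge0E d (T : measurableType d) (R : realType)
    (mu : {measure set T -> \bar R}) (u : T -> R) :
  measurable_fun setT u -> (n1 mu u < +oo)%E -> {ae mu, forall x, 0 <= u x} ->
  n1 mu u = (\int[mu]_x u x)%:E.
Proof.
move=> mU uoo u0.
have iu : mu.-integrable setT (EFin \o u) by exact/integrable_n1P.
rewrite /Rintegral fineK; last exact: integrable_fin_num.
apply: ae_eq_integral => //; [exact: measurable_normE|exact/measurable_EFinP|].
by apply: ae_mono u0 => x ux _; rewrite ger0_norm.
Qed.

(** * Uniform estimates for mild solutions *)

Section mild_solution_estimates.
Context (R : realType).
Variables (lambda gamma eps : R) (f0 : R -> R) (g0 : R * R -> R).
Variables (f : R -> R -> R) (g : R -> R * R -> R).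
Hypotheses (lambda_gt0 : 0 < lambda) (gamma_gt0 : 0 < gamma) (eps_gt0 : 0 < eps).
Hypotheses (mf0 : measurable_fun setT f0) (f0oo : (n1 (leb R) f0 < +oo)%E).
Hypotheses (mg0 : measurable_fun setT g0) (g0oo : (n1 (leb2 R) g0 < +oo)%E).
Hypotheses (cf : L1_curve (leb R) f) (cg : L1_curve (leb2 R) g).
Hypotheses (f_ge0 : forall t, {ae leb R, forall x, 0 <= f t x})
           (g_ge0 : forall t, {ae leb2 R, forall z, 0 <= g t z}).
Hypothesis f_mild : forall t, 0 <= t -> {ae leb R, forall x,
  f t x = damping lambda f 0 t * f0 x +
    2 * gamma * \int[leb R]_(s in `[0, t]) (damping lambda f s t * marginal (g s) x)}.
Hypothesis g_mild : forall t, 0 <= t -> {ae leb2 R, forall z,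
  g t z = semigroup gamma (t / eps) g0 z + lambda / eps *
    \int[leb R]_(s in `[0, t]) semigroup gamma (s / eps) (tensor (f (t - s))) z}.

Let M t : R := \int[leb R]_x f t x.
Let N t : R := \int[leb2 R]_z g t z.
Let M0 : R := \int[leb R]_x f0 x.
Let N0 : R := \int[leb2 R]_z g0 z.

Let mf t : measurable_fun setT (f t). Proof. by case: cf => j _ _; exact: joint_meas_sec. Qed.
Let mg t : measurable_fun setT (g t). Proof. by case: cg => j _ _; exact: joint_meas_sec. Qed.
Let foo t : (n1 (leb R) (f t) < +oo)%E. Proof. by case: cf. Qed.
Let goo t : (n1 (leb2 R) (g t) < +oo)%E. Proof. by case: cg. Qed.

Lemma n1_mass_f t : n1 (leb R) (f t) = (M t)%:E.
Proof. by apply: (@n1_ge0E _ _ R (leb R)); [exact: mf|exact: foo|exact: f_ge0]. Qed.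

Lemma n1_mass_g t : n1 (leb2 R) (g t) = (N t)%:E.
Proof. by apply: (@n1_ge0E _ _ R (leb2 R)); [exact: mg|exact: goo|exact: g_ge0]. Qed.

Lemma mass_f_ge0 t : 0 <= M t.
Proof. by rewrite -lee_fin -n1_mass_f n1_ge0. Qed.

Lemma mass_g_ge0 t : 0 <= N t.
Proof. by rewrite -lee_fin -n1_mass_g n1_ge0. Qed.

Lemma continuous_mass_f : continuous M. Proof. exact: cvg_mass cf. Qed.
Lemma continuous_mass_g : continuous N. Proof. exact: cvg_mass cg. Qed.

(** The primitive of the mass, constant at negative times, so that the damping
    factor becomes a function defined and continuous for all times. *)
Definition cumulative_mass t := prim M (Num.max 0 t).
Let A := cumulative_mass.

Definition weight s t := expR (- (2 * lambda * (A t - A s))).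

Lemma weight_mul s a b : weight s b = weight a b * weight s a.
Proof. by rewrite /weight -expRD; congr expR; ring. Qed.

Lemma cumulative_massB s t : 0 <= s -> s <= t ->
  A t - A s = \int[leb R]_(r in `[s, t]) M r.
Proof.
move=> s0 st; rewrite /A /cumulative_mass !max_r//; last exact: le_trans st.
rewrite integral_prim//; [exact: continuous_mass_f|exact: le_trans (lerN10 R) s0].
Qed.

Lemma damping_weight s t : 0 <= s -> s <= t -> damping lambda f s t = weight s t.
Proof. by move=> s0 st; rewrite /damping /weight cumulative_massB. Qed.

Lemma weight_ge0 s t : 0 <= weight s t.
Proof. exact: expR_ge0. Qed.

Lemma weight_le1 s t : 0 <= s -> s <= t -> weight s t <= 1.
Proof.
move=> s0 st; rewrite /weight -expR0 ler_expR oppr_le0 !mulr_ge0// ?(ltW lambda_gt0)//.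
by rewrite cumulative_massB// Rintegral_ge0// => r _; exact: mass_f_ge0.
Qed.

Lemma continuous_weight t : continuous (weight ^~ t).
Proof.
move=> s; apply: continuous_comp; last exact: continuous_expR.
apply: cvgN; apply: cvgM; first exact: cvg_cst.
by apply: cvgB; [exact: cvg_cst|exact: continuous_prim_max continuous_mass_f s].
Qed.

Let jP : joint_meas (fun s => marginal (g s)).
Proof. by case: cg => j _ _; exact: joint_meas_marginal. Qed.

Lemma joint_meas_weighted t : joint_meas (fun s x => weight s t * marginal (g s) x).
Proof.
apply: measurable_funM => //.
apply: (measurableT_comp (f := weight ^~ t)) => //.
exact: continuous_measurable_fun (@continuous_weight t).
Qed.

Lemma n1_marginal_g s : (n1 (leb R) (marginal (g s)) <= (N s)%:E)%E.
Proof. by rewrite -n1_mass_g; exact: n1_marginal. Qed.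

Lemma integral_weighted_le a t : 0 <= a ->
  (\int[leb R]_(s in `[a, t]) n1 (leb R) (fun x => weight s t * marginal (g s) x)
   <= \int[leb R]_(s in `[a, t]) (N s)%:E)%E.
Proof.
move=> a0; apply: ge0_le_integral => //.
- by move=> s _; exact: n1_ge0.
- by have := @measurable_n1_param _ _ _ _ R (@lebesgue_measure R) _ (joint_meas_weighted t);
    exact: measurable_funTS.
- apply/measurable_EFinP; apply: measurable_funTS.
  exact: continuous_measurable_fun continuous_mass_g.
move=> s /=; rewrite in_itv/= => /andP[as_ st].
apply: (n1Z_le (leb R) _ (n1_marginal_g s)); first exact: measurable_marginal.
rewrite ger0_norm ?weight_ge0// ler_piMl ?mass_g_ge0// weight_le1//.
exact: le_trans as_.
Qed.

Lemma integral_weighted_fin a t : 0 <= a ->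
  (\int[leb R]_(s in `[a, t]) n1 (leb R) (fun x => weight s t * marginal (g s) x) < +oo)%E.
Proof.
move=> a0; apply: le_lt_trans (integral_weighted_le _ a0) _.
have := continuous_integrable_itv a t continuous_mass_g.
move=> /integrableP[_]; under eq_integral do rewrite /= ger0_norm ?mass_g_ge0//.
by [].
Qed.

Lemma f_mildE t : 0 <= t -> {ae leb R, forall x,
  f t x = weight 0 t * f0 x +
    2 * gamma * \int[leb R]_(s in `[0, t]) (weight s t * marginal (g s) x)}.
Proof.
move=> t0; apply: ae_mono (f_mild t0) => x ->.
rewrite (damping_weight (lexx 0) t0); congr (_ + _).
apply: (congr1 (fun y => 2 * gamma * y)); apply: eq_Rintegral => s.
by rewrite inE/= in_itv/= => /andP[s0 st]; rewrite (damping_weight s0 st).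
Qed.

Lemma measurable_weighted_integral a t : measurable_fun setT (fun x =>
  \int[leb R]_(s in `[a, t]) (weight s t * marginal (g s) x)).
Proof.
have := @measurable_Rintegral_param _ _ _ _ R (@lebesgue_measure R) _ _
  (measurable_itv `[a, t]) (joint_meas_weighted t).
by apply.
Qed.

Lemma n1_weighted_integral_lty a t : 0 <= a -> (n1 (leb R) (fun x =>
  \int[leb R]_(s in `[a, t]) (weight s t * marginal (g s) x)) < +oo)%E.
Proof.
move=> a0; apply: le_lt_trans (integral_weighted_fin t a0).
exact: (minkowski_integral (@lebesgue_measure R) (@lebesgue_measure R) _ (joint_meas_weighted t)).
Qed.

(** Fubini in the Duhamel formula: the marginal of g has the same integral as g. *)
Lemma mass_f_formula t : 0 <= t ->
  M t = weight 0 t * M0 + 2 * gamma * \int[leb R]_(s in `[0, t]) (weight s t * N s).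
Proof.
move=> t0; rewrite /M.
have mW := measurable_weighted_integral 0 t.
have iW : (leb R).-integrable setT (EFin \o (fun x =>
    \int[leb R]_(s in `[0, t]) (weight s t * marginal (g s) x))).
  by apply/integrable_n1P; split => //; exact: n1_weighted_integral_lty.
have if0 : (leb R).-integrable setT (EFin \o f0) by exact/integrable_n1P.
transitivity (\int[leb R]_x (weight 0 t * f0 x +
    2 * gamma * \int[leb R]_(s in `[0, t]) (weight s t * marginal (g s) x))).
  apply: (eq_Rintegral_ae (leb R) _ _ (f_mildE t0)); first exact: mf.
  by apply: measurable_funD; exact: measurable_funM.
rewrite RintegralD//; last 2 first.
- by have := integrableZl measurableT (weight 0 t) if0.
- by have := integrableZl measurableT (2 * gamma) iW.
rewrite !RintegralZl//; congr (_ + _ * _).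
rewrite (@Rintegral_swap _ _ _ _ R (@lebesgue_measure R) (@lebesgue_measure R))//; last 2 first.
- exact: joint_meas_weighted.
- exact: integral_weighted_fin.
apply: eq_Rintegral => s _; rewrite RintegralZl//.
  rewrite integral_marginal//; apply/integrable_n1P; split; [exact: mg|exact: goo].
apply/integrable_n1P; split; first exact: measurable_marginal.
by apply: le_lt_trans (n1_marginal_g s) _; exact: ltry.
Qed.

Let jT (t : R) : joint_meas (fun s : R => tensor (f (t - s))).
Proof.
apply: joint_meas_tensor; case: cf => j _ _.
apply: (measurableT_comp j (g := fun p : R * R => (t - p.1, p.2))).
by apply: measurable_fun_pair => //; apply: measurable_funB.
Qed.

Lemma joint_meas_gain t : joint_meas (fun s : R => semigroup gamma (s / eps) (tensor (f (t - s)))).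
Proof.
apply: (@joint_meas_semigroup _ _ R gamma (fun s => s / eps) (fun s => tensor (f (t - s)))) => //.
exact: measurable_funM.
Qed.

Lemma n1_gain t s : n1 (leb2 R) (semigroup gamma (s / eps) (tensor (f (t - s)))) =
  (expR (- (gamma / eps * s)) * M (t - s) ^+ 2)%:E.
Proof.
rewrite n1_semigroup; last exact: measurable_tensor2.
rewrite (n1_tensor2 (mf _) (mf _)) n1_mass_f -!EFinM expr2.
by congr (expR _ * _)%:E; ring.
Qed.

Let cont_gain t : continuous (fun s => expR (- (gamma / eps * s)) * M (t - s) ^+ 2).
Proof.
move=> s; apply: cvgM.
  apply: continuous_comp; last exact: continuous_expR.
  by apply: cvgN; apply: cvgM; [exact: cvg_cst|exact: cvg_id].
have h : (fun s => M (t - s)) s' @[s' --> s] --> M (t - s).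
  apply: (continuous_comp (f := fun s => t - s)); last exact: continuous_mass_f.
  by apply: cvgB; [exact: cvg_cst|exact: cvg_id].
by rewrite expr2; under eq_fun do rewrite expr2; exact: cvgM.
Qed.

Lemma integral_gain_fin t : (\int[leb R]_(s in `[0%R, t])
  n1 (leb2 R) (semigroup gamma (s / eps) (tensor (f (t - s)))) < +oo)%E.
Proof.
have := continuous_integrable_itv 0 t (@cont_gain t).
move=> /integrableP[_]; congr (_ < _)%E; apply: eq_integral => s _.
by rewrite /= n1_gain ger0_norm// mulr_ge0 ?expR_ge0// sqr_ge0.
Qed.

Lemma measurable_gain_integral t : measurable_fun setT (fun z =>
  \int[leb R]_(s in `[0, t]) semigroup gamma (s / eps) (tensor (f (t - s))) z).
Proof.
have := @measurable_Rintegral_param _ _ _ _ R (@lebesgue_measure R) _ _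
  (measurable_itv `[0%R, t]) (joint_meas_gain t).
by apply.
Qed.

(** Integration of the Duhamel formula over the plane; the semigroup multiplies the
    integral by e^(- gamma t / eps). *)
Lemma mass_g_formula t : 0 <= t ->
  N t = expR (- (gamma / eps * t)) * N0 +
    lambda / eps * \int[leb R]_(s in `[0, t]) (expR (- (gamma / eps * s)) * M (t - s) ^+ 2).
Proof.
move=> t0; rewrite /N.
have mI := measurable_gain_integral t.
have mS := measurable_semigroup gamma (t / eps) mg0.
have ig0 : (leb2 R).-integrable setT (EFin \o g0) by exact/integrable_n1P.
have iS : (leb2 R).-integrable setT (EFin \o semigroup gamma (t / eps) g0).
  apply/integrable_n1P; split => //.
  by rewrite n1_semigroup// lte_mul_pinfty// lee_fin expR_ge0.
have iI : (leb2 R).-integrable setT (EFin \o (fun z =>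
    \int[leb R]_(s in `[0, t]) semigroup gamma (s / eps) (tensor (f (t - s))) z)).
  apply/integrable_n1P; split => //.
  apply: le_lt_trans (integral_gain_fin t).
  exact: (minkowski_planar _ (joint_meas_gain t)).
transitivity (\int[leb2 R]_z (semigroup gamma (t / eps) g0 z + lambda / eps *
    \int[leb R]_(s in `[0, t]) semigroup gamma (s / eps) (tensor (f (t - s))) z)).
  apply: (eq_Rintegral_ae (leb2 R) _ _ (g_mild t0)); first exact: mg.
  by apply: measurable_funD => //; exact: measurable_funM.
rewrite RintegralD//; last by have := integrableZl measurableT (lambda / eps) iI.
rewrite RintegralZl// integral_semigroup//; congr (_ + _).
  by congr (expR _ * _); ring.
apply: (congr1 (fun y => lambda / eps * y)).
rewrite (Rintegral_swap_planar (measurable_itv _) (joint_meas_gain t) (integral_gain_fin t)).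
apply: eq_Rintegral => s _; rewrite integral_semigroup; last first.
  apply/integrable_n1P; split; first exact: measurable_tensor2.
  by rewrite (n1_tensor2 (mf _) (mf _)) n1_mass_f -EFinM ltry.
rewrite integral_tensor; last by apply/integrable_n1P; split; [exact: mf|exact: foo].
by congr (expR _ * _); ring.
Qed.

Lemma gain_reflect t : \int[leb R]_(s in `[0, t])
    (expR (- (gamma / eps * s)) * M (t - s) ^+ 2) =
  expR (- (gamma / eps * t)) *
    \int[leb R]_(r in `[0, t]) (expR (gamma / eps * r) * M r ^+ 2).
Proof.
pose h r := expR (gamma / eps * r) * M r ^+ 2.
have ch : continuous h.
  move=> s; apply: cvgM.
    apply: continuous_comp; last exact: continuous_expR.
    by apply: cvgM; [exact: cvg_cst|exact: cvg_id].
  have hM : M s' @[s' --> s] --> M s by exact: continuous_mass_f.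
  by rewrite expr2; under eq_fun do rewrite expr2; exact: cvgM.
have h0 s : 0 <= h s by rewrite mulr_ge0 ?expR_ge0// sqr_ge0.
have ih := continuous_integrable_itv 0 t ch.
rewrite -[in RHS]RintegralZl// /Rintegral; congr fine.
have cE : continuous (fun r => expR (- (gamma / eps * t)) * h r).
  by move=> r; apply: cvgM; [exact: cvg_cst|exact: ch].
rewrite -[RHS](@ge0_integral_itv_reflect R t (fun r => expR (- (gamma / eps * t)) * h r)).
- apply: eq_integral => s _; congr (_%:E); rewrite /h mulrA -expRD.
  by congr (expR _ * _); ring.
- exact: continuous_measurable_fun.
- by move=> s; rewrite mulr_ge0 ?expR_ge0.
Qed.

(** A pair is made of two particles and its density carries the factor eps. The
    two integrated Duhamel formulas show that both masses are differentiable, and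
    their derivatives cancel in this combination; the mean value theorem concludes. *)
Lemma mass_conservation t : 0 <= t -> M t + 2 * eps * N t = M 0 + 2 * eps * N 0.
Proof.
move=> t0.
have cM := continuous_mass_f; have cN := continuous_mass_g.
pose k := gamma / eps.
pose hf s := expR (2 * lambda * A s) * N s.
pose hg s := expR (k * s) * M s ^+ 2.
have chf : continuous hf.
  move=> s; apply: cvgM; last exact: cN.
  apply: continuous_comp; last exact: continuous_expR.
  by apply: cvgM; [exact: cvg_cst|exact: continuous_prim_max cM s].
have chg : continuous hg.
  move=> s; apply: cvgM.
    apply: continuous_comp; last exact: continuous_expR.
    by apply: cvgM; [exact: cvg_cst|exact: cvg_id].
  have hM : M s' @[s' --> s] --> M s by exact: cM.
  by rewrite expr2; under eq_fun do rewrite expr2; exact: cvgM.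
pose c := expR (2 * lambda * prim M 0).
pose Pf s := M0 * c + 2 * gamma * (prim hf s - prim hf 0).
pose Pg s := N0 + lambda / eps * (prim hg s - prim hg 0).
(* F and G extend the masses to times in (-1, 0) as differentiable functions. *)
pose F s := expR (- (2 * lambda * prim M s)) * Pf s.
pose G s := expR (- (k * s)) * Pg s.
have AE s : 0 <= s -> A s = prim M s.
  by move=> s0; rewrite /A /cumulative_mass max_r.
have FE s : 0 <= s -> M s = F s.
  move=> s0; rewrite mass_f_formula// /F /Pf mulrDr /weight !AE//; congr (_ + _).
    by rewrite mulrCA mulrC -expRD; congr (_ * expR _); ring.
  rewrite -(integral_prim chf)// ?lerN10//.
  rewrite [RHS]mulrCA; congr (_ * _).
  rewrite -RintegralZl//; last exact: continuous_integrable_itv.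
  apply: eq_Rintegral => r; rewrite inE/= in_itv/= => /andP[r0 _].
  rewrite /hf AE// mulrA -expRD; congr (expR _ * _); ring.
have GE s : 0 <= s -> N s = G s.
  move=> s0; rewrite mass_g_formula// /G /Pg mulrDr; congr (_ + _).
  rewrite gain_reflect -(integral_prim chg)// ?lerN10//.
  by rewrite -/k; exact: mulrCA.
pose D s := F s + 2 * eps * G s.
pose dD s : R := (- (2 * lambda * M s) * F s + expR (- (2 * lambda * prim M s)) * (2 * gamma * hf s))
  + 2 * eps * (- k * G s + expR (- (k * s)) * (lambda / eps * hg s)).
have derD (s : R) : - 1 < s -> is_derive s (1:R) D (dD s).
  move=> s1.
  have d1 := is_derive_prim cM s1.
  have d2 := is_derive_prim chf s1.
  have d3 := is_derive_prim chg s1.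
  apply: is_derive_eq; rewrite /GRing.scale /= /dD /F /G /Pf /Pg.
  ring.
have dD0 (s : R) : 0 <= s -> dD s = 0.
  move=> s0; rewrite /dD -FE// -GE// /hf /hg AE//.
  have -> : expR (- (2 * lambda * prim M s)) * (2 * gamma * (expR (2 * lambda * prim M s) * N s)) =
      2 * gamma * N s * (expR (- (2 * lambda * prim M s)) * expR (2 * lambda * prim M s)) by ring.
  have -> : expR (- (k * s)) * (lambda / eps * (expR (k * s) * M s ^+ 2)) =
      lambda / eps * M s ^+ 2 * (expR (- (k * s)) * expR (k * s)) by ring.
  rewrite -!expRD !addNr expR0 !mulr1 /k; field; exact: lt0r_neq0.
have [x /=] : exists2 x, x \in `[0, t]%R & D t - D 0 = dD x * (t - 0).
  apply: (MVT_segment t0).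
  - move=> s; rewrite in_itv/= => /andP[s0 _]; apply: derD.
    exact: lt_trans (ltrN10 R) s0.
  - apply: continuous_in_subspaceT => s; rewrite inE/= in_itv/= => /andP[s0 _].
    apply/differentiable_continuous/derivable1_diffP.
    by case: (derD _ (lt_le_trans (ltrN10 R) s0)).
rewrite in_itv/= => /andP[x0 _]; rewrite dD0// mul0r => /eqP; rewrite subr_eq0 => /eqP.
by rewrite /D -!FE// -!GE.
Qed.

Lemma mass_f0 : M 0 = M0.
Proof.
rewrite mass_f_formula// set_itv1 Rintegral_set1 mulr0 addr0.
by rewrite /weight subrr mulr0 oppr0 expR0 mul1r.
Qed.

Lemma mass_g0 : N 0 = N0.
Proof.
rewrite mass_g_formula// set_itv1 Rintegral_set1 !mulr0 addr0.
by rewrite oppr0 expR0 mul1r.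
Qed.

Let m := M0 + 2 * N0.
Hypothesis eps_le1 : eps <= 1.

Let M0_ge0 : 0 <= M0. Proof. by rewrite -mass_f0 mass_f_ge0. Qed.
Let N0_ge0 : 0 <= N0. Proof. by rewrite -mass_g0 mass_g_ge0. Qed.
Let m_ge0 : 0 <= m. Proof. by rewrite /m addr_ge0// mulr_ge0. Qed.

Lemma mass_f_le t : 0 <= t -> M t <= m.
Proof.
move=> t0; have := mass_conservation t0; rewrite mass_f0 mass_g0 => E.
apply: (@le_trans _ _ (M0 + 2 * eps * N0)).
  by rewrite -E lerDl !mulr_ge0// ?mass_g_ge0// ltW.
by rewrite /m lerD2l ler_wpM2r// ler_piMr.
Qed.

Let n := N0 + lambda / gamma * m ^+ 2.

Let n_ge0 : 0 <= n.
Proof. by rewrite /n addr_ge0// mulr_ge0 ?sqr_ge0// divr_ge0// ltW. Qed.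

Lemma mass_g_le t : 0 <= t -> N t <= n.
Proof.
move=> t0; rewrite mass_g_formula//.
have k0 : 0 < gamma / eps by rewrite divr_gt0.
rewrite /n lerD//.
  by rewrite ler_piMl// -expR0 ler_expR oppr_le0 mulr_ge0// ltW.
have ih := continuous_integrable_itv 0 t (@cont_gain t).
have le1 : \int[leb R]_(s in `[0, t]) (expR (- (gamma / eps * s)) * M (t - s) ^+ 2) <=
    eps / gamma * m ^+ 2.
  rewrite -lee_fin /Rintegral fineK; last exact: integrable_fin_num.
  apply: (@le_trans _ _ (\int[leb R]_(s in `[0%R, t])
      ((m ^+ 2)%:E * (expR (- (gamma / eps * s)))%:E))%E).
    apply: ge0_le_integral => //.
    - by move=> s _; rewrite lee_fin mulr_ge0 ?expR_ge0// sqr_ge0.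
    - exact: measurable_int ih.
    - by apply: emeasurable_funM => //; exact: measurable_exp_lin.
    move=> s /=; rewrite in_itv/= => /andP[s0 st].
    rewrite -EFinM lee_fin mulrC ler_wpM2r ?expR_ge0//.
    rewrite lerXn2r ?nnegrE ?mass_f_ge0//.
    by apply: mass_f_le; rewrite subr_ge0.
  rewrite ge0_integralZl_EFin//; last 2 first.
  - exact: measurable_exp_lin.
  - exact: sqr_ge0.
  apply: (@le_trans _ _ ((m ^+ 2)%:E * (eps / gamma)%:E)%E); last first.
    by rewrite -EFinM mulrC.
  apply: lee_wpmul2l; first by rewrite lee_fin sqr_ge0.
  by have := @integral_exp_itv R _ 0 t k0 (lexx 0); rewrite invf_div.
apply: (@le_trans _ _ (lambda / eps * (eps / gamma * m ^+ 2))).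
  by rewrite ler_wpM2l// divr_ge0// ltW.
rewrite mulrA; apply: ler_wpM2r; first exact: sqr_ge0.
rewrite le_eqVlt; apply/orP; left; apply/eqP; field.
by rewrite !gt_eqF.
Qed.

Lemma n1_f_le t : 0 <= t -> (n1 (leb R) (f t) <= m%:E)%E.
Proof. by move=> t0; rewrite n1_mass_f lee_fin mass_f_le. Qed.

Lemma n1_g_le t : 0 <= t -> (n1 (leb2 R) (g t) <= n%:E)%E.
Proof. by move=> t0; rewrite n1_mass_g lee_fin mass_g_le. Qed.

(** Duhamel's formula restarted at time a, from the multiplicativity of the weight. *)
Lemma f_restart a b : 0 <= a -> a <= b -> {ae leb R, forall x,
  f b x = weight a b * f a x +
    2 * gamma * \int[leb R]_(s in `[a, b]) (weight s b * marginal (g s) x)}.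
Proof.
move=> a0 ab; have b0 := le_trans a0 ab.
have ia := @ae_integrable_param _ _ _ _ R (@lebesgue_measure R) (@lebesgue_measure R) _ _
  (measurable_itv `[0%R, a]) (joint_meas_weighted a) (integral_weighted_fin a (lexx 0)).
have ib := @ae_integrable_param _ _ _ _ R (@lebesgue_measure R) (@lebesgue_measure R) _ _
  (measurable_itv `[0%R, b]) (joint_meas_weighted b) (integral_weighted_fin b (lexx 0)).
have i12 := ae_mono2 (fun x p q => conj p q) (f_mildE a0) (f_mildE b0).
have i34 := ae_mono2 (fun x p q => conj p q) ia ib.
apply: ae_mono2 i12 i34 => x [-> ->] [iax ibx].
pose I c d e := \int[leb R]_(s in `[c, d]) (weight s e * marginal (g s) x).
have S : I 0 b b = I 0 a b + I a b b := Rintegral_itv_split ibx a0 ab.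
have S2 : I 0 a b = weight a b * I 0 a a.
  have Z := @RintegralZl _ _ R (leb R) _ _ (weight a b) (measurable_itv `[0%R, a]) iax.
  rewrite -[RHS]Z; apply: eq_Rintegral => s _.
  by rewrite (weight_mul s a b) mulrA.
change (weight 0 b * f0 x + 2 * gamma * I 0 b b = weight a b *
  (weight 0 a * f0 x + 2 * gamma * I 0 a a) + 2 * gamma * I a b b).
rewrite S S2 (weight_mul 0 a b).
move: (weight a b) (weight 0 a) (f0 x) (I 0 a a) (I a b b) => *; ring.
Qed.

Lemma one_sub_weight_le a b s : 0 <= a -> a <= s -> s <= b ->
  1 - weight s b <= 2 * lambda * m * (b - a).
Proof.
move=> a0 as_ sb; have s0 := le_trans a0 as_.
rewrite /weight cumulative_massB//.
set y := \int[_]_(_ in _) _.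
have yle : y <= m * (b - s).
  rewrite -lee_fin /y /Rintegral fineK; last first.
    by apply: integrable_fin_num => //; exact: continuous_integrable_itv continuous_mass_f.
  apply: integral_itv_le_cst => //.
    apply/measurable_EFinP; apply: measurable_funTS.
    exact: continuous_measurable_fun continuous_mass_f.
  move=> r; rewrite in_itv/= => /andP[sr _].
  by rewrite !lee_fin mass_f_ge0 mass_f_le// (le_trans s0).
apply: (@le_trans _ _ (2 * lambda * y)).
  by rewrite lerBlDr -lerBlDl; apply: le_trans (expR_ge1Dx _); rewrite addrC.
rewrite -!mulrA; apply: ler_wpM2l => //; apply: ler_wpM2l; first exact: ltW.
by apply: le_trans yle _; rewrite ler_wpM2l// lerB.
Qed.

Lemma measurable_n1_weighted b (v : R -> R) : measurable_fun setT v ->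
  measurable_fun setT (fun s => n1 (leb R) (fun x => weight s b * marginal (g s) x - v x)).
Proof.
move=> mv.
have j : joint_meas (fun s x => weight s b * marginal (g s) x - v x).
  apply: measurable_funB; first exact: joint_meas_weighted.
  exact: (measurableT_comp mv (@measurable_snd _ _ R R)).
by have := @measurable_n1_param _ _ _ _ R (@lebesgue_measure R) _ j; apply.
Qed.

Lemma n1_weighted_integral_le a b : 0 <= a -> a <= b ->
  (n1 (leb R) (fun x => \int[leb R]_(s in `[a, b]) (weight s b * marginal (g s) x))
   <= (n * (b - a))%:E)%E.
Proof.
move=> a0 ab.
apply: le_trans (minkowski_integral (@lebesgue_measure R) (@lebesgue_measure R) _
  (joint_meas_weighted b)) _ => //.
apply: le_trans (integral_weighted_le b a0) _.
apply: integral_itv_le_cst => //.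
  apply/measurable_EFinP; apply: measurable_funTS.
  exact: continuous_measurable_fun continuous_mass_g.
move=> s; rewrite in_itv/= => /andP[as_ _].
by rewrite !lee_fin mass_g_ge0 mass_g_le// (le_trans a0).
Qed.

Let L := 2 * lambda * m ^+ 2 + 2 * gamma * n.

Let L_ge0 : 0 <= L.
Proof. by rewrite /L addr_ge0// !mulr_ge0 ?sqr_ge0// ltW. Qed.

(** In the formula restarted at a, the damping of f(a) and the gain are both of
    order b - a. *)
Lemma f_lipschitz a b : 0 <= a -> a <= b ->
  (n1 (leb R) (fun x => f b x - f a x) <= (L * (b - a))%:E)%E.
Proof.
move=> a0 ab.
pose V x := \int[leb R]_(s in `[a, b]) (weight s b * marginal (g s) x).
have mV : measurable_fun setT V := measurable_weighted_integral a b.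
have mV2 : measurable_fun setT (fun x => 2 * gamma * V x).
  exact: measurable_funM.
have mW : measurable_fun setT (fun x => (weight a b - 1) * f a x).
  exact: measurable_funM.
have mfab : measurable_fun setT (fun x => f b x - f a x) by exact: measurable_funB.
have mWV : measurable_fun setT (fun x => (weight a b - 1) * f a x + 2 * gamma * V x).
  exact: (measurable_funD mW mV2).
rewrite (n1_ae (leb R) mfab mWV); last first.
  by apply: ae_mono (f_restart a0 ab) => x ->; rewrite -/(V x); ring.
have nV : (n1 (leb R) (fun x => 2 * gamma * V x) <= (2 * gamma * (n * (b - a)))%:E)%E.
  apply: (n1Z_le (leb R) mV (n1_weighted_integral_le a0 ab)).
  by rewrite ger0_norm// mulr_ge0// ltW.
have nW : (n1 (leb R) (fun x => (weight a b - 1) * f a x) <=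
    (2 * lambda * m * (b - a) * m)%:E)%E.
  apply: (n1Z_le (leb R) (mf a) (n1_f_le a0)); apply: ler_wpM2r => //.
  rewrite distrC ger0_norm ?one_sub_weight_le// subr_ge0; exact: weight_le1.
apply: (n1D_le (leb R) mW mV2 nW nV).
by rewrite /L le_eqVlt; apply/orP; left; apply/eqP; ring.
Qed.

Let k := gamma / eps.
Let k_gt0 : 0 < k. Proof. by rewrite /k divr_gt0. Qed.
Let K := pair_density lambda gamma.

(** Compares the Duhamel integral of g with the one where f is frozen at time t and
    the past extends to - oo. On [0, t] the sources differ by O(s), by the
    Lipschitz bound, against the weight e^(- k s); the remaining past gives a tail
    of that exponential. *)
Lemma relaxation_integral t : 0 <= t ->
  (n1 (leb2 R) (fun z =>
     \int[leb R]_(s in `[0, t]) semigroup gamma (s / eps) (tensor (f (t - s))) z -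
     \int[leb R]_(s in `[0, +oo[) semigroup gamma (s / eps) (tensor (f t)) z)
   <= (2 * m * L * (4 / k ^+ 2) + m ^+ 2 * (expR (- (k * t)) / k))%:E)%E.
Proof.
move=> t0.
pose D := (`[0, t]%classic : set R).
have mD : measurable D by exact: measurable_itv.
pose H1 s z : R := \1_D s * semigroup gamma (s / eps) (tensor (f (t - s))) z.
pose H2 s := semigroup gamma (s / eps) (tensor (f t)).
have j1 : joint_meas H1 := joint_meas_indicM mD (joint_meas_gain t).
have j2 : joint_meas H2 := joint_meas_semigroup_tensor gamma eps (mf t).
have E1 z : \int[leb R]_(s in `[0, t]) semigroup gamma (s / eps) (tensor (f (t - s))) z =
    \int[leb R]_(s in `[0, +oo[) H1 s z.
  rewrite /Rintegral; congr fine.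
  rewrite integral_mkcond [RHS]integral_mkcond.
  apply: eq_integral => s _; rewrite !patchE; case: ifPn => st; case: ifPn => s0.
  - by rewrite /H1 indicE st mul1r.
  - by move: st s0; rewrite !mem_setE !in_itv/= andbT => /andP[->].
  - by rewrite /H1 indicE (negbTE st) mul0r.
  - by [].
have -> : n1 (leb2 R) (fun z =>
     \int[leb R]_(s in `[0, t]) semigroup gamma (s / eps) (tensor (f (t - s))) z -
     \int[leb R]_(s in `[0, +oo[) semigroup gamma (s / eps) (tensor (f t)) z) =
  n1 (leb2 R) (fun z => \int[leb R]_(s in `[0, +oo[) H1 s z -
     \int[leb R]_(s in `[0, +oo[) H2 s z).
  by apply: eq_n1 => z; rewrite E1.
have fin2 := integral_n1_semigroup_tensor_fin gamma_gt0 eps_gt0 (mf t) (foo t).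
have fin1 : (\int[leb R]_(s in `[0%R, +oo[) n1 (leb2 R) (H1 s) < +oo)%E.
  apply: le_lt_trans (integral_gain_fin t).
  rewrite [leLHS]integral_mkcond [leRHS]integral_mkcond.
  rewrite le_eqVlt; apply/orP; left; apply/eqP; apply: eq_integral => s _.
  rewrite !patchE; case: ifPn => s0; case: ifPn => st.
  - by apply: eq_n1 => z; rewrite /H1 indicE st mul1r.
  - by apply: integral0_eq => z _; rewrite /H1 indicE (negbTE st) mul0r normr0.
  - by move: s0 st; rewrite !mem_setE !in_itv/= andbT => /negbTE ->.
  - by [].
apply: le_trans (minkowskiB_planar (measurable_itv `[0%R, +oo[) j1 j2 fin1 fin2) _.
pose d s z := H1 s z - H2 s z.
have jd : joint_meas d by exact: measurable_funB.
have mnd := measurable_n1_planar jd.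
have -> : (`[0, +oo[%classic : set R) = `[0, t] `|` `]t, +oo[.
  by rewrite -itv_bndbnd_setU// bnd_simp.
rewrite ge0_integral_setU//; last 3 first.
- exact: measurable_funTS.
- by move=> s _; exact: n1_ge0.
- rewrite disj_set2E; apply/eqP; rewrite -subset0 => s []/=; rewrite !in_itv/= andbT.
  by move=> /andP[_ st]; rewrite ltNge st.
rewrite EFinD; apply: leeD.
- apply: (@le_trans _ _ (\int[leb R]_(s in `[0%R, t])
      ((2 * m * L)%:E * (s * expR (- (k * s)))%:E))%E); last first.
    rewrite ge0_integralZl_EFin//.
    + apply: (@le_trans _ _ ((2 * m * L)%:E * (4 / k ^+ 2)%:E)%E); last by rewrite -EFinM.
      apply: lee_wpmul2l; last exact: integral_id_exp_itv.
      by rewrite lee_fin !mulr_ge0.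
    + by move=> s /=; rewrite in_itv/= => /andP[s0 _]; rewrite lee_fin mulr_ge0// expR_ge0.
    + apply/measurable_EFinP; apply: measurable_funM => //.
      by apply/measurable_EFinP; exact: measurable_exp_lin.
    + by rewrite !mulr_ge0.
  apply: ge0_le_integral => //.
  + by move=> s _; exact: n1_ge0.
  + exact: measurable_funTS.
  + apply: emeasurable_funM => //; apply/measurable_EFinP; apply: measurable_funM => //.
    by apply/measurable_EFinP; exact: measurable_exp_lin.
  move=> s /=; rewrite in_itv/= => /andP[s0 st].
  have st0 : 0 <= t - s by rewrite subr_ge0.
  have -> : n1 (leb2 R) (d s) = n1 (leb2 R) (semigroup gamma (s / eps)
      (fun z => tensor (f (t - s)) z - tensor (f t) z)).
    apply: eq_n1 => z; rewrite /d /H1 /H2 indicE mem_set ?mul1r; last first.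
      by rewrite /D /= in_itv/= s0.
    by rewrite /semigroup mulrBr.
  rewrite n1_semigroup; last first.
    by apply: measurable_funB; exact: measurable_tensor2.
  have lip : (n1 (leb R) (fun x => (f (t - s) x - f t x)%R) <= (L * s)%:E)%E.
    have := @f_lipschitz (t - s) t st0; rewrite gerBl subKr n1_distC; exact.
  have tB := n1_tensorB_le (mf (t - s)) (mf t) (n1_f_le st0) (n1_f_le t0) lip.
  apply: (@le_trans _ _ ((expR (- (gamma * (s / eps))))%:E * (2 * m * (L * s))%:E)%E).
    by apply: lee_wpmul2l tB; rewrite lee_fin expR_ge0.
  rewrite -!EFinM lee_fin le_eqVlt; apply/orP; left; apply/eqP.
  have -> : gamma * (s / eps) = k * s by rewrite /k; ring.
  by ring.
- apply: (@le_trans _ _ (\int[leb R]_(s in `]t, +oo[)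
      ((m ^+ 2)%:E * (expR (- (k * s)))%:E))%E); last first.
    rewrite ge0_integralZl_EFin//; last 2 first.
    + exact: measurable_exp_lin.
    + exact: sqr_ge0.
    apply: (@le_trans _ _ ((m ^+ 2)%:E * (expR (- (k * t)) / k)%:E)%E); last by rewrite -EFinM.
    apply: lee_wpmul2l; first by rewrite lee_fin sqr_ge0.
    rewrite -integral_exp_tail//; apply: ge0_subset_integral => //.
    + exact: measurable_exp_lin.
    + by move=> s /=; rewrite !in_itv/= !andbT; exact: ltW.
  apply: ge0_le_integral => //.
  + by move=> s _; exact: n1_ge0.
  + exact: measurable_funTS.
  + by apply: emeasurable_funM => //; exact: measurable_exp_lin.
  move=> s /=; rewrite in_itv/= andbT => st.
  have -> : n1 (leb2 R) (d s) = n1 (leb2 R) (H2 s).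
    rewrite -[RHS]n1N; apply: eq_n1 => z; rewrite /d /H1 indicE memNset ?mul0r ?sub0r//.
    by rewrite /D /= in_itv/= => /andP[_]; rewrite leNgt st.
  rewrite /H2 n1_semigroup; last exact: measurable_tensor2.
  rewrite muleC (_ : gamma * (s / eps) = k * s); last by rewrite /k; ring.
  apply: lee_wpmul2r; first by rewrite lee_fin expR_ge0.
  exact: n1_tensor_le (n1_f_le t0).
Qed.
Hypothesis g0_pos : forall z, 0 <= g0 z.


Let C := n + 8 * lambda * m * L / gamma ^+ 2.

Let C_ge0 : 0 <= C.
Proof.
rewrite /C addr_ge0// divr_ge0 ?sqr_ge0// !mulr_ge0//; exact: ltW.
Qed.

(** The initial datum of g decays like e^(- k t), and in [relaxation_integral] the
    factor lambda / eps turns 1 / k^2 into O(eps). *)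
Lemma relaxation t : 0 <= t ->
  (n1 (leb2 R) (fun z => g t z - K (f t) z) <= (C * (expR (- (k * t)) + eps))%:E)%E.
Proof.
move=> t0.
pose I1 z := \int[leb R]_(s in `[0, t]) semigroup gamma (s / eps) (tensor (f (t - s))) z.
pose I2 z := \int[leb R]_(s in `[0, +oo[) semigroup gamma (s / eps) (tensor (f t)) z.
have mI1 : measurable_fun setT I1 := measurable_gain_integral t.
have mI2 : measurable_fun setT I2.
  have := @measurable_Rintegral_param _ _ _ _ R (@lebesgue_measure R) _ _
    (measurable_itv `[0%R, +oo[) (joint_meas_semigroup_tensor gamma eps (mf t)).
  by apply.
have mK : measurable_fun setT (K (f t)) := measurable_pair_density lambda gamma (mf t).
have mS := measurable_semigroup gamma (t / eps) mg0.
pose Y z := lambda / eps * I2 z.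
have mY : measurable_fun setT Y by exact: measurable_funM.
have KY : (n1 (leb2 R) (fun z => Y z - K (f t) z) <= 0%:E)%E.
  by rewrite n1_distC (pair_density_rescaled lambda gamma_gt0 eps_gt0 (mf t) (foo t)).
have mI12 : measurable_fun setT (fun z => I1 z - I2 z) by exact: measurable_funB.
have mI12' : measurable_fun setT (fun z => lambda / eps * (I1 z - I2 z)).
  exact: measurable_funM.
have mSI : measurable_fun setT (fun z =>
    semigroup gamma (t / eps) g0 z + lambda / eps * (I1 z - I2 z)).
  exact: measurable_funD.
have mgY : measurable_fun setT (fun z => g t z - Y z) by exact: measurable_funB.
have nS : (n1 (leb2 R) (semigroup gamma (t / eps) g0) <= (expR (- (k * t)) * N0)%:E)%E.
  rewrite n1_semigroup// (_ : gamma * (t / eps) = k * t); last by rewrite /k; ring.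
  rewrite EFinM; apply: lee_wpmul2l; first by rewrite lee_fin expR_ge0.
  have -> : n1 (leb2 R) g0 = N0%:E; last exact: lexx.
  by apply: (@n1_ge0E _ _ R (leb2 R)); [exact: mg0|exact: g0oo|exact: aeW].
have nI : (n1 (leb2 R) (fun z => lambda / eps * (I1 z - I2 z)) <=
   (lambda / eps * (2 * m * L * (4 / k ^+ 2) + m ^+ 2 * (expR (- (k * t)) / k)))%:E)%E.
  apply: (n1Z_le (leb2 R) mI12 (relaxation_integral t0)).
  by rewrite ger0_norm// divr_ge0// ltW.
have gY : (n1 (leb2 R) (fun z => g t z - Y z) <= (C * (expR (- (k * t)) + eps))%:E)%E.
  rewrite (n1_ae (leb2 R) mgY mSI); last first.
    by apply: ae_mono (g_mild t0) => z ->; rewrite -/(I1 z) /Y mulrBr addrA.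
  apply: (n1D_le (leb2 R) mS mI12' nS nI).
  have e0 : 0 <= expR (- (k * t)) by exact: expR_ge0.
  move: (expR (- (k * t))) e0 => e e0.
  have -> : e * N0 + lambda / eps * (2 * m * L * (4 / k ^+ 2) + m ^+ 2 * (e / k)) =
     n * e + 8 * lambda * m * L / gamma ^+ 2 * eps.
    by rewrite /k /n; field; rewrite !gt_eqF.
  rewrite /C [leRHS]mulrDr; apply: lerD; apply: ler_wpM2r => //.
  - by rewrite lerDl divr_ge0 ?sqr_ge0// !mulr_ge0// ltW.
  - exact: ltW.
  - by rewrite lerDr.
by apply: (n1_trans_le (leb2 R) (mg t) mK mY gY KY); rewrite addr0.
Qed.

Lemma expRN_quadratic (x : R) : 0 <= x -> `|expR (- x) - 1 + x| <= x ^+ 2.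
Proof.
move=> x0; rewrite ger0_norm; last first.
  by rewrite -addrA addrC -addrA addrC subr_ge0; have := expR_ge1Dx (- x); lra.
have x1 : 0 < 1 + x by rewrite ltr_wpDr.
have h : expR (- x) <= (1 + x)^-1.
  by rewrite expRN lef_pV2 ?posrE ?expR_gt0// expR_ge1Dx.
have h2 : (1 + x)^-1 <= 1 - x + x ^+ 2.
  rewrite -div1r ler_pdivrMr//.
  have -> : (1 - x + x ^+ 2) * (1 + x) = 1 + x ^+ 3 by ring.
  by rewrite lerDl exprn_ge0.
by have := le_trans h h2; lra.
Qed.

Lemma mass_f_lipschitz a s : 0 <= a -> a <= s -> `|M s - M a| <= L * (s - a).
Proof.
move=> a0 as_; rewrite -lee_fin; apply: le_trans (f_lipschitz a0 as_).
rewrite /M -RintegralB//.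
- have mB : measurable_fun setT (fun x => f s x - f a x) by exact: measurable_funB (mf s) (mf a).
  exact: (Rintegral_le_n1 (leb R) mB).
- by apply/integrable_n1P; split; [exact: mf|exact: foo].
- by apply/integrable_n1P; split; [exact: mf|exact: foo].
Qed.

(** The exponential is expanded to first order, and the Lipschitz bound on the mass
    replaces its integral over [a, b] by (b - a) M a. *)
Lemma weight_expansion a b : 0 <= a -> a <= b ->
  `|weight a b - 1 + 2 * lambda * (b - a) * M a| <=
  (4 * lambda ^+ 2 * m ^+ 2 + 2 * lambda * L) * (b - a) ^+ 2.
Proof.
move=> a0 ab; have ba0 : 0 <= b - a by rewrite subr_ge0.
rewrite /weight cumulative_massB//; set y := \int[_]_(_ in _) _.
have iM : (leb R).-integrable `[a, b] (EFin \o M).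
  exact: continuous_integrable_itv continuous_mass_f.
have cB : continuous (fun s => M s - M a).
  by move=> s; apply: cvgB; [exact: continuous_mass_f|exact: cvg_cst].
have iB := continuous_integrable_itv a b cB.
have yB : y - (b - a) * M a = \int[leb R]_(s in `[a, b]) (M s - M a).
  rewrite RintegralB//; last first.
    by apply: continuous_integrable_itv => s; exact: cvg_cst.
  rewrite Rintegral_cst// /= lebesgue_measure_itv/= lte_fin; congr (_ - _).
  have [ab'|ba] := ltP a b; first by rewrite -EFinB /= mulrC.
  have -> : b = a by apply/eqP; rewrite eq_le ba.
  by rewrite subrr mul0r mulr0.
have yM : `|y - (b - a) * M a| <= L * (b - a) * (b - a).
  rewrite yB; apply: le_trans (le_normr_Rintegral _ iB) _ => //.
  have iN : (leb R).-integrable `[a, b] (EFin \o (fun s => `|M s - M a|)).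
    by have := integrable_norm iB.
  rewrite -lee_fin /Rintegral fineK; last exact: integrable_fin_num.
  apply: integral_itv_le_cst => //; [exact: mulr_ge0|exact: measurable_int iN|].
  move=> s; rewrite in_itv/= => /andP[as_ sb]; rewrite !lee_fin normr_ge0/=.
  apply: le_trans (mass_f_lipschitz a0 as_) _.
  by rewrite ler_wpM2l// lerB.
have y0 : 0 <= y by rewrite /y Rintegral_ge0// => s _; exact: mass_f_ge0.
have ym : y <= m * (b - a).
  rewrite -lee_fin /y /Rintegral fineK; last exact: integrable_fin_num.
  apply: integral_itv_le_cst => //; first exact: measurable_int iM.
  move=> s; rewrite in_itv/= => /andP[as_ _].
  by rewrite !lee_fin mass_f_ge0 mass_f_le// (le_trans a0).
have x0 : 0 <= 2 * lambda * y by rewrite !mulr_ge0// ltW.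
have -> : expR (- (2 * lambda * y)) - 1 + 2 * lambda * (b - a) * M a =
   (expR (- (2 * lambda * y)) - 1 + 2 * lambda * y) +
   - (2 * lambda) * (y - (b - a) * M a) by ring.
apply: le_trans (ler_normD _ _) _; rewrite [leRHS]mulrDl; apply: lerD.
  apply: le_trans (expRN_quadratic x0) _.
  have -> : 4 * lambda ^+ 2 * m ^+ 2 * (b - a) ^+ 2 = (2 * lambda * (m * (b - a))) ^+ 2.
    by ring.
  rewrite lerXn2r ?nnegrE//; first by rewrite !mulr_ge0// ltW.
  by rewrite ler_wpM2l// mulr_ge0// ltW.
rewrite normrM normrN (ger0_norm (_ : 0 <= 2 * lambda)); last by rewrite mulr_ge0// ltW.
rewrite -mulrA; apply: ler_wpM2l; first by rewrite mulr_ge0// ltW.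
by rewrite expr2 mulrA.
Qed.

(** Three replacements under the gain integral: the weight by 1, the pair density
    g(s) by K(f(s)), and f(s) by f(a). *)
Lemma n1_weighted_gainB_le a b s : 0 <= a -> a <= s -> s <= b ->
  (n1 (leb R) (fun x => (weight s b * marginal (g s) x - marginal (K (f a)) x)%R) <=
   ((2 * lambda * m * n + 2 * lambda * m * L / gamma) * (b - a) +
    C * eps + C * expR (- (k * s)))%:E)%E.
Proof.
move=> a0 as_ sb; have s0 := le_trans a0 as_.
have mG := mg s; have mK t : measurable_fun setT (K (f t)).
  exact: measurable_pair_density (mf t).
have mPg := measurable_marginal mG.
have mPK t := measurable_marginal (mK t).
have Koo t : 0 <= t -> (n1 (leb2 R) (K (f t)) < +oo)%E.
  move=> t0; apply: le_lt_trans (n1_pair_density_le lambda_gt0 gamma_gt0 (mf t) (n1_f_le t0)) _.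
  exact: ltry.
have mW : measurable_fun setT (fun x => weight s b * marginal (g s) x).
  exact: (measurable_funM (measurable_cst (weight s b)) mPg).
have A1 : (n1 (leb R) (fun x => weight s b * marginal (g s) x - marginal (g s) x) <=
    (2 * lambda * m * (b - a) * n)%:E)%E.
  have -> : n1 (leb R) (fun x => weight s b * marginal (g s) x - marginal (g s) x) =
      n1 (leb R) (fun x => (weight s b - 1) * marginal (g s) x).
    by apply: eq_n1 => x; rewrite mulrBl mul1r.
  apply: (n1Z_le (leb R) mPg (le_trans (n1_marginal mG) (n1_g_le s0))).
  apply: ler_wpM2r => //; rewrite distrC ger0_norm ?(one_sub_weight_le a0)//.
  by rewrite subr_ge0; exact: weight_le1.
have A2 : (n1 (leb R) (fun x => marginal (g s) x - marginal (K (f s)) x) <=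
    (C * (expR (- (k * s)) + eps))%:E)%E.
  apply: le_trans (n1_marginalB mG (mK s) (goo s) (Koo s s0)) _.
  exact: relaxation.
have A3 : (n1 (leb R) (fun x => marginal (K (f s)) x - marginal (K (f a)) x) <=
    (lambda / gamma * (2 * m * (L * (b - a))))%:E)%E.
  apply: le_trans (n1_marginalB (mK s) (mK a) (Koo s s0) (Koo a a0)) _.
  apply: (n1_pair_densityB_le lambda_gt0 gamma_gt0 (mf s) (mf a) (n1_f_le s0) (n1_f_le a0)).
  apply: le_trans (f_lipschitz a0 as_) _.
  by rewrite lee_fin ler_wpM2l// lerB.
have A12 := n1_trans_le (leb R) mW (mPK s) mPg A1 A2 (lexx _).
apply: (n1_trans_le (leb R) mW (mPK a) (mPK s) A12 A3).
rewrite le_eqVlt; apply/orP; left; apply/eqP; clearbody C k m n L.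
by move: (expR _) => e; field; rewrite gt_eqF.
Qed.

Lemma n1_gainB_le a b : 0 <= a -> a <= b ->
  (n1 (leb R) (fun x => (\int[leb R]_(s in `[a, b]) (weight s b * marginal (g s) x) -
     (b - a) * marginal (K (f a)) x)%R) <=
   ((2 * lambda * m * n + 2 * lambda * m * L / gamma) * (b - a) ^+ 2 +
    C * eps * (gamma^-1 + (b - a)))%:E)%E.
Proof.
move=> a0 ab; have b0 := le_trans a0 ab; have ba0 : 0 <= b - a by rewrite subr_ge0.
have mK : measurable_fun setT (K (f a)) := measurable_pair_density lambda gamma (mf a).
have mP := measurable_marginal mK.
have len : lebesgue_measure (`[a, b]%classic : set R) = (b - a)%:E.
  rewrite lebesgue_measure_itv/= lte_fin; have [ab'|ba] := ltP a b; first by rewrite EFinB.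
  by have -> : b = a; [apply/eqP; rewrite eq_le ba|rewrite subrr].
have -> : n1 (leb R) (fun x => (\int[leb R]_(s in `[a, b]) (weight s b * marginal (g s) x) -
     (b - a) * marginal (K (f a)) x)%R) =
   n1 (leb R) (fun x => (\int[leb R]_(s in `[a, b]) (weight s b * marginal (g s) x) -
     \int[leb R]_(s in `[a, b]) marginal (K (f a)) x)%R).
  apply: eq_n1 => x; congr (_ - _).
  transitivity (marginal (K (f a)) x * fine (lebesgue_measure (`[a, b]%classic : set R))).
    by rewrite len /= mulrC.
  by rewrite Rintegral_cst.
have jc : joint_meas (fun (_ : R) x => marginal (K (f a)) x).
  exact: (measurableT_comp mP (@measurable_snd _ _ R R)).
have Pfin : (\int[leb R]_(s in `[a, b]) n1 (leb R) (fun x => marginal (K (f a)) x) < +oo)%E.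
  rewrite integral_cst//= (len : (leb R) `[a, b]%classic = _).
  have Pb := le_trans (n1_marginal mK)
    (n1_pair_density_le lambda_gt0 gamma_gt0 (mf a) (n1_f_le a0)).
  apply: (@le_lt_trans _ _ ((lambda / gamma * m ^+ 2)%:E * (b - a)%:E)%E).
    by apply: lee_wpmul2r => //; rewrite lee_fin.
  by rewrite -EFinM ltry.
have MB := @minkowski_integralB _ _ _ _ R (@lebesgue_measure R) (@lebesgue_measure R) _ _ _
  (measurable_itv `[a, b]) (joint_meas_weighted b) jc (integral_weighted_fin b a0) Pfin.
apply: le_trans MB _.
pose c := (2 * lambda * m * n + 2 * lambda * m * L / gamma) * (b - a) + C * eps.
have c0 : 0 <= c.
  rewrite /c addr_ge0//; last by rewrite mulr_ge0// ltW.
  by rewrite mulr_ge0// addr_ge0 ?divr_ge0// ?mulr_ge0// ltW.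
apply: (@le_trans _ _ (\int[leb R]_(s in `[a, b])
    (c%:E + C%:E * (expR (- (k * s)))%:E))%E).
  apply: ge0_le_integral => //.
  - by move=> s _; exact: n1_ge0.
  - by apply: measurable_funTS; exact: measurable_n1_weighted.
  - by apply: emeasurable_funD => //; apply: emeasurable_funM => //; exact: measurable_exp_lin.
  move=> s /=; rewrite in_itv/= => /andP[as_ sb].
  by rewrite -EFinM -EFinD; exact: n1_weighted_gainB_le.
rewrite ge0_integralD//; last 2 first.
- by move=> s _; rewrite -EFinM lee_fin mulr_ge0// expR_ge0.
- by apply: emeasurable_funM => //; exact: measurable_exp_lin.
rewrite integral_cst// ge0_integralZl_EFin//; last exact: measurable_exp_lin.
apply: (@le_trans _ _ (c%:E * (b - a)%:E + C%:E * (k^-1)%:E)%E).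
  apply: leeD; first by rewrite -len; exact: lexx.
  apply: lee_wpmul2l; first by rewrite lee_fin.
  exact: integral_exp_itv.
rewrite -!EFinM -EFinD lee_fin le_eqVlt; apply/orP; left; apply/eqP.
rewrite /c /k; clearbody C m n L; field.
by rewrite !gt_eqF.
Qed.

Let C1 := (4 * lambda ^+ 2 * m ^+ 2 + 2 * lambda * L) * m +
  2 * gamma * (2 * lambda * m * n + 2 * lambda * m * L / gamma).

(** One explicit Euler step: the damping factor is expanded to first order and the
    gain integrand is frozen at its value for f(a). The relaxation error enters
    through its time integral only, which is O(eps) even for small b - a. *)
Lemma euler_estimate a b : 0 <= a -> a <= b ->
  (n1 (leb R) (fun x => (f b x - f a x - (b - a) * collision lambda gamma (f a) x)%R) <=
   (C1 * (b - a) ^+ 2 + 2 * gamma * C * eps * (gamma^-1 + (b - a)))%:E)%E.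
Proof.
move=> a0 ab.
pose V x := \int[leb R]_(s in `[a, b]) (weight s b * marginal (g s) x).
pose P := marginal (K (f a)).
have mV : measurable_fun setT V := measurable_weighted_integral a b.
have mP : measurable_fun setT P.
  exact: (measurable_marginal (measurable_pair_density lambda gamma (mf a))).
have mVP : measurable_fun setT (fun x => V x - (b - a) * P x).
  exact: (measurable_funB mV (measurable_funM (measurable_cst (b - a)) mP)).
have m2 : measurable_fun setT (fun x => 2 * gamma * (V x - (b - a) * P x)).
  exact: (measurable_funM (measurable_cst (2 * gamma)) mVP).
pose w := weight a b - 1 + 2 * lambda * (b - a) * M a.
have m1 : measurable_fun setT (fun x => w * f a x).
  exact: (measurable_funM (measurable_cst w) (mf a)).
have m12 : measurable_fun setT (fun x => w * f a x + 2 * gamma * (V x - (b - a) * P x)).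
  exact: (measurable_funD m1 m2).
have mE : measurable_fun setT
    (fun x => f b x - f a x - (b - a) * collision lambda gamma (f a) x).
  apply: (measurable_funB (measurable_funB (mf b) (mf a))).
  exact: (measurable_funM (measurable_cst (b - a)) (measurable_collision lambda gamma (mf a))).
rewrite (n1_ae (leb R) mE m12); last first.
  apply: ae_mono (f_restart a0 ab) => x ->.
  rewrite -/(V x) /collision -/K -/(P x) -/(M a) /w.
  move: (V x) (P x) (f a x) (M a) (weight a b) => *; ring.
have n_1 : (n1 (leb R) (fun x => w * f a x) <=
   ((4 * lambda ^+ 2 * m ^+ 2 + 2 * lambda * L) * (b - a) ^+ 2 * m)%:E)%E.
  apply: (n1Z_le (leb R) (mf a) (n1_f_le a0)); apply: ler_wpM2r => //.
  exact: weight_expansion.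
have n_2 : (n1 (leb R) (fun x => 2 * gamma * (V x - (b - a) * P x)) <=
   (2 * gamma * ((2 * lambda * m * n + 2 * lambda * m * L / gamma) * (b - a) ^+ 2 +
    C * eps * (gamma^-1 + (b - a))))%:E)%E.
  apply: (n1Z_le (leb R) mVP (n1_gainB_le a0 ab)).
  by rewrite ger0_norm// mulr_ge0// ltW.
apply: (n1D_le (leb R) m1 m2 n_1 n_2).
rewrite le_eqVlt; apply/orP; left; apply/eqP; rewrite /C1; clearbody C m n L.
by field; rewrite gt_eqF.
Qed.

End mild_solution_estimates.

(** * Approximate Euler curves *)

Section euler_curves.
Context (R : realType).
Variables (lambda gamma : R) (f0 : R -> R).
Hypotheses (lambda_gt0 : 0 < lambda) (gamma_gt0 : 0 < gamma).
Hypothesis mf0 : measurable_fun setT f0.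
Implicit Types (f : R -> R -> R) (m C eps a b s t : R).

(** The properties of the solutions that survive the limit, with constants that do
    not depend on eps; the case eps = 0 describes the limit itself. Clamping time
    at 0 makes joint measurability a statement on the whole plane. *)
Definition euler_curve m C eps f : Prop :=
  [/\ joint_meas (fun t => f (Num.max 0 t)),
      n1 (leb R) (fun x => f 0 x - f0 x) = 0%E,
      forall t, 0 <= t -> (n1 (leb R) (f t) <= m%:E)%E,
      forall a b, 0 <= a -> a <= b ->
        (n1 (leb R) (fun x => f b x - f a x) <= (C * (b - a))%:E)%E &
      forall a b, 0 <= a -> a <= b ->
        (n1 (leb R) (fun x => f b x - f a x - (b - a) * collision lambda gamma (f a) x)
         <= (C * ((b - a) ^+ 2 + eps * (1 + (b - a))))%:E)%E].

Lemma euler_measurable m C eps f t : euler_curve m C eps f -> 0 <= t ->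
  measurable_fun setT (f t).
Proof. by case=> j _ _ _ _ t0; have := joint_meas_sec t j; rewrite max_r. Qed.

(** Two Euler steps with the same length: the distance grows by the Lipschitz
    constant of the collision operator, plus the two one-step errors. *)
Lemma step_distance_le (u u' v v' : R -> R) a d e1 e2 h :
  measurable_fun setT u -> measurable_fun setT u' ->
  measurable_fun setT v -> measurable_fun setT v' -> 0 <= h ->
  (n1 (leb R) u <= a%:E)%E -> (n1 (leb R) v <= a%:E)%E ->
  (n1 (leb R) (fun x => u x - v x) <= d%:E)%E ->
  (n1 (leb R) (fun x => u' x - u x - h * collision lambda gamma u x) <= e1%:E)%E ->
  (n1 (leb R) (fun x => v' x - v x - h * collision lambda gamma v x) <= e2%:E)%E ->
  (n1 (leb R) (fun x => u' x - v' x) <= (d * (1 + 8 * lambda * a * h) + (e1 + e2))%:E)%E.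
Proof.
move=> mu mu' mv mv' h0 ua va duv E1 E2.
pose c1 := collision lambda gamma u; pose c2 := collision lambda gamma v.
have mc1 : measurable_fun setT c1 by exact: measurable_collision mu.
have mc2 : measurable_fun setT c2 by exact: measurable_collision mv.
have mh (c : R -> R) : measurable_fun setT c -> measurable_fun setT (fun x => h * c x).
  by move=> mc; exact: (measurable_funM (measurable_cst h) mc).
have mD1 : measurable_fun setT (fun x => u' x - u x - h * c1 x).
  exact: (measurable_funB (measurable_funB mu' mu) (mh _ mc1)).
have mD2 : measurable_fun setT (fun x => v' x - v x - h * c2 x).
  exact: (measurable_funB (measurable_funB mv' mv) (mh _ mc2)).
have mD2' : measurable_fun setT (fun x => -1 * (v' x - v x - h * c2 x)).
  exact: (measurable_funM (measurable_cst (-1 : R)) mD2).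
have mc : measurable_fun setT (fun x => c1 x - c2 x) by exact: (measurable_funB mc1 mc2).
have muv : measurable_fun setT (fun x => u x - v x) by exact: (measurable_funB mu mv).
have -> : n1 (leb R) (fun x => u' x - v' x) = n1 (leb R) (fun x =>
  ((u x - v x) + h * (c1 x - c2 x)) +
  ((u' x - u x - h * c1 x) + -1 * (v' x - v x - h * c2 x))).
  by apply: eq_n1 => x; ring.
have E2' : (n1 (leb R) (fun x => (-1 * (v' x - v x - h * c2 x))%R) <= e2%:E)%E.
  by apply: (n1Z_le (leb R) mD2 E2); rewrite normrN1 mul1r.
have Ec := n1Z_le (leb R) (k := h) mc
  (n1_collisionB_le lambda_gt0 gamma_gt0 mu mv ua va duv) (lexx _).
have A1 := n1D_le (leb R) muv (mh _ mc) duv Ec (lexx _).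
have A2 := n1D_le (leb R) mD1 mD2' E1 E2' (lexx _).
apply: (n1D_le (leb R) (measurable_funD muv (mh _ mc)) (measurable_funD mD1 mD2') A1 A2).
by rewrite ger0_norm// le_eqVlt; apply/orP; left; apply/eqP; ring.
Qed.

Lemma euler_step_le m C eps1 eps2 f1 f2 d t h :
  euler_curve m C eps1 f1 -> euler_curve m C eps2 f2 -> 0 <= t -> 0 <= h ->
  (n1 (leb R) (fun x => f1 t x - f2 t x) <= d%:E)%E ->
  (n1 (leb R) (fun x => f1 (t + h) x - f2 (t + h) x) <=
   (d * (1 + 8 * lambda * m * h) +
    C * (2 * h ^+ 2 + (eps1 + eps2) * (1 + h)))%:E)%E.
Proof.
move=> e1 e2 t0 h0 dt; have th0 : 0 <= t + h by rewrite addr_ge0.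
have tth : t <= t + h by rewrite lerDl.
have m1 s : 0 <= s -> measurable_fun setT (f1 s) := euler_measurable e1.
have m2 s : 0 <= s -> measurable_fun setT (f2 s) := euler_measurable e2.
have [_ _ b1 _ E1] := e1; have [_ _ b2 _ E2] := e2.
have {E1} := E1 t (t + h) t0 tth; rewrite addrAC subrr add0r => E1.
have {E2} := E2 t (t + h) t0 tth; rewrite addrAC subrr add0r => E2.
have := step_distance_le (m1 t t0) (m1 _ th0) (m2 t t0) (m2 _ th0) h0
  (b1 t t0) (b2 t t0) dt E1 E2.
by rewrite (_ : C * (2 * _ + _) = C * (h ^+ 2 + eps1 * (1 + h)) + C * (h ^+ 2 + eps2 * (1 + h)));
  last ring.
Qed.

(** Discrete Gronwall over N equal steps. Each step costs O((t / N)^2) from the Euler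
    scheme and O(eps) from relaxation, so more steps help the first error and harm
    the second; N is left free. *)
Lemma euler_dist_le m C eps1 eps2 f1 f2 t N : 0 <= m -> 0 <= C -> 0 <= eps1 -> 0 <= eps2 ->
  euler_curve m C eps1 f1 -> euler_curve m C eps2 f2 -> 0 <= t -> (0 < N)%N ->
  (n1 (leb R) (fun x => f1 t x - f2 t x) <=
   (expR (8 * lambda * m * t) * C *
    (2 * t ^+ 2 / N%:R + (eps1 + eps2) * (N%:R + t)))%:E)%E.
Proof.
move=> m0 C0 e10 e20 e1 e2 t0 N0.
have N0' : 0 < N%:R :> R by rewrite ltr0n.
pose h := t / N%:R; pose q := 1 + 8 * lambda * m * h.
have h0 : 0 <= h by rewrite divr_ge0// ltW.
have l0 := ltW lambda_gt0.
pose r := C * (2 * h ^+ 2 + (eps1 + eps2) * (1 + h)).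
have r0 : 0 <= r.
  by rewrite /r mulr_ge0// addr_ge0// mulr_ge0// ?sqr_ge0// addr_ge0.
have q1 : 1 <= q by rewrite /q lerDl !mulr_ge0.
have step j : (n1 (leb R) (fun x => f1 (j%:R * h) x - f2 (j%:R * h) x) <=
    (j%:R * q ^+ j * r)%:E)%E.
  elim: j => [|j IH].
    rewrite !mul0r; have [_ z1 _ _ _] := e1; have [_ z2 _ _ _] := e2.
    have m1 := euler_measurable e1 (lexx 0); have m2 := euler_measurable e2 (lexx 0).
    have B1 : (n1 (leb R) (fun x => f1 0 x - f0 x) <= 0%:E)%E by rewrite z1.
    have B2 : (n1 (leb R) (fun x => f0 x - f2 0 x) <= 0%:E)%E by rewrite n1_distC z2.
    apply: (n1_trans_le (leb R) m1 m2 mf0 B1 B2); by rewrite addr0.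
  have := euler_step_le e1 e2 _ h0 IH.
  have -> : j%:R * h + h = j.+1%:R * h by rewrite -natr1; ring.
  move=> S.
  apply: le_trans (S _) _; first by rewrite mulr_ge0.
  rewrite lee_fin -/q -/r exprSr.
  have qj : 1 <= q ^+ j * q by rewrite -exprSr exprn_ege1.
  have -> : j.+1%:R * (q ^+ j * q) * r = j%:R * q ^+ j * r * q + (q ^+ j * q) * r.
    by rewrite -natr1; ring.
  by rewrite lerD2l ler_peMl.
have -> : t = N%:R * h by rewrite /h mulrC divfK// gt_eqF.
apply: le_trans (step N) _; rewrite lee_fin.
have qN : q ^+ N <= expR (8 * lambda * m * (N%:R * h)).
  rewrite mulrCA expRM_natl lerXn2r ?nnegrE ?expR_ge0//; first exact: le_trans q1.
  exact: expR_ge1Dx.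
apply: (@le_trans _ _ (N%:R * expR (8 * lambda * m * (N%:R * h)) * r)).
  by rewrite ler_wpM2r// ler_wpM2l.
rewrite le_eqVlt; apply/orP; left; apply/eqP; rewrite /r.
by move: (expR _) => e; field; rewrite gt_eqF.
Qed.

End euler_curves.

(** The constants depend on the data only. In the proof, absolute values make them
    nonnegative before any solution is given. *)
Lemma mild_estimates (R : realType) (lambda gamma : R) (f0 : R -> R) (g0 : R * R -> R) :
  0 < lambda -> 0 < gamma ->
  measurable_fun setT f0 -> (n1 (leb R) f0 < +oo)%E ->
  measurable_fun setT g0 -> (n1 (leb2 R) g0 < +oo)%E -> (forall z, 0 <= g0 z) ->
  exists m C, [/\ 0 <= m, 0 <= C & forall eps (f : R -> R -> R) (g : R -> R * R -> R),
    0 < eps -> eps <= 1 -> mild_solution lambda gamma eps f0 g0 f g ->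
    euler_curve lambda gamma f0 m C eps f /\
    forall t, 0 <= t -> [/\ measurable_fun setT (g t), (n1 (leb2 R) (g t) < +oo)%E &
      (n1 (leb2 R) (fun z => g t z - pair_density lambda gamma (f t) z) <=
      (C * (expR (- (gamma / eps * t)) + eps))%:E)%E]].
Proof.
move=> l0 ga0 mf0 f0oo mg0 g0oo g0pos.
pose M0 := \int[leb R]_x f0 x; pose N0 := \int[leb2 R]_z g0 z.
pose m := M0 + 2 * N0; pose n := N0 + lambda / gamma * m ^+ 2.
pose L := 2 * lambda * m ^+ 2 + 2 * gamma * n.
pose c := n + 8 * lambda * m * L / gamma ^+ 2.
pose C1 := (4 * lambda ^+ 2 * m ^+ 2 + 2 * lambda * L) * m +
  2 * gamma * (2 * lambda * m * n + 2 * lambda * m * L / gamma).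
pose C2 := 2 * gamma * c.
pose C := `|C1| + `|C2| * (1 + gamma^-1) + `|L| + `|c|.
have gi : 0 <= gamma^-1 by rewrite invr_ge0 ltW.
have C20 : 0 <= `|C2| * (1 + gamma^-1) by rewrite mulr_ge0// addr_ge0.
have LC : L <= C.
  by rewrite /C; apply: le_trans (ler_norm L) _; rewrite -addrA addrCA lerDl !addr_ge0.
have cC : c <= C.
  by rewrite /C; apply: le_trans (ler_norm c) _; rewrite lerDr !addr_ge0.
exists `|m|, C; split; [exact: normr_ge0|by rewrite !addr_ge0|].
move=> eps f g e0 e1 [[cf fpos] [cg gpos] fm gm].
pose F t := f (Num.max 0 t); pose G t := g (Num.max 0 t).
have FE t : 0 <= t -> F t = f t by move=> t0; rewrite /F max_r.
have GE t : 0 <= t -> G t = g t by move=> t0; rewrite /G max_r.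
have cF : L1_curve (leb R) F := C_L1_extend cf.
have cG : L1_curve (leb2 R) G := C_L1_extend cg.
have F0 t : {ae leb R, forall x, 0 <= F t x} by exact/fpos/max0_ge0.
have G0 t : {ae leb2 R, forall z, 0 <= G t z} by exact/gpos/max0_ge0.
have dE s t : 0 <= s -> damping lambda f s t = damping lambda F s t.
  move=> s0; rewrite /damping; apply: (congr1 (fun y => expR (- (2 * lambda * y)))).
  apply: eq_Rintegral => r; rewrite inE/= in_itv/= => /andP[sr _].
  by rewrite /mass FE// (le_trans s0).
have Fm t : 0 <= t -> {ae leb R, forall x, F t x = damping lambda F 0 t * f0 x +
    2 * gamma * \int[leb R]_(s in `[0, t]) (damping lambda F s t * marginal (G s) x)}.
  move=> t0; apply: ae_mono (fm t t0) => x.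
  have -> : \int[leb R]_(s in `[0, t]) (damping lambda F s t * marginal (G s) x) =
      \int[leb R]_(s in `[0, t]) (damping lambda f s t * \int[leb R]_y g s (x, y)).
    apply: eq_Rintegral => s; rewrite inE/= in_itv/= => /andP[s0 st].
    by rewrite (dE s t s0) (GE s s0).
  by rewrite (FE t t0) => ->; rewrite (dE 0 t (lexx 0)).
have Gm t : 0 <= t -> {ae leb2 R, forall z, G t z = semigroup gamma (t / eps) g0 z +
    lambda / eps * \int[leb R]_(s in `[0, t]) semigroup gamma (s / eps) (tensor (F (t - s))) z}.
  move=> t0; apply: ae_mono (gm t t0) => z.
  have -> : \int[leb R]_(s in `[0, t]) semigroup gamma (s / eps) (tensor (F (t - s))) z =
      \int[leb R]_(s in `[0, t]) semigroup gamma (s / eps) (tensor (f (t - s))) z.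
    apply: eq_Rintegral => s; rewrite inE/= in_itv/= => /andP[s0 st].
    by rewrite (FE (t - s))// subr_ge0.
  by rewrite (GE t t0) => ->.
split; last first.
  move=> t t0; have [jG Goo _] := cG.
  have := joint_meas_sec t jG; have := Goo t; rewrite GE// => goo mg; split => //.
  have := relaxation l0 ga0 e0 mf0 f0oo mg0 g0oo cF cG F0 G0 Fm Gm e1 g0pos t0.
  rewrite GE// FE// => h; apply: le_trans h _; rewrite lee_fin.
  by apply: ler_wpM2r; [rewrite addr_ge0// ?expR_ge0// ltW|exact: cC].
split.
- by case: cF.
- have mF0 : measurable_fun setT (F 0) by case: cF => j _ _; exact: joint_meas_sec.
  have -> : f 0 = F 0 by rewrite FE.
  apply: (n1_dist0 (leb R) mF0 mf0).
  apply: ae_mono (Fm 0 (lexx 0)) => x ->.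
  rewrite set_itv1 Rintegral_set1 mulr0 addr0 /damping set_itv1 Rintegral_set1.
  by rewrite mulr0 oppr0 expR0 mul1r.
- move=> t t0; have := n1_f_le l0 e0 mf0 f0oo mg0 g0oo cF cG F0 G0 Fm Gm e1 t0.
  by rewrite FE// => h; apply: le_trans h _; rewrite lee_fin; exact: ler_norm.
- move=> a b a0 ab; have b0 := le_trans a0 ab.
  have := f_lipschitz l0 ga0 e0 mf0 f0oo mg0 g0oo cF cG F0 G0 Fm Gm e1 a0 ab.
  rewrite !FE// => h; apply: le_trans h _; rewrite lee_fin.
  by apply: ler_wpM2r; [rewrite subr_ge0|exact: LC].
- move=> a b a0 ab; have b0 := le_trans a0 ab.
  have := euler_estimate l0 ga0 e0 mf0 f0oo mg0 g0oo cF cG F0 G0 Fm Gm e1 g0pos a0 ab.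
  rewrite !FE// => h; apply: le_trans h _.
  rewrite -/M0 -/N0 -/m -/n -/L -/c -/C1 -/C2 lee_fin.
  have ba0 : 0 <= b - a by rewrite subr_ge0.
  apply: (@le_trans _ _ (`|C1| * (b - a) ^+ 2 +
     `|C2| * (1 + gamma^-1) * (eps * (1 + (b - a))))).
    apply: lerD; first by rewrite ler_wpM2r ?sqr_ge0// ler_norm.
    rewrite -[C2 * eps * _]mulrA -[leRHS]mulrA; apply: (@le_trans _ _ (`|C2| * (eps * (gamma^-1 + (b - a))))).
      apply: ler_wpM2r; last exact: ler_norm.
      by apply: mulr_ge0; [exact: ltW|exact: addr_ge0].
    apply: ler_wpM2l => //; rewrite mulrCA ler_wpM2l ?(ltW e0)//.
    by rewrite mulrDr mulr1 mulrDl mul1r; apply: lerD; rewrite ?lerDr// lerDl mulr_ge0.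
  have CE : `|C1| <= C by rewrite /C -!addrA lerDl !addr_ge0.
  have CE2 : `|C2| * (1 + gamma^-1) <= C.
    by rewrite /C -!addrA addrCA lerDl !addr_ge0.
  rewrite [leRHS]mulrDr; apply: lerD; apply: ler_wpM2r => //; first exact: sqr_ge0.
  by apply: mulr_ge0; [exact: ltW|exact: addr_ge0].
Qed.

(** * Limits of geometrically Cauchy sequences in L^1 *)

Section L1_limit.
Context d (T : measurableType d) (R : realType).
Variable mu : {measure set T -> \bar R}.

(** A limit superior, because it is measurable in every parameter without any
    convergence assumption; this gives a jointly measurable limit. *)
Definition limit_density (u : nat -> T -> R) (x : T) : R :=
  fine (limn_esup (fun k => (u k x)%:E)).

Lemma geometric_limit (x : \bar R) (A B : R) :
  (forall k, x <= (A + B / 2 ^+ k)%:E)%E -> (x <= A%:E)%E.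
Proof.
move=> h; apply/lee_addgt0Pr => e e0.
have : (fun k => B / 2 ^+ k) @ \oo --> 0.
  rewrite -[X in _ --> X](mulr0 B); apply: cvgM; first exact: cvg_cst.
  under eq_fun do rewrite -exprVn.
  by apply: cvg_expr; rewrite ger0_norm ?invr_ge0// invf_lt1// ltr1n.
move=> /cvgrPdist_le/(_ e e0) [k _ /(_ k (leqnn k))]; rewrite sub0r normrN => ke.
apply: le_trans (h k) _; rewrite -EFinD lee_fin lerD2l; exact: le_trans (ler_norm _) ke.
Qed.

Lemma measurable_limit_density (u : nat -> T -> R) :
  (forall k, measurable_fun setT (u k)) -> measurable_fun setT (limit_density u).
Proof.
move=> mu_; apply: measurableT_comp => //.
by apply: measurable_fun_limn_esup => k; exact/measurable_EFinP.
Qed.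

(** The sum of the increments has finite integral, so it is finite almost everywhere
    and the telescoping series converges there. *)
Lemma ae_cvg_geometric (u : nat -> T -> R) c :
  (forall k, measurable_fun setT (u k)) ->
  (forall k, n1 mu (fun x => u k.+1 x - u k x) <= (c / 2 ^+ k)%:E)%E ->
  {ae mu, forall x, cvgn (u ^~ x)}.
Proof.
move=> mu_ uc.
have mD k : measurable_fun setT (fun x => u k.+1 x - u k x) by exact: measurable_funB.
pose S x := (\sum_(k <oo) (`|u k.+1 x - u k x|)%:E)%E.
have mS : measurable_fun setT S.
  apply: ge0_emeasurable_sum => [k x _ _|k _]; [by []|exact: measurable_normE].
have c0 : 0 <= c.
  by have := le_trans (n1_ge0 _ _) (uc 0%N); rewrite lee_fin expr0 divr1.
have iS : mu.-integrable setT S.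
  apply/integrableP; split => //.
  under eq_integral do rewrite gee0_abs ?nneseries_ge0//.
  rewrite integral_nneseries//; last by move=> k; exact: measurable_normE.
  apply: (@le_lt_trans _ _ (\sum_(k <oo) (c / 2 ^+ k)%:E)%E).
    by apply: lee_nneseries => k *; [exact: n1_ge0|exact: uc].
  apply: (@le_lt_trans _ _ (2 * c)%:E); last exact: ltry.
  have c20 : 0 <= 2 * c by rewrite mulr_ge0.
  apply: le_trans (epsilon_trick0 xpredT c20); apply: lee_nneseries => [k _ _|k _].
    by rewrite lee_fin divr_ge0// exprn_ge0.
  rewrite lee_fin natrX exprS le_eqVlt; apply/orP; left; apply/eqP; field.
  by rewrite expf_eq0 andbC pnatr_eq0.
apply: ae_mono (integrable_ae measurableT iS) => x /(_ I) Sx.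
pose v k := u k.+1 x - u k x.
have nS : cvgn [normed series v].
  apply: nondecreasing_is_cvgn.
    apply/nondecreasing_seqP => k; rewrite [leRHS](_ : _ = [normed series v] k + `|v k|).
      by rewrite lerDl.
    exact: seriesSr.
  exists (fine (S x)) => _ [k _ <-]; rewrite -lee_fin fineK//.
  rewrite /series/= -sumEFin.
  by apply: (@nneseries_lim_ge R _ xpredT 0%N) => j _ _; rewrite lee_fin.
have uE : u ^~ x = (fun k => u 0%N x + series v k).
  apply/funext => k; exact: (eq_sum_telescope (u ^~ x)).
by rewrite uE; apply: is_cvgD; [exact: is_cvg_cst|exact: normed_cvg].
Qed.

Lemma limn_einf_le (v : nat -> \bar R) (k : nat) (c : \bar R) :
  (forall j, (k <= j)%N -> (v j <= c)%E) -> (limn_einf v <= c)%E.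
Proof.
move=> vc; rewrite limn_einf_lim; apply: lime_le; first exact: is_cvg_einfs.
apply: nearW => n; apply: le_trans (vc (maxn n k) (leq_maxr _ _)).
by apply: ereal_inf_lbound; exists (maxn n k) => //=; exact: leq_maxl.
Qed.

(** Fatou's lemma, applied to |u_j - u_k| as j tends to infinity. *)
Lemma n1_limit_density (u : nat -> T -> R) c :
  (forall k, measurable_fun setT (u k)) ->
  (forall j k, (k <= j)%N -> n1 mu (fun x => u j x - u k x) <= (c / 2 ^+ k)%:E)%E ->
  forall k, (n1 mu (fun x => limit_density u x - u k x) <= (c / 2 ^+ k)%:E)%E.
Proof.
move=> mu_ uc k.
have cv := ae_cvg_geometric mu_ (fun k => uc k.+1 k (leqnSn k)).
have mL := measurable_limit_density mu_.
have mB j : measurable_fun setT (fun x => u j x - u k x) by exact: measurable_funB.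
have F := @fatou _ _ R mu setT measurableT (fun j x => (`|u j x - u k x|)%:E)
  (fun j => measurable_normE (mB j)) (fun j x _ => normr_ge0 _).
apply: le_trans (le_trans _ F) _; last first.
  by apply: (@limn_einf_le _ k) => j kj; exact: uc.
apply: ae_ge0_le_integral => //.
- by apply: measurable_normE; exact: measurable_funB.
- move=> x _; rewrite limn_einf_lim; apply: lime_ge; first exact: is_cvg_einfs.
  by apply: nearW => n; apply: le_ereal_inf_tmp => _ [j _ <-]; rewrite lee_fin.
- apply: measurableT_comp => //.
  apply: measurable_fun_limn_esup => j; apply: measurableT_comp => //.
  exact: measurable_normE.
apply: ae_mono cv => x cx _.
have [l ul] : exists l : R, u ^~ x @ \oo --> l by apply/cvg_ex.
have e1 : (fun j => (u j x)%:E) @ \oo --> l%:E by apply: cvg_EFin => //; exact: nearW.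
have e2 : (fun j => (`|u j x - u k x|)%:E) @ \oo --> (`|l - u k x|)%:E.
  apply: cvg_EFin; first exact: nearW.
  by apply: cvg_norm; apply: cvgB => //; exact: cvg_cst.
rewrite (cvg_limn_einf_sup e2) /limit_density (cvg_limn_einf_sup e1) /=; exact: lexx.
Qed.

End L1_limit.

(** * The limit curve *)

Section limit_curve.
Context (R : realType).
Variables (lambda gamma : R) (f0 : R -> R) (m C : R) (fe : R -> R -> R -> R).
Hypotheses (lambda_gt0 : 0 < lambda) (gamma_gt0 : 0 < gamma).
Hypothesis mf0 : measurable_fun setT f0.
Hypotheses (m_ge0 : 0 <= m) (C_ge0 : 0 <= C).
Hypothesis fe_euler : forall eps, 0 < eps -> eps <= 1 ->
  euler_curve lambda gamma f0 m C eps (fe eps).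
Implicit Types (a b t : R).

(** Along eps = p k ^ 2, with N = 1 / p k steps, both errors of [euler_dist_le] are
    O(p k). *)
Let p (k : nat) : R := (2 ^+ k)^-1.
Let p_gt0 k : 0 < p k. Proof. by rewrite invr_gt0 exprn_gt0. Qed.
Let p_le1 k : p k <= 1.
Proof. by rewrite invf_le1 ?exprn_gt0// exprn_ege1// ler1n. Qed.
Let p_mono j k : (k <= j)%N -> p j <= p k.
Proof. by move=> kj; rewrite lef_pV2 ?posrE ?exprn_gt0// ler_eXn2l// ltr1n. Qed.

Let u k := fe (p k ^+ 2).
Let u_euler k : euler_curve lambda gamma f0 m C (p k ^+ 2) (u k).
Proof. by apply: fe_euler; [rewrite exprn_gt0|rewrite expr_le1// ltW]. Qed.

Definition limit_curve t : R -> R := limit_density (fun k => u k (Num.max 0 t)).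
Let F := limit_curve.

Let rate t := expR (8 * lambda * m * t) * C * (2 * t ^+ 2 + 2 * (1 + t)).

Let mu k t : 0 <= t -> measurable_fun setT (u k t).
Proof. exact: euler_measurable (u_euler k). Qed.

Let u_cauchy t j k : 0 <= t -> (k <= j)%N ->
  (n1 (leb R) (fun x => u j t x - u k t x) <= (rate t / 2 ^+ k)%:E)%E.
Proof.
move=> t0 kj; have e0 i : 0 <= p i ^+ 2 by rewrite sqr_ge0.
have N0 : (0 < 2 ^ k)%N by rewrite expn_gt0.
apply: le_trans (euler_dist_le lambda_gt0 gamma_gt0 mf0 m_ge0 C_ge0 (e0 j) (e0 k)
  (u_euler j) (u_euler k) t0 N0) _.
rewrite lee_fin natrX -/(p k) -mulrA -[leRHS]mulrA -[leRHS]mulrA.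
apply: ler_wpM2l; first exact: expR_ge0.
apply: ler_wpM2l => //; have pk := p_gt0 k; have pk1 := p_le1 k.
have -> : (2 ^+ k : R) = (p k)^-1 by rewrite /p invrK.
apply: (@le_trans _ _ (2 * t ^+ 2 * p k + 2 * p k ^+ 2 * ((p k)^-1 + t))).
  rewrite invrK lerD2l ler_wpM2r//; first by rewrite addr_ge0// invr_ge0 ltW.
  rewrite mulr2n mulrDl mul1r lerD2r; apply: lerXn2r.
  - by rewrite nnegrE ltW.
  - by rewrite nnegrE ltW.
  - exact: p_mono.
rewrite [leRHS]mulrDl lerD2l.
have -> : 2 * p k ^+ 2 * ((p k)^-1 + t) = 2 * p k * (1 + p k * t).
  by field; rewrite gt_eqF.
rewrite [leRHS]mulrAC; apply: ler_wpM2l; first by rewrite mulr_ge0// ltW.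
by rewrite lerD2l ler_piMl.
Qed.

Let FE t : 0 <= t -> F t = limit_density (u ^~ t).
Proof. by move=> t0; rewrite /F /limit_curve max_r. Qed.

Let mF t : 0 <= t -> measurable_fun setT (F t).
Proof. by move=> t0; rewrite FE//; apply: measurable_limit_density => k; exact: mu. Qed.

Let F_close t k : 0 <= t ->
  (n1 (leb R) (fun x => F t x - u k t x) <= (rate t / 2 ^+ k)%:E)%E.
Proof.
move=> t0; rewrite FE//.
have := @n1_limit_density _ _ R (leb R) (u ^~ t) (rate t) (fun k => mu k t0).
by apply=> j i ij; exact: u_cauchy.
Qed.

Let F_close' t k : 0 <= t ->
  (n1 (leb R) (fun x => u k t x - F t x) <= (rate t / 2 ^+ k)%:E)%E.
Proof. by move=> t0; rewrite n1_distC; exact: F_close. Qed.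

Let F_bound t : 0 <= t -> (n1 (leb R) (F t) <= m%:E)%E.
Proof.
move=> t0; apply: (@geometric_limit _ _ m (rate t)) => k.
have [_ _ um _ _] := u_euler k.
have -> : n1 (leb R) (F t) = n1 (leb R) (fun x => u k t x + (F t x - u k t x)).
  by apply: eq_n1 => x; rewrite addrC subrK.
apply: (n1D_le (leb R) (mu k t0) (measurable_funB (mF t0) (mu k t0)) (um t t0) (F_close k t0)).
exact: lexx.
Qed.

(** Every bound holds for u k up to a multiple of p k, and the collision operator is
    continuous on bounded sets, so each passes to the limit. *)
Lemma limit_curve_euler : euler_curve lambda gamma f0 m C 0 limit_curve.
Proof.
split; rewrite -/F.
- have -> : (fun t => F (Num.max 0 t)) = F.
    by apply/funext => t; rewrite /F /limit_curve max_r ?max0_ge0.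
  rewrite /joint_meas /F /limit_curve.
  have := @measurable_limit_density _ _ R (fun k (q : R * R) => u k (Num.max 0 q.1) q.2).
  by apply=> k; have [j _ _ _ _] := u_euler k.
- apply/eqP; rewrite eq_le n1_ge0 andbT.
  apply: (@geometric_limit _ _ 0 (rate 0)) => k; rewrite add0r.
  have [_ u0 _ _ _] := u_euler k.
  have u0' : (n1 (leb R) (fun x => u k 0 x - f0 x) <= 0%:E)%E by rewrite u0.
  apply: (n1_trans_le (leb R) (mF (lexx 0)) mf0 (mu k (lexx 0)) (F_close k (lexx 0)) u0').
  by rewrite addr0.
- exact: F_bound.
- move=> a b a0 ab; have b0 := le_trans a0 ab.
  apply: (@geometric_limit _ _ _ (rate b + rate a)) => k.
  have [_ _ _ uL _] := u_euler k.
  have B1 := n1_trans_le (leb R) (mF b0) (mu k a0) (mu k b0) (F_close k b0) (uL a b a0 ab) (lexx _).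
  apply: (n1_trans_le (leb R) (mF b0) (mF a0) (mu k a0) B1 (F_close' k a0)).
  by rewrite mulrDl le_eqVlt; apply/orP; left; apply/eqP; ring.
- move=> a b a0 ab; have b0 := le_trans a0 ab; have ba0 : 0 <= b - a by rewrite subr_ge0.
  rewrite mul0r addr0.
  apply: (@geometric_limit _ _ _
    (C * (1 + (b - a)) + rate b + rate a + (b - a) * (8 * lambda * m * rate a))) => k.
  have [_ _ um _ uE] := u_euler k.
  pose c v := collision lambda gamma v.
  have mc v : measurable_fun setT v -> measurable_fun setT (c v).
    by move=> mv; exact: measurable_collision.
  have mh (v : R -> R) : measurable_fun setT v ->
      measurable_fun setT (fun x => (b - a) * c v x).
    by move=> mv; exact: (measurable_funM (measurable_cst (b - a)) (mc v mv)).
  have ma := mu k a0; have mb := mu k b0; have mFa := mF a0; have mFb := mF b0.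
  have -> : n1 (leb R) (fun x => F b x - F a x - (b - a) * c (F a) x) =
    n1 (leb R) (fun x => (u k b x - u k a x - (b - a) * c (u k a) x) +
      (((F b x - u k b x) + (u k a x - F a x)) +
       (b - a) * (c (u k a) x - c (F a) x))).
    by apply: eq_n1 => x; ring.
  have mD1 : measurable_fun setT (fun x => u k b x - u k a x - (b - a) * c (u k a) x).
    exact: (measurable_funB (measurable_funB mb ma) (mh _ ma)).
  have mD2 : measurable_fun setT (fun x => F b x - u k b x) by exact: measurable_funB mFb mb.
  have mD3 : measurable_fun setT (fun x => u k a x - F a x) by exact: measurable_funB ma mFa.
  have mD4 : measurable_fun setT (fun x => c (u k a) x - c (F a) x).
    exact: measurable_funB (mc _ ma) (mc _ mFa).
  have mD5 : measurable_fun setT (fun x => (b - a) * (c (u k a) x - c (F a) x)).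
    exact: (measurable_funM (measurable_cst (b - a)) mD4).
  have E4 := n1Z_le (leb R) (k := b - a) mD4 (n1_collisionB_le lambda_gt0 gamma_gt0 ma mFa
    (um a a0) (F_bound a0) (F_close' k a0)) (lexx _).
  have E23 := n1D_le (leb R) mD2 mD3 (F_close k b0) (F_close' k a0) (lexx _).
  have E234 := n1D_le (leb R) (measurable_funD mD2 mD3) mD5 E23 E4 (lexx _).
  apply: (n1D_le (leb R) mD1 (measurable_funD (measurable_funD mD2 mD3) mD5)
    (uE a b a0 ab) E234).
  rewrite (ger0_norm ba0) -/(p k).
  apply: (@le_trans _ _ (C * ((b - a) ^+ 2 + p k * (1 + (b - a))) +
    (rate b * p k + rate a * p k + (b - a) * (8 * lambda * m * (rate a * p k))))).
    rewrite lerD2r; apply: ler_wpM2l => //; rewrite lerD2l.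
    apply: ler_wpM2r; first by rewrite addr_ge0.
    by rewrite expr2 ler_piMr// ltW.
  by rewrite le_eqVlt; apply/orP; left; apply/eqP; move: (p k) (rate a) (rate b) => *; ring.
Qed.

Lemma n1_limit_curve_le eps t N : 0 < eps -> eps <= 1 -> 0 <= t -> (0 < N)%N ->
  (n1 (leb R) (fun x => fe eps t x - limit_curve t x) <=
   (expR (8 * lambda * m * t) * C * (2 * t ^+ 2 / N%:R + eps * (N%:R + t)))%:E)%E.
Proof.
move=> e0 e1 t0 N0; have := euler_dist_le lambda_gt0 gamma_gt0 mf0 m_ge0 C_ge0 (ltW e0) (lexx 0)
  (fe_euler e0 e1) limit_curve_euler t0 N0.
by rewrite addr0.
Qed.

End limit_curve.

(** * The limit equation *)

Section limit_equation.
Context (R : realType).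
Variables (lambda gamma : R) (f0 : R -> R) (m C : R) (f : R -> R -> R).
Hypotheses (lambda_gt0 : 0 < lambda) (gamma_gt0 : 0 < gamma).
Hypothesis mf0 : measurable_fun setT f0.
Hypotheses (m_ge0 : 0 <= m) (C_ge0 : 0 <= C).
Hypothesis f_euler : euler_curve lambda gamma f0 m C 0 f.
Implicit Types (t h : R).

Let c := collision lambda gamma.
Let Q := Q1 lambda gamma.

Let mf t : 0 <= t -> measurable_fun setT (f t).
Proof. exact: euler_measurable f_euler. Qed.

Let fm t : 0 <= t -> (n1 (leb R) (f t) <= m%:E)%E.
Proof. by have [_ _ h _ _] := f_euler; exact: h. Qed.

Let foo t : 0 <= t -> (n1 (leb R) (f t) < +oo)%E.
Proof. by move=> t0; apply: le_lt_trans (fm t0) _; exact: ltry. Qed.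

Let mc t : 0 <= t -> measurable_fun setT (c (f t)).
Proof. by move=> t0; exact: measurable_collision (mf t0). Qed.

Lemma euler_lipschitz t t' : 0 <= t -> 0 <= t' ->
  (n1 (leb R) (fun x => f t x - f t' x) <= (C * `|t - t'|)%:E)%E.
Proof.
move=> t0 t'0; have [_ _ _ lip _] := f_euler.
have [tt'|/ltW t't] := leP t t'.
  by rewrite n1_distC distrC ger0_norm ?subr_ge0//; exact: lip.
by rewrite ger0_norm ?subr_ge0//; exact: lip.
Qed.

(** For h > 0 this is the Euler estimate based at t. For h < 0 the Euler step is
    based at t + h, and c(f(t + h)) is then replaced by c(f(t)), at the price of the
    Lipschitz constants of c and f. *)
Lemma n1_difference_quotient t h : 0 <= t -> h != 0 -> 0 <= t + h ->
  (n1 (leb R) (fun x => h^-1 * (f (t + h) x - f t x) - c (f t) x) <=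
   ((C + 8 * lambda * m * C) * `|h|)%:E)%E.
Proof.
move=> t0 h0 th0; have [_ _ _ _ E] := f_euler.
have l0 : 0 <= 8 * lambda * m * C by rewrite !mulr_ge0// ltW.
have mD a b : 0 <= a -> 0 <= b ->
    measurable_fun setT (fun x => f b x - f a x - (b - a) * c (f a) x).
  move=> a0 b0; apply: (measurable_funB (measurable_funB (mf b0) (mf a0))).
  exact: (measurable_funM (measurable_cst (b - a)) (mc a0)).
have [hp|hn] := ltP 0 h.
  have tth : t <= t + h by rewrite lerDl ltW.
  have := E t (t + h) t0 tth; have := mD t (t + h) t0 th0.
  rewrite addrAC subrr add0r mul0r addr0 => mE Eh.
  have -> : n1 (leb R) (fun x => h^-1 * (f (t + h) x - f t x) - c (f t) x) =
      n1 (leb R) (fun x => h^-1 * (f (t + h) x - f t x - h * c (f t) x)).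
    by apply: eq_n1 => x; rewrite [RHS]mulrBr mulKf.
  apply: (n1Z_le (leb R) mE Eh); rewrite !gtr0_norm ?invr_gt0//.
  apply: (@le_trans _ _ (C * h)); last by apply: ler_wpM2r; [exact: ltW|rewrite lerDl].
  by rewrite le_eqVlt; apply/orP; left; apply/eqP; field.
have hlt : h < 0 by rewrite lt_neqAle h0.
have tht : t + h <= t by rewrite gerDl.
have := E (t + h) t th0 tht; have := mD (t + h) t th0 t0.
rewrite opprD addrA subrr add0r mul0r addr0 sqrrN => mE Eh.
have -> : n1 (leb R) (fun x => h^-1 * (f (t + h) x - f t x) - c (f t) x) =
    n1 (leb R) (fun x => - h^-1 * (f t x - f (t + h) x - - h * c (f (t + h)) x) +
      (c (f (t + h)) x - c (f t) x)).
  apply: eq_n1 => x; move: (f _ x) (f _ x) (c _ x) (c _ x) => *; field.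
  exact: h0.
have mE' : measurable_fun setT
    (fun x => - h^-1 * (f t x - f (t + h) x - - h * c (f (t + h)) x)).
  exact: (measurable_funM (measurable_cst (- h^-1)) mE).
have E1 : (n1 (leb R) (fun x =>
    (- h^-1 * (f t x - f (t + h) x - - h * c (f (t + h)) x))%R) <= (C * `|h|)%:E)%E.
  apply: (n1Z_le (leb R) mE Eh); rewrite normrN ltr0_norm ?invr_lt0// ltr0_norm//.
  by rewrite le_eqVlt; apply/orP; left; apply/eqP; field.
have lip : (n1 (leb R) (fun x => f (t + h) x - f t x) <= (C * `|h|)%:E)%E.
  by have := euler_lipschitz th0 t0; rewrite addrAC subrr add0r.
have E2 := n1_collisionB_le lambda_gt0 gamma_gt0 (mf th0) (mf t0) (fm th0) (fm t0) lip.
apply: (n1D_le (leb R) mE' (measurable_funB (mc th0) (mc t0)) E1 E2).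
by rewrite le_eqVlt; apply/orP; left; apply/eqP; ring.
Qed.

(** Lets [Q1] and [collision] be exchanged inside L^1 estimates. *)
Lemma n1_subQ1_le (v u : R -> R) b : measurable_fun setT v -> measurable_fun setT u ->
  (n1 (leb R) u < +oo)%E ->
  (n1 (leb R) (fun x => v x - c u x) <= b%:E)%E ->
  (n1 (leb R) (fun x => v x - Q u x) <= b%:E)%E.
Proof.
move=> mv mu uoo vb.
have mQ : measurable_fun setT (Q u) by exact: measurable_Q1.
have mcu : measurable_fun setT (c u) by exact: measurable_collision.
have cQ : (n1 (leb R) (fun x => c u x - Q u x) <= 0%:E)%E.
  by rewrite n1_distC (n1_Q1_collision lambda_gt0 gamma_gt0 mu uoo).
by apply: (n1_trans_le (leb R) mv mQ mcu vb cQ); rewrite addr0.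
Qed.

Lemma euler_derive t : 0 <= t -> is_L1_derive (leb R) f t (Q (f t)).
Proof.
move=> t0; pose D := C + 8 * lambda * m * C.
apply: (@squeeze_cvge _ _ _ _ (fun=> 0%E) _ (fun h => (D * `|h|)%:E)).
- rewrite near_withinE /dnbhs near_withinE; apply: nearW => h h0 th0; rewrite (n1_ge0 (leb R))/=.
  have mq : measurable_fun setT (fun x => h^-1 * (f (t + h) x - f t x)).
    exact: (measurable_funM (measurable_cst h^-1) (measurable_funB (mf th0) (mf t0))).
  apply: (n1_subQ1_le mq (mf t0) (foo t0)).
  exact: n1_difference_quotient.
- exact: cvg_cst.
- apply: cvg_EFin; first exact: nearW.
  apply: cvg_within_filter; apply: cvg_within_filter.
  have : D * `|h| @[h --> (0 : R)] --> D * `|0 : R|.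
    by apply: cvgM; [exact: cvg_cst|exact: cvg_norm].
  by rewrite normr0 mulr0.
Qed.

Lemma euler_C_L1 : C_L1 (leb R) f.
Proof.
split.
- have [j _ _ _ _] := f_euler.
  have mD : measurable ((`[0, +oo[%classic : set R) `*` [set: R]) by exact: measurableX.
  apply: (eq_measurable_fun (fun p : R * R => f (Num.max 0 p.1) p.2)); last exact: measurable_funTS.
  by move=> [s x]; rewrite inE/= => -[/=]; rewrite in_itv/= andbT => s0 _; rewrite max_r.
- by move=> t t0; apply/integrable_n1P; split; [exact: mf|exact: foo].
move=> t t0.
apply: (@squeeze_cvge _ _ _ _ (fun=> 0%E) _ (fun s => (C * `|s - t|)%:E)).
- rewrite near_withinE; apply: nearW => s /=; rewrite in_itv/= andbT => s0; rewrite (n1_ge0 (leb R))/=.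
  exact: euler_lipschitz.
- exact: cvg_cst.
- apply: cvg_EFin; first exact: nearW.
  apply: cvg_within_filter.
  have : C * `|s - t| @[s --> t] --> C * `|t - t|.
    by apply: cvgM; [exact: cvg_cst|apply: cvg_norm; apply: cvgB; [exact: cvg_id|exact: cvg_cst]].
  by rewrite subrr normr0 mulr0.
Qed.

Lemma euler_limit_solution : limit_solution lambda gamma f0 f.
Proof.
split; [exact: euler_C_L1| |exact: euler_derive].
have [_ z _ _ _] := f_euler.
have m0 := mf (lexx 0).
exact: (n1_eq0_ae (leb R) m0 mf0 z).
Qed.

End limit_equation.

(** * Uniqueness *)

(** Induction along the half line: the infimum of the set of failures can neither
    belong to it nor be approached by it. *)
Lemma real_induction (R : realType) (P : R -> Prop) : P 0 ->
  (forall t, 0 <= t -> P t -> exists2 h, 0 < h & forall s, t < s -> s <= t + h -> P s) ->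
  (forall t, 0 < t -> (forall s, 0 <= s -> s < t -> P s) -> P t) ->
  forall t, 0 <= t -> P t.
Proof.
move=> P0 step lim t t0; apply: contrapT => nPt.
pose S := [set s : R | 0 <= s /\ ~ P s].
have St : S t by [].
have lS : has_lbound S by exists 0 => s [].
have iS : has_inf S by split => //; exists t.
pose i := inf S.
have i0 : 0 <= i by apply: lb_le_inf; [exists t|move=> s []].
have Pi s : 0 <= s -> s < i -> P s.
  move=> s0 si; apply: contrapT => nPs.
  by have := inf_lbound lS (conj s0 nPs : S s); rewrite leNgt si.
have {}Pi : P i.
  by move: i0; rewrite le_eqVlt => /orP[/eqP<-//|ip]; exact: lim.
have [h h0 Ph] := step i i0 Pi.
have [s [s0 nPs] sih] := inf_adherent h0 iS.
have is_ : i <= s by exact: inf_lbound.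
move: is_; rewrite le_eqVlt => /orP[/eqP is_|is_]; first by apply: nPs; rewrite -is_.
by apply: nPs; apply: Ph => //; exact: ltW.
Qed.

Section uniqueness.
Context (R : realType).
Variables (lambda gamma : R) (f0 : R -> R) (m C : R) (f f' : R -> R -> R).
Hypotheses (lambda_gt0 : 0 < lambda) (gamma_gt0 : 0 < gamma).
Hypothesis mf0 : measurable_fun setT f0.
Hypotheses (m_ge0 : 0 <= m) (C_ge0 : 0 <= C).
Hypothesis f_euler : euler_curve lambda gamma f0 m C 0 f.
Hypothesis f'_solution : limit_solution lambda gamma f0 f'.
Implicit Types (t h : R).

Let c := collision lambda gamma.
Let w t := n1 (leb R) (fun x => f' t x - f t x).

Let mf t : 0 <= t -> measurable_fun setT (f t).
Proof. exact: euler_measurable f_euler. Qed.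

Let fm t : 0 <= t -> (n1 (leb R) (f t) <= m%:E)%E.
Proof. by have [_ _ h _ _] := f_euler; exact: h. Qed.

Let mf' t : 0 <= t -> measurable_fun setT (f' t).
Proof.
by move=> t0; have [[_ h _] _ _] := f'_solution; have /integrable_n1P[] := h t t0.
Qed.

Let f'oo t : 0 <= t -> (n1 (leb R) (f' t) < +oo)%E.
Proof.
by move=> t0; have [[_ h _] _ _] := f'_solution; have /integrable_n1P[] := h t t0.
Qed.

Let w0 : w 0 = 0%E.
Proof.
have m1 := mf (lexx 0); have m2 := mf' (lexx 0).
have [_ z _ _ _] := f_euler; have [_ z' _] := f'_solution.
apply: (n1_dist0 (leb R) m2 m1).
by apply: ae_mono2 z' (n1_eq0_ae (leb R) m1 mf0 z) => x -> ->.
Qed.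

Let continuous_f' t e : 0 <= t -> 0 < e -> exists2 r, 0 < r &
  forall s, 0 <= s -> `|t - s| < r -> (n1 (leb R) (fun x => f' t x - f' s x) <= e%:E)%E.
Proof.
move=> t0 e0; have [[_ _ uc] _ _] := f'_solution.
have := uc t t0 => /fine_cvgP[fnum /cvgrPdist_le/(_ e e0) near_e].
have [r r0 hr] := filterI fnum near_e.
exists r => // s s0 ts.
have Ds : (`[0, +oo[%classic : set R) s by rewrite /= in_itv/= s0.
have [sfin se] := hr s ts Ds.
rewrite n1_distC /L1norm -(fineK sfin) lee_fin.
by move: se; rewrite sub0r normrN; apply: le_trans; exact: ler_norm.
Qed.

Let euler_f' t e : 0 <= t -> 0 < e -> exists2 r, 0 < r & forall h, 0 < h -> h < r ->
  (n1 (leb R) (fun x => f' (t + h) x - f' t x - h * c (f' t) x) <= (h * e)%:E)%E.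
Proof.
move=> t0 e0; have [_ _ /(_ t t0) D] := f'_solution.
have := D => /fine_cvgP[fnum /cvgrPdist_le/(_ e e0) near_e].
have [r r0 hr] := filterI fnum near_e.
exists r => // h h0 hlt; have th0 : 0 <= t + h by rewrite addr_ge0// ltW.
have hb : `|0 - h| < r by rewrite sub0r normrN gtr0_norm.
have [sfin se] := hr h hb (lt0r_neq0 h0) th0.
pose q x := h^-1 * (f' (t + h) x - f' t x).
have mq : measurable_fun setT q.
  exact: (measurable_funM (measurable_cst h^-1) (measurable_funB (mf' th0) (mf' t0))).
have mQ : measurable_fun setT (Q1 lambda gamma (f' t)).
  exact: measurable_Q1 (mf' t0).
have mc : measurable_fun setT (c (f' t)) by exact: measurable_collision (mf' t0).
have qQ : (n1 (leb R) (fun x => q x - Q1 lambda gamma (f' t) x) <= e%:E)%E.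
  rewrite /L1norm -(fineK sfin) lee_fin.
  by move: se; rewrite sub0r normrN; apply: le_trans; exact: ler_norm.
have Qc : (n1 (leb R) (fun x => Q1 lambda gamma (f' t) x - c (f' t) x) <= 0%:E)%E.
  by rewrite (n1_Q1_collision lambda_gt0 gamma_gt0 (mf' t0) (f'oo t0)).
have qc := n1_trans_le (leb R) mq mc mQ qQ Qc (lexx _).
have -> : n1 (leb R) (fun x => f' (t + h) x - f' t x - h * c (f' t) x) =
    n1 (leb R) (fun x => h * (q x - c (f' t) x)).
  by apply: eq_n1 => x; rewrite [RHS]mulrBr /q mulVKf// lt0r_neq0.
apply: (n1Z_le (leb R) (measurable_funB mq mc) qc).
by rewrite addr0 gtr0_norm.
Qed.

(** A Gronwall argument by real induction on the bound eta e^((L + 1) t). As long as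
    it stays below 1, both curves are bounded by m + 1 in L^1, which makes the
    collision operator Lipschitz with constant L; the spare growth rate 1 absorbs
    the o(h) errors of the derivative, and eta is arbitrary. *)
Lemma limit_solution_unique t : 0 <= t -> w t = 0%E.
Proof.
move=> T0; set T := t in T0 *.
pose L := 8 * lambda * (m + 1); have L0 : 0 <= L by rewrite !mulr_ge0 ?addr_ge0// ltW.
have small eta : 0 < eta -> eta * expR ((L + 1) * T) <= 1 ->
    (w T <= (eta * expR ((L + 1) * T))%:E)%E.
  move=> eta0 eta1; pose phi s := eta * expR ((L + 1) * s).
  have phi_mono s s' : s <= s' -> phi s <= phi s'.
    move=> ss'; rewrite /phi ler_pM2l// ler_expR ler_wpM2l// addr_ge0//.
  have phi_eta s : 0 <= s -> eta <= phi s.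
    move=> s0; apply: ler_peMr; first exact: ltW.
    by rewrite -expR0 ler_expR mulr_ge0// addr_ge0.
  suff : T <= T -> (w T <= (phi T)%:E)%E by apply.
  apply: (@real_induction R (fun s => s <= T -> (w s <= (phi s)%:E)%E)) => //.
  - by move=> _; rewrite w0 lee_fin (le_trans (ltW eta0))// phi_eta.
  - move=> s s0 Ps; have d0 : 0 < eta / 2 by rewrite divr_gt0.
    have [r r0 hr] := euler_f' s0 d0.
    (* With this step, the two one-step errors are each at most h eta / 2. *)
    pose h0 := Num.min (r / 2) (eta / 2 / (C + 1)).
    have C1 : 0 < C + 1 by rewrite ltr_wpDl.
    have h00 : 0 < h0 by rewrite /h0 lt_min !divr_gt0.
    exists h0 => // s' ss' s'h s'T.
    pose h := s' - s; have h_gt0 : 0 < h by rewrite subr_gt0.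
    have hh0 : h <= h0 by rewrite lerBlDl.
    have s'E : s' = s + h by rewrite addrC subrK.
    have hr' : h < r.
      by apply: le_lt_trans hh0 _; rewrite /h0 gt_min ltr_pdivrMr// ltr_pMr// ltr1n.
    have Ch : C * h <= eta / 2.
      apply: (@le_trans _ _ ((C + 1) * h)); first by apply: ler_wpM2r; [exact: ltW|rewrite lerDl].
      rewrite mulrC -ler_pdivlMr//; apply: le_trans hh0 _.
      by rewrite /h0 ge_min lexx orbT.
    have {}Ps : (w s <= (phi s)%:E)%E by apply: Ps; exact: le_trans (ltW ss') s'T.
    have phi1 : phi s <= 1.
      by apply: le_trans eta1; apply: phi_mono; exact: le_trans (ltW ss') s'T.
    have sh0 : 0 <= s + h by rewrite -s'E; exact: le_trans s0 (ltW ss').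
    have f'b : (n1 (leb R) (f' s) <= (m + 1)%:E)%E.
      have -> : n1 (leb R) (f' s) = n1 (leb R) (fun x => f s x + (f' s x - f s x)).
        by apply: eq_n1 => x; rewrite addrC subrK.
      apply: (n1D_le (leb R) (mf s0) (measurable_funB (mf' s0) (mf s0)) (fm s0) Ps).
      by rewrite lerD2l.
    have fb : (n1 (leb R) (f s) <= (m + 1)%:E)%E.
      by apply: le_trans (fm s0) _; rewrite lee_fin lerDl.
    have Ef' := hr h h_gt0 hr'.
    have sle : s <= s + h by rewrite lerDl ltW.
    have [_ _ _ _ /(_ s (s + h) s0 sle)] := f_euler.
    rewrite addrAC subrr add0r mul0r addr0 => Ef.
    have := step_distance_le lambda_gt0 gamma_gt0 (mf' s0) (mf' sh0) (mf s0) (mf sh0)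
      (ltW h_gt0) f'b fb Ps Ef' Ef.
    rewrite -/L -s'E => W; apply: le_trans W _; rewrite lee_fin.
    apply: (@le_trans _ _ (phi s * (1 + (L + 1) * h))).
      have -> : phi s * (1 + (L + 1) * h) = phi s * (1 + L * h) + phi s * h by ring.
      rewrite lerD2l; apply: (@le_trans _ _ (eta * h)); last first.
        by apply: ler_wpM2r; [exact: ltW|exact: phi_eta].
      have -> : eta * h = h * (eta / 2) + (eta / 2) * h by field.
      by rewrite lerD2l expr2 mulrA; apply: ler_wpM2r => //; exact: ltW.
    have -> : phi s' = phi s * expR ((L + 1) * h).
      by rewrite /phi s'E mulrDr expRD mulrA.
    apply: ler_wpM2l; first exact: le_trans (ltW eta0) (phi_eta s s0).
    exact: expR_ge1Dx.
  - move=> s s0 Ps sT; have s0' := ltW s0; apply/lee_addgt0Pr => e e0.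
    have e20 : 0 < e / 2 by rewrite divr_gt0.
    have [r r0 hr] := continuous_f' s0' e20.
    have C1 : 0 < C + 1 by rewrite ltr_wpDl.
    pose d := Num.min (r / 2) (e / 2 / (C + 1)).
    have d0 : 0 < d by rewrite /d lt_min !divr_gt0.
    pose s' := Num.max 0 (s - d).
    have s's : s' < s by rewrite /s' gt_max s0 ltrBlDr ltrDl.
    have s'0 : 0 <= s' by rewrite /s' le_max lexx.
    have ss'd : `|s - s'| <= d.
      by rewrite gtr0_norm ?subr_gt0// lerBlDr -lerBlDl /s' le_max lexx orbT.
    have A1 : (n1 (leb R) (fun x => f' s x - f' s' x) <= (e / 2)%:E)%E.
      apply: hr => //; apply: le_lt_trans ss'd _.
      by rewrite /d gt_min ltr_pdivrMr// ltr_pMr// ltr1n.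
    have A2 := Ps s' s'0 s's (le_trans (ltW s's) sT).
    have A3 := euler_lipschitz f_euler s'0 s0'.
    have A12 := n1_trans_le (leb R) (mf' s0') (mf s'0) (mf' s'0) A1 A2 (lexx _).
    rewrite -EFinD; apply: (n1_trans_le (leb R) (mf' s0') (mf s0') (mf s'0) A12 A3).
    have Cd : C * `|s' - s| <= e / 2.
      rewrite distrC; apply: (@le_trans _ _ ((C + 1) * d)).
        by apply: ler_pM => //; rewrite lerDl.
      by rewrite mulrC -ler_pdivlMr// /d ge_min lexx orbT.
    have := phi_mono _ _ (ltW s's) => pm.
    by rewrite [e in leRHS](splitr e); lra.
apply/eqP; rewrite eq_le n1_ge0 andbT; apply/lee_addgt0Pr => e e0; rewrite add0e.
pose E := expR ((L + 1) * T); have E0 : 0 < E by exact: expR_gt0.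
pose eta := Num.min 1 e / E.
have eta0 : 0 < eta by rewrite divr_gt0// lt_min ltr01.
have etaE : eta * E = Num.min 1 e by rewrite /eta divfK// gt_eqF.
have := small eta eta0; rewrite -/E etaE => /(_ _) h.
by apply: le_trans (h _) _; rewrite ?lee_fin ge_min lexx ?orbT.
Qed.

End uniqueness.

(** * Testing against bounded functions *)

Section testing.
Context d (T : measurableType d) (R : realType).
Variable mu : {measure set T -> \bar R}.
Implicit Types (u v h : T -> R).

Lemma n1_test_le u h B b : measurable_fun setT u -> measurable_fun setT h ->
  {ae mu, forall x, `|h x| <= B} -> 0 <= B -> (n1 mu u <= b%:E)%E ->
  (n1 mu (fun x => u x * h x) <= (B * b)%:E)%E.
Proof.
move=> mU mH hB B0 ub.
apply: (@le_trans _ _ (n1 mu (fun x => B * u x))).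
  apply: n1_le; [exact: measurable_funM|exact: measurable_funM|].
  apply: ae_mono hB => x hx; rewrite !normrM mulrC (ger0_norm B0).
  by apply: ler_wpM2r.
by apply: (n1Z_le mu mU ub); rewrite ger0_norm.
Qed.

Lemma test_distance_le u v h B b : measurable_fun setT u -> measurable_fun setT v ->
  measurable_fun setT h -> (n1 mu u < +oo)%E -> (n1 mu v < +oo)%E ->
  {ae mu, forall x, `|h x| <= B} -> 0 <= B ->
  (n1 mu (fun x => u x - v x) <= b%:E)%E ->
  `|\int[mu]_x (u x * h x) - \int[mu]_x (v x * h x)| <= B * b.
Proof.
move=> mU mV mH uoo voo hB B0 uv.
have int_test w : measurable_fun setT w -> (n1 mu w < +oo)%E ->
    mu.-integrable setT (EFin \o (fun x => w x * h x)).
  move=> mW woo; apply/integrable_n1P; split; first exact: measurable_funM.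
  have wb : (n1 mu w <= (fine (n1 mu w))%:E)%E by rewrite fineK// ge0_fin_numE ?n1_ge0.
  by apply: le_lt_trans (n1_test_le mW mH hB B0 wb) _; exact: ltry.
rewrite -RintegralB//; [|exact: int_test|exact: int_test].
rewrite -lee_fin; have muv : measurable_fun setT (fun x => u x - v x).
  exact: measurable_funB.
apply: le_trans (Rintegral_le_n1 mu (_ : measurable_fun setT (fun x => u x * h x - v x * h x))) _.
  by apply: measurable_funB; exact: measurable_funM.
have -> : n1 mu (fun x => u x * h x - v x * h x) = n1 mu (fun x => (u x - v x) * h x).
  by apply: eq_n1 => x; rewrite mulrBl.
exact: n1_test_le.
Qed.

End testing.

(** The essential supremum is a bound almost everywhere. The norm is defined by cases
    on the measure of the whole space, whence the degenerate branch. *)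
Lemma Lfun_oo_bounded (R : realType) (h : R -> R) : h \in Lfun (leb R) +oo%E ->
  measurable_fun setT h /\ exists2 B, 0 <= B & {ae leb R, forall x, `|h x| <= B}.
Proof.
move=> hL; have mh : measurable_fun setT h := set_mem (sub_Lfun_mfun hL).
split => //; have := set_mem (sub_Lfun_finLfun hL).
rewrite /finite_norm /= unlock.
case: ifPn => [_ hoo|]; last first.
  move=> mu0 _; exists 0 => //; exists setT; split => //.
  by apply/eqP; rewrite eq_le measure_ge0 andbT leNgt.
have [B sB] : exists B : R, (ess_sup (leb R) (abse \o (EFin \o h)) <= B%:E)%E.
  case: (ess_sup _ _) hoo => [r _|//|_]; first by exists r.
  by exists 0; rewrite leNye.
exists (Num.max 0 B); first by rewrite le_max lexx.
have /ess_supP := sB; apply: ae_mono => x /=; rewrite lee_fin => hB.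
by rewrite le_max hB orbT.
Qed.

Lemma uniform_limit (R : realType) (K : set R) (G : R -> R -> R) (g : R -> R) :
  (forall e, 0 < e -> \forall eps \near 0^'+, forall t, K t -> `|G eps t - g t| <= e) ->
  {uniform K, G @ 0^'+ --> g}.
Proof.
move=> H P /uniform_nbhs [E [entE sub]].
move: entE; rewrite -entourage_ballE => -[e /= e0 eE].
have e20 : 0 < e / 2 by rewrite divr_gt0.
apply: filterS (H _ e20) => eps Heps; apply: sub => t Kt.
apply: eE => /=; rewrite /ball/= distrC; apply: le_lt_trans (Heps t Kt) _.
by rewrite ltr_pdivrMr// ltr_pMr// ltr1n.
Qed.

Lemma near_linear_small (R : realType) (A e : R) : 0 <= A -> 0 < e ->
  \forall eps \near 0^'+, [/\ 0 < eps, eps <= 1 & A * eps <= e].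
Proof.
move=> A0 e0; have A1 : 0 < A + 1 by rewrite ltr_wpDl.
near=> eps.
have p0 : 0 < eps by near: eps; exact: nbhs_right_gt.
split => //; first by near: eps; exact: nbhs_right_le.
apply: (@le_trans _ _ ((A + 1) * eps)); first by apply: ler_wpM2r; [exact: ltW|rewrite lerDl].
rewrite mulrC -ler_pdivlMr//; near: eps; apply: nbhs_right_le.
by rewrite divr_gt0.
Unshelve. all: by end_near. Qed.

Lemma compact_bound (R : realType) (K : set R) : compact K ->
  exists2 T : R, 0 <= T & forall t, K t -> t <= T.
Proof.
move=> /compact_bounded [M [_ HM]]; exists (Num.max 0 (M + 1)); first by rewrite le_max lexx.
move=> t Kt; have MM : M < M + 1 by rewrite ltrDl.
have := HM (M + 1) MM t Kt; rewrite le_max => /(le_trans (ler_norm t)) ->.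
by rewrite orbT.
Qed.

(** The complement of K is a neighbourhood of 0. *)
Lemma compact_pos_lower (R : realType) (K : set R) : compact K ->
  K `<=` `]0, +oo[%classic -> exists2 r : R, 0 < r & forall t, K t -> r <= t.
Proof.
move=> /(compact_closed (@Rhausdorff R)) cK K0.
have : nbhs 0 (~` K).
  by apply: open_nbhs_nbhs; split; [exact: closed_openC|move=> /K0; rewrite /= in_itv/= ltxx].
move=> [r /= r0 hr]; exists r => // t Kt.
have t0 : 0 < t by have := K0 t Kt; rewrite /= in_itv/= andbT.
rewrite leNgt; apply/negP => tr; apply: (hr t) => //=.
by rewrite /= sub0r normrN gtr0_norm.
Qed.

(** An open set of the plane is the union of the rational open rectangles that it
    contains. *)
Lemma open_measurable_plane (R : realType) (U : set (R * R)) : open U -> measurable U.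
Proof.
move=> oU.
pose box (q : (rat * rat) * (rat * rat)) : set (R * R) :=
  `]ratr q.1.1, ratr q.1.2[%classic `*` `]ratr q.2.1, ratr q.2.2[%classic.
have -> : U = \bigcup_q (if `[< box q `<=` U >] then box q else set0).
  apply/seteqP; split=> [[x y] Uxy|z [q _]]; last by case: asboolP => // qU /qU.
  have [e /= e0 eU] : nbhs_ball (x, y) U by apply/nbhs_ballP; exact: open_nbhs_nbhs.
  have lo s : s - e < s by rewrite gtrDl oppr_lt0.
  have hi s : s < s + e by rewrite ltrDl.
  have [a1 /[!in_itv]/= /andP[a1l a1r]] := rat_in_itvoo (lo x).
  have [a2 /[!in_itv]/= /andP[a2l a2r]] := rat_in_itvoo (hi x).
  have [b1 /[!in_itv]/= /andP[b1l b1r]] := rat_in_itvoo (lo y).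
  have [b2 /[!in_itv]/= /andP[b2l b2r]] := rat_in_itvoo (hi y).
  have near_pt c1 c2 s s' : s - e < c1 -> c2 < s + e -> c1 < s' -> s' < c2 -> ball s e s'.
    by move=> h1 h2 h3 h4; rewrite /ball/= ltr_norml; apply/andP; split; lra.
  exists ((a1, a2), (b1, b2)) => //; rewrite asboolT.
    by split; rewrite /= in_itv/=; apply/andP; split.
  move=> [x' y'] [/= /[!in_itv]/= /andP[h1 h2] /andP[h3 h4]]; apply: eU; split => /=.
    exact: near_pt h1 h2.
  exact: near_pt h3 h4.
apply: countable_bigcupT_measurable => [|q]; first exact: countableP.
by case: ifP => // _; apply: measurableX; exact: measurable_itv.
Qed.

Lemma measurable_continuous_plane (R : realType) (h : R * R -> R) : continuous h ->
  measurable_fun setT h.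
Proof.
move=> /continuousP ch; apply: (measurability _ (RGenOpens.measurableE R)).
move=> _ [_ [a [b ->] <-]]; rewrite setTI; apply: open_measurable_plane.
exact/ch/interval_open.
Qed.

(** * Convergence *)

Section convergence.
Context (R : realType).
Variables (lambda gamma : R) (f0 : R -> R) (m C : R).
Variables (fe : R -> R -> R -> R) (ge : R -> R -> R * R -> R) (f : R -> R -> R).
Hypotheses (lambda_gt0 : 0 < lambda) (gamma_gt0 : 0 < gamma).
Hypotheses (m_ge0 : 0 <= m) (C_ge0 : 0 <= C).
Hypothesis fe_euler : forall eps, 0 < eps -> eps <= 1 ->
  euler_curve lambda gamma f0 m C eps (fe eps).
Hypothesis f_euler : euler_curve lambda gamma f0 m C 0 f.
Hypothesis f_close : forall eps t N, 0 < eps -> eps <= 1 -> 0 <= t -> (0 < N)%N ->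
  (n1 (leb R) (fun x => fe eps t x - f t x) <=
   (expR (8 * lambda * m * t) * C * (2 * t ^+ 2 / N%:R + eps * (N%:R + t)))%:E)%E.
Hypothesis ge_relax : forall eps t, 0 < eps -> eps <= 1 -> 0 <= t ->
  [/\ measurable_fun setT (ge eps t), (n1 (leb2 R) (ge eps t) < +oo)%E &
  (n1 (leb2 R) (fun z => ge eps t z - pair_density lambda gamma (fe eps t) z) <=
    (C * (expR (- (gamma / eps * t)) + eps))%:E)%E].
Implicit Types (t e eps T r : R).

Let K := pair_density lambda gamma.
Let l0 : 0 <= lambda. Proof. exact: ltW. Qed.
Let ga0 : 0 <= gamma. Proof. exact: ltW. Qed.

(** N is chosen first, to make the discretization error at most e / 2 on [0, T]; the
    relaxation error is then linear in eps. *)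
Lemma strong_cvg_f T e : 0 <= T -> 0 < e ->
  \forall eps \near 0^'+, forall t, 0 <= t -> t <= T ->
    (n1 (leb R) (fun x => fe eps t x - f t x) <= e%:E)%E.
Proof.
move=> T0 e0; pose E := expR (8 * lambda * m * T) * C.
have E0 : 0 <= E by rewrite mulr_ge0// expR_ge0.
pose N := (Num.bound (E * (2 * T ^+ 2) / (e / 2))).+1.
have N0 : 0 < N%:R :> R by rewrite ltr0n.
have e20 : 0 < e / 2 by rewrite divr_gt0.
have NE : E * (2 * T ^+ 2) / N%:R <= e / 2.
  rewrite ler_pdivrMr// [leRHS]mulrC -ler_pdivrMr//.
  have X0 : 0 <= E * (2 * T ^+ 2) / (e / 2).
    by rewrite divr_ge0 ?(ltW e20)// mulr_ge0// mulr_ge0// sqr_ge0.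
  apply: le_trans (ltW (archi_boundP X0)) _.
  by rewrite /N ler_nat leqnSn.
have A0 : 0 <= E * (N%:R + T) by rewrite mulr_ge0// addr_ge0.
have := near_linear_small A0 e20; apply: filterS => eps [p0 p1 pe] t t0 tT.
apply: le_trans (f_close p0 p1 t0 (ltn0Sn _ : (0 < N)%N)) _; rewrite lee_fin.
apply: (@le_trans _ _ (E * (2 * T ^+ 2 / N%:R + eps * (N%:R + T)))); last first.
  rewrite [leLHS]mulrDr [e in leRHS](splitr e); apply: lerD; first by rewrite mulrA.
  by rewrite mulrCA mulrC.
apply: ler_pM.
- by rewrite mulr_ge0// expR_ge0.
- rewrite addr_ge0//; first by rewrite divr_ge0// mulr_ge0// sqr_ge0.
  by rewrite mulr_ge0 ?(ltW p0)// addr_ge0.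
- by apply: ler_wpM2r => //; rewrite ler_expR; apply: ler_wpM2l => //; rewrite !mulr_ge0.
apply: lerD.
  apply: ler_wpM2r; first by rewrite invr_ge0 ltW.
  by apply: ler_wpM2l => //; apply: lerXn2r.
by apply: ler_wpM2l; [exact: ltW|rewrite lerD2l].
Qed.

Let mf t : 0 <= t -> measurable_fun setT (f t).
Proof. exact: euler_measurable f_euler. Qed.

Let fm t : 0 <= t -> (n1 (leb R) (f t) <= m%:E)%E.
Proof. by have [_ _ h _ _] := f_euler; exact: h. Qed.

Lemma expRN_le_inv (x : R) : 0 < x -> expR (- x) <= x^-1.
Proof.
move=> x0; rewrite expRN lef_pV2 ?posrE ?expR_gt0//.
by apply: le_trans (expR_ge1Dx x); rewrite lerDr.
Qed.

(** For t >= r the initial layer has size e^(- gamma t / eps) <= eps / (gamma r). *)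
Lemma strong_cvg_g r T e : 0 < r -> 0 <= T -> 0 < e ->
  \forall eps \near 0^'+, forall t, r <= t -> t <= T ->
    (n1 (leb2 R) (fun z => ge eps t z - K (f t) z) <= e%:E)%E.
Proof.
move=> r0 T0 e0; have e20 : 0 < e / 2 by rewrite divr_gt0.
pose B := 2 * lambda * m / gamma + 1.
have B0 : 0 < B by rewrite ltr_wpDl// divr_ge0// !mulr_ge0.
have A0 : 0 <= C * ((gamma * r)^-1 + 1).
  by rewrite mulr_ge0// addr_ge0// invr_ge0 mulr_ge0// ltW.
have nf := strong_cvg_f T0 (divr_gt0 e20 B0).
apply: filterS2 nf (near_linear_small A0 e20) => eps nf [p0 p1 pe] t rt tT.
have t_gt0 := lt_le_trans r0 rt; have t0 := ltW t_gt0.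
have [mg _ gK] := ge_relax p0 p1 t0.
have mfe := euler_measurable (fe_euler p0 p1) t0.
have mKfe : measurable_fun setT (K (fe eps t)) := measurable_pair_density lambda gamma mfe.
have mKf : measurable_fun setT (K (f t)) := measurable_pair_density lambda gamma (mf t0).
have [_ _ fem _ _] := fe_euler p0 p1.
have KK := n1_pair_densityB_le lambda_gt0 gamma_gt0 mfe (mf t0) (fem t t0) (fm t0) (nf t t0 tT).
apply: (n1_trans_le (leb2 R) mg mKf mKfe gK KK).
rewrite [leRHS](splitr e); apply: lerD.
  apply: le_trans pe; rewrite -[leRHS]mulrA; apply: ler_wpM2l => //.
  rewrite mulrDl mul1r lerD2r.
  have x0 : 0 < gamma / eps * t by rewrite mulr_gt0// divr_gt0.
  apply: le_trans (expRN_le_inv x0) _.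
  have -> : (gamma / eps * t)^-1 = (gamma * t)^-1 * eps.
    by field; rewrite !gt_eqF.
  apply: ler_wpM2r; first exact: ltW.
  by rewrite lef_pV2 ?posrE ?mulr_gt0// ler_pM2l.
have -> : lambda / gamma * (2 * m * (e / 2 / B)) = 2 * lambda * m / gamma / B * (e / 2).
  by move: (B) => b; ring.
apply: ler_piMl; first exact: ltW.
by rewrite ler_pdivrMr// mul1r lerDl.
Qed.

Lemma weak_cvg : weak_L1_cvg_loc_unif `[0, +oo[%classic fe f.
Proof.
have foo t : 0 <= t -> (n1 (leb R) (f t) < +oo)%E.
  by move=> t0; apply: le_lt_trans (fm t0) _; exact: ltry.
split=> [t|h /Lfun_oo_bounded[mh [B B0 hB]] J cJ J0].
  by rewrite /= in_itv/= andbT => t0; apply/integrable_n1P; split; [exact: mf|exact: foo].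
have [T T0 JT] := compact_bound cJ; apply: uniform_limit => e e0.
have B1 : 0 < B + 1 by rewrite ltr_wpDl.
have small1 := near_linear_small (lexx (0 : R)) e0.
apply: filterS2 small1 (strong_cvg_f T0 (divr_gt0 e0 B1)) => eps [p0 p1 _] nf t Jt.
have t0 : 0 <= t by have := J0 t Jt; rewrite /= in_itv/= andbT.
have mfe := euler_measurable (fe_euler p0 p1) t0.
have [_ _ fem _ _] := fe_euler p0 p1.
have feoo : (n1 (leb R) (fe eps t) < +oo)%E.
  by apply: le_lt_trans (fem t t0) _; exact: ltry.
have D := @test_distance_le _ _ R (leb R) _ _ h _ _ mfe (mf t0) mh feoo (foo t t0) hB B0
  (nf t t0 (JT t Jt)).
apply: le_trans D _.
rewrite mulrCA; apply: ler_piMr; first exact: ltW.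
by rewrite ler_pdivrMr// mul1r lerDl.
Qed.

(** A compact subset of the open half line lies in some [r, T] with r > 0, where the
    pair densities converge in norm. *)
Lemma tight_cvg : tight_cvg_loc_unif `]0, +oo[%classic ge
  (limit_pair_density lambda gamma f).
Proof.
have mK t : 0 <= t -> measurable_fun setT (K (f t)).
  by move=> t0; exact: measurable_pair_density (mf t0).
have Koo t : 0 <= t -> (n1 (leb2 R) (K (f t)) < +oo)%E.
  move=> t0; apply: le_lt_trans (n1_pair_density_le lambda_gt0 gamma_gt0 (mf t0) (fm t0)) _.
  exact: ltry.
split=> [t|h ch [M [_ HM]] J cJ J0].
  rewrite /= in_itv/= andbT => /ltW t0.
  by apply/integrable_n1P; split; [exact: mK|exact: Koo].
have [r r0 Jr] := compact_pos_lower cJ J0.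
have [T T0 JT] := compact_bound cJ; apply: uniform_limit => e e0.
pose B := Num.max 0 (M + 1); have B0 : 0 <= B by rewrite le_max lexx.
have MM : M < M + 1 by rewrite ltrDl.
have hB : {ae leb2 R, forall z, `|h z| <= B}.
  by apply: aeW => z; rewrite le_max (HM _ MM z I) orbT.
have mh := measurable_continuous_plane ch.
have B1 : 0 < B + 1 by rewrite ltr_wpDl.
have small1 := near_linear_small (lexx (0 : R)) e0.
apply: filterS2 small1 (strong_cvg_g r0 T0 (divr_gt0 e0 B1)) => eps [p0 p1 _] ng t Jt.
have t0 : 0 <= t := le_trans (ltW r0) (Jr t Jt).
have [mg goo _] := ge_relax p0 p1 t0.
have D := @test_distance_le _ _ R (leb2 R) _ _ h _ _ mg (mK t t0) mh goo (Koo t t0) hB B0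
  (ng t (Jr t Jt) (JT t Jt)).
apply: le_trans D _.
rewrite mulrCA; apply: ler_piMr; first exact: ltW.
by rewrite ler_pdivrMr// mul1r lerDl.
Qed.

End convergence.

Lemma moment_n1_lty d (T : measurableType d) (R : realType) (mu : {measure set T -> \bar R})
    (u p : T -> R) : measurable_fun setT u -> measurable_fun setT p ->
  (forall x, 0 <= u x) -> (\int[mu]_x ((1 + p x ^+ 2) * u x)%:E < +oo)%E ->
  (n1 mu u < +oo)%E.
Proof.
move=> mU mp u0; apply: le_lt_trans; apply: ge0_le_integral => //.
- exact: measurable_normE.
- apply/measurable_EFinP; apply: measurable_funM => //; apply: measurable_funD => //.
  exact: measurable_funX.
by move=> x _; rewrite lee_fin ger0_norm// ler_peMl// lerDl sqr_ge0.
Qed.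

Theorem theorem6 (R : realType) (lambda gamma : R)
    (lambda_gt0 : 0 < lambda) (gamma_gt0 : 0 < gamma)
    (f0 : R -> R) (g0 : R * R -> R)
    (f0_meas : measurable_fun [set: R] f0)
    (g0_meas : measurable_fun [set: R * R] g0)
    (f0_ge0 : forall x, 0 <= f0 x) (g0_ge0 : forall z, 0 <= g0 z)
    (f0_moment : (\int[leb R]_x ((1 + x ^+ 2) * f0 x)%:E < +oo)%E)
    (g0_moment : (\int[leb2 R]_z ((1 + z.1 ^+ 2) * g0 z)%:E < +oo)%E)
    (g0_sym : forall x y, g0 (x, y) = g0 (y, x))
    (f0_entropy : (leb R).-integrable [set: R] (fun x => (f0 x * ln (f0 x))%:E))
    (g0_entropy :
       (leb2 R).-integrable [set: R * R] (fun z => (g0 z * ln (g0 z))%:E))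
    (feps : R -> R -> R -> R) (geps : R -> R -> R * R -> R)
    (sol_eps : forall eps, 0 < eps ->
       mild_solution lambda gamma eps f0 g0 (feps eps) (geps eps)) :
  exists f : R -> R -> R,
    [/\ limit_solution lambda gamma f0 f,
        forall f' : R -> R -> R, limit_solution lambda gamma f0 f' ->
          forall t, 0 <= t -> {ae leb R, forall x, f' t x = f t x},
        weak_L1_cvg_loc_unif `[0, +oo[%classic feps f &
        tight_cvg_loc_unif `]0, +oo[%classic geps
          (limit_pair_density lambda gamma f)].
Proof.
have f0oo := @moment_n1_lty _ _ R (leb R) f0 id f0_meas (@measurable_id _ _ _) f0_ge0 f0_moment.
have g0oo := @moment_n1_lty _ _ R (leb2 R) g0 fst g0_meas (@measurable_fst _ _ _ _) g0_ge0
  g0_moment.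
have [m [C [m0 C0 mildP]]] :=
  mild_estimates lambda_gt0 gamma_gt0 f0_meas f0oo g0_meas g0oo g0_ge0.
have eu eps : 0 < eps -> eps <= 1 -> euler_curve lambda gamma f0 m C eps (feps eps).
  by move=> e0 e1; have [] := mildP eps _ _ e0 e1 (sol_eps eps e0).
have relax eps t : 0 < eps -> eps <= 1 -> 0 <= t ->
    [/\ measurable_fun setT (geps eps t), (n1 (leb2 R) (geps eps t) < +oo)%E &
    (n1 (leb2 R) (fun z => geps eps t z - pair_density lambda gamma (feps eps t) z) <=
    (C * (expR (- (gamma / eps * t)) + eps))%:E)%E].
  by move=> e0 e1 t0; have [_] := mildP eps _ _ e0 e1 (sol_eps eps e0); exact.
pose f := limit_curve feps.
have f_euler : euler_curve lambda gamma f0 m C 0 f.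
  exact: limit_curve_euler lambda_gt0 gamma_gt0 f0_meas m0 C0 eu.
have f_close eps t N : 0 < eps -> eps <= 1 -> 0 <= t -> (0 < N)%N ->
    (n1 (leb R) (fun x => feps eps t x - f t x) <=
    (expR (8 * lambda * m * t) * C * (2 * t ^+ 2 / N%:R + eps * (N%:R + t)))%:E)%E.
  exact: (n1_limit_curve_le lambda_gt0 gamma_gt0 f0_meas m0 C0 eu).
exists f; split.
- exact: euler_limit_solution f_euler.
- move=> f' sol' t t0.
  have mf := euler_measurable f_euler t0.
  have mf' : measurable_fun setT (f' t).
    by have [[_ h _] _ _] := sol'; have /integrable_n1P[] := h t t0.
  apply: (n1_eq0_ae (leb R) mf' mf).
  exact: (limit_solution_unique lambda_gt0 gamma_gt0 f0_meas m0 C0 f_euler sol' t0).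
- exact: (weak_cvg lambda_gt0 m0 C0 eu f_euler f_close).
- exact: (tight_cvg lambda_gt0 gamma_gt0 m0 C0 eu f_euler f_close relax).
Qed.
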